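(* Consider the Stochastic Block Model under random dyad sampling, assume (A1)–(A4) of the context and $\rho=\rho_n\gg\log(n)/n$ (i.e. $n\rho_n/\log n\to\infty$). Let $\widehat\theta_{MLE}=(\widehat\alpha_{MLE},\widehat\pi_{MLE})$ be the maximum likelihood estimator, i.e. a maximizer of $\theta\mapsto p(\mathbf y^o;\theta)$ over $\Theta$. Then there exist permutations $s$ of $\{1,\dots,Q\}$ (depending on $n$ and on the data) such that, as $n\to\infty$, $$\hat\alpha(\mathbf z^\star)-\widehat\alpha_{MLE}^{\,s}=o_P\bigl(n^{-1/2}\bigr),\qquad \hat\pi(\mathbf z^\star)-\widehat\pi_{MLE}^{\,s}=o_P\bigl(n^{-1}\bigr).$$
   Context: **Model.** $Q\ge1$ is fixed and known; there are $n$ nodes. Let $\varphi(y,\pi)=b(y)\exp(\pi y-\psi(\pi))$, $\pi\in\mathcal A\subset\mathbb R$, be a regular one-dimensional exponential family in canonical form (densities with respect to a fixed dominating measure); on the interior $\mathring{\mathcal A}$, $\psi$ is smooth and convex, and $\psi'(\pi)$, $\psi''(\pi)>0$ are the mean and variance of $\varphi(\cdot,\pi)$. A parameter is $\theta=(\alpha,\pi)$ with $\alpha=(\alpha_1,\dots,\alpha_Q)$ a probability vector and $\pi=(\pi_{q\ell})$ a $Q\times Q$ matrix. Under $\theta$: $z_1,\dots,z_n$ are i.i.d. with $\mathbb P(z_i=q)=\alpha_q$; conditionally on $\mathbf z$, the variables $y_{ij}$ (ordered pairs $i\ne j$) are independent with $y_{ij}\sim\varphi(\cdot,\pi_{z_iz_j})$.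 Data are generated under a fixed true parameter $\theta^\star=(\alpha^\star,\pi^\star)$, with true memberships $\mathbf z^\star$. Write $z_{iq}=1$ if $z_i=q$ and $0$ otherwise. **Random dyad sampling.** The $r_{ij}$ ($i\ne j$) are i.i.d. Bernoulli($\rho$), independent of everything else; one observes $\mathbf r$ and $\mathbf y^{o}=\{y_{ij}:r_{ij}=1\}$. **Likelihoods.** $p(\mathbf y^o,\mathbf z;\theta)=\prod_i\alpha_{z_i}\prod_{i\neq j:\,r_{ij}=1}\varphi(y_{ij},\pi_{z_iz_j})$ and $p(\mathbf y^o;\theta)=\sum_{\mathbf z}p(\mathbf y^o,\mathbf z;\theta)$, the sum being over $\{1,\dots,Q\}^n$. **Estimators with known memberships.** For an assignment $\mathbf z$: $\hat\alpha_q(\mathbf z)=\frac1n\sum_i z_{iq}$, $\hat y_{q\ell}(\mathbf z)=\frac{\sum_{i\ne j}y_{ij}r_{ij}z_{iq}z_{j\ell}}{\sum_{i\ne j}r_{ij}z_{iq}z_{j\ell}}$, $\hat\pi_{q\ell}(\mathbf z)=(\psi')^{-1}(\hat y_{q\ell}(\mathbf z))$ (with an arbitrary value when undefined). **Assumptions.** (A1) There are a constant $c>0$ and a compact interval $C_\pi\subset\mathring{\mathcal A}$ with $\Theta\subset[c,1-c]^Q\times C_\pi^{Q\times Q}$, where $\Theta$ is the parameter space. (A2) $\theta^\star$ lies in the interior of $\Theta$. (A3) The map $\pi\mapsto\varphi(\cdot,\pi)$ is injective. (A4) The coordinates of the vector $\psi'(\pi^\star)\alpha^\star$ ($\psi'$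 applied entrywise to the matrix $\pi^\star$) are pairwise distinct. **Permutations.** $\alpha^s=(\alpha_{s(q)})_q$ and $\pi^s=(\pi_{s(q)s(\ell)})_{q,\ell}$. Stochastic orders are under $\mathbb P_{\theta^\star}$. *)

(* Defs.v *)
From HB Require Import structures.
From mathcomp Require Import all_boot all_order all_fingroup all_algebra.
From mathcomp Require Import all_classical all_reals all_analysis.

Set Implicit Arguments.
Unset Strict Implicit.
Unset Printing Implicit Defensive.

Import Order.TTheory GRing.Theory Num.Theory.
Import numFieldNormedType.Exports.

Local Open Scope classical_set_scope.
Local Open Scope ring_scope.

Section exponential_family.
Context {R : realType}.
Implicit Types (A : set R) (b psi : R -> R) (mu : {measure set R -> \bar R}).

Definition phi b psi (y p : R) : R := b y * expR (p * y - psi p).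

(* Outside [A], [psi] is unconstrained; every condition on its derivatives is
   imposed at interior points of [A] only. *)
Record expfam mu A b psi : Prop := Expfam {
  expfam_measurable : measurable_fun setT b;
  expfam_ge0 : forall y, 0 <= b y;
  expfam_density : forall p, A p -> (\int[mu]_y (phi b psi y p)%:E = 1)%E;
  expfam_interval : is_interval A°;
  expfam_smooth : forall k p, A° p -> derivable (derive1n k psi) p 1;
  expfam_convex : convex_function (A° : set (convex_lmodType R^o)) psi;
  expfam_mean : forall p, A° p ->
    (\int[mu]_y (y * phi b psi y p)%:E = (derive1 psi p)%:E)%E;
  expfam_variance : forall p, A° p ->
    (\int[mu]_y ((y - derive1 psi p) ^+ 2 * phi b psi y p)%:E
      = (derive1n 2 psi p)%:E)%E;
  expfam_variance_gt0 : forall p, A° p -> 0 < derive1n 2 psi p }.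

End exponential_family.

Section parameters.
Context {R : realType} {Q : nat}.

Definition param : Type := ('rV[R]_Q * 'M[R]_Q)%type.

Implicit Types (t : param) (Theta : set param) (A : set R).

Definition prob_vector (alpha : 'rV[R]_Q) : Prop :=
  (forall q, 0 <= alpha 0 q) /\ \sum_q alpha 0 q = 1.

Definition param_box (c lo hi : R) : set param :=
  [set t : param | (forall q, c <= t.1 0 q <= 1 - c) /\
           (forall q l, lo <= t.2 q l <= hi)].

Definition compact_param_space A Theta : Prop :=
  exists c lo hi : R, [/\ 0 < c, `[lo, hi] `<=` A° &
    Theta `<=` param_box c lo hi].

(* Probability vectors have empty interior in R^Q, so the interior is taken
   relative to (probability vectors) x (matrices). *)
Definition param_interior Theta : set param :=
  [set t : param | Theta t /\ within [set u : param | prob_vector u.1] (nbhs t) Theta].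

Definition distinct_mean_degrees (psi : R -> R) t : Prop :=
  injective (fun q => (map_mx (derive1 psi) t.2 *m t.1^T) q 0).

Definition perm_alpha (s : 'S_Q) (alpha : 'rV[R]_Q) : 'rV[R]_Q :=
  \row_q alpha 0 (s q).

Definition perm_pi (s : 'S_Q) (pi : 'M[R]_Q) : 'M[R]_Q :=
  \matrix_(q, l) pi (s q) (s l).

End parameters.

Arguments param R Q : clear implicits.

Section block_model.
Context {R : realType} {Q n : nat}.

(* The distribution of (z, y, r) on n nodes: z is i.i.d. with law alpha; given
   z, the y_ij are independent with density phi(., pi_{z_i z_j}); the r_ij are
   i.i.d. Bernoulli(rho), independent of (z, y).  Rectangles suffice to
   characterize the joint law.  The diagonal entries of y and r play no role. *)
Record sbm_dyad_sample d (T : measurableType d) (P : probability T R)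
    (mu : {measure set R -> \bar R}) (b psi : R -> R) (t : param R Q) (rho : R)
    (z : T -> 'I_n -> 'I_Q) (y : T -> 'I_n -> 'I_n -> R)
    (r : T -> 'I_n -> 'I_n -> bool) : Prop := SbmDyadSample {
  sbm_measurable_z : forall i q, measurable [set w | z w i = q];
  sbm_measurable_y : forall i j, i != j -> measurable_fun setT (fun w => y w i j);
  sbm_measurable_r : forall i j, i != j -> measurable_fun setT (fun w => r w i j);
  sbm_law_z : forall zz : 'I_n -> 'I_Q,
    P [set w | forall i, z w i = zz i] = (\prod_i t.1 0 (zz i))%:E;
  sbm_law_y : forall (zz : 'I_n -> 'I_Q) (B : 'I_n -> 'I_n -> set R),
    (forall i j, measurable (B i j)) ->
    (P [set w | (forall i, z w i = zz i) /\
                (forall i j, i != j -> B i j (y w i j))] =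
     P [set w | forall i, z w i = zz i] *
     \prod_i \prod_(j | i != j)
       \int[mu]_(x in B i j) (phi b psi x (t.2 (zz i) (zz j)))%:E)%E;
  sbm_law_r : forall rr : 'I_n -> 'I_n -> bool,
    P [set w | forall i j, i != j -> r w i j = rr i j] =
    (\prod_i \prod_(j | i != j) (if rr i j then rho else 1 - rho))%:E;
  sbm_indep : forall (zz : 'I_n -> 'I_Q) (B : 'I_n -> 'I_n -> set R)
      (rr : 'I_n -> 'I_n -> bool),
    (forall i j, measurable (B i j)) ->
    (P ([set w | (forall i, z w i = zz i) /\
                 (forall i j, i != j -> B i j (y w i j))] `&`
        [set w | forall i j, i != j -> r w i j = rr i j]) =
     P [set w | (forall i, z w i = zz i) /\
                (forall i j, i != j -> B i j (y w i j))] *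
     P [set w | forall i j, i != j -> r w i j = rr i j])%E }.

(* The observed data (r, y^o): entry (i, j) is [Some y_ij] if r_ij = 1 and
   [None] if r_ij = 0; the diagonal is [None]. *)
Definition observation : Type := 'I_n -> 'I_n -> option R.

Definition observe (y : 'I_n -> 'I_n -> R) (r : 'I_n -> 'I_n -> bool) :
    observation :=
  fun i j => if (i != j) && r i j then Some (y i j) else None.

Definition complete_likelihood (b psi : R -> R) (o : observation)
    (z : 'I_n -> 'I_Q) (t : param R Q) : R :=
  (\prod_i t.1 0 (z i)) *
  \prod_i \prod_(j | i != j)
    (if o i j is Some x then phi b psi x (t.2 (z i) (z j)) else 1).

Definition likelihood (b psi : R -> R) (o : observation) (t : param R Q) : R :=
  \sum_(z : {ffun 'I_n -> 'I_Q}) complete_likelihood b psi o z t.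

Definition is_mle (b psi : R -> R) (Theta : set (param R Q)) (o : observation)
    (t : param R Q) : Prop :=
  Theta t /\ forall u, Theta u -> likelihood b psi o u <= likelihood b psi o t.

Definition alpha_hat (z : 'I_n -> 'I_Q) : 'rV[R]_Q :=
  \row_q (n%:R^-1 * \sum_i (z i == q)%:R).

Definition dyad_count (r : 'I_n -> 'I_n -> bool) (z : 'I_n -> 'I_Q)
    (q l : 'I_Q) : R :=
  \sum_i \sum_(j | i != j) (r i j)%:R * (z i == q)%:R * (z j == l)%:R.

Definition y_hat (y : 'I_n -> 'I_n -> R) (r : 'I_n -> 'I_n -> bool)
    (z : 'I_n -> 'I_Q) (q l : 'I_Q) : R :=
  (\sum_i \sum_(j | i != j)
     y i j * (r i j)%:R * (z i == q)%:R * (z j == l)%:R) / dyad_count r z q l.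

(* (psi')^-1 (y_hat), where psi' is inverted on the interior of [A]; the value
   is [dflt] when there is no observed dyad in the block or y_hat is not in the
   range of psi'. *)
Definition pi_hat (A : set R) (psi : R -> R) (dflt : R)
    (y : 'I_n -> 'I_n -> R) (r : 'I_n -> 'I_n -> bool) (z : 'I_n -> 'I_Q) :
    'M[R]_Q :=
  \matrix_(q, l) xget dflt
    [set p | [/\ A° p, dyad_count r z q l != 0 & derive1 psi p = y_hat y r z q l]].

End block_model.

Arguments observation R n : clear implicits.

(* X_n = o_P(a_n).  The outer measure [mu_ext (P n)] extends [P n] to all sets
   and agrees with it on measurable ones; it is used because no measurability
   is required of the estimator or of the permutations. *)
Definition little_oP {R : realType} (d : nat -> measure_display)
    (T : forall n, measurableType (d n)) (P : forall n, probability (T n) R)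
    {k l : nat} (X : forall n, T n -> 'M[R]_(k, l)) (a : nat -> R) : Prop :=
  forall e : R, 0 < e ->
    (mu_ext (P n) [set w | e * a n < `|X n w|]) @[n --> \oo] --> 0%E.

(* Main.v *)
Require Import Defs.
From mathcomp Require Import all_boot all_order all_fingroup all_algebra.
From mathcomp Require Import all_classical all_reals all_analysis.
From mathcomp Require Import ring lra measurable_realfun.

Import Order.TTheory GRing.Theory Num.Theory.
Import numFieldNormedType.Exports.

Set Implicit Arguments.
Unset Strict Implicit.
Unset Printing Implicit Defensive.

Local Open Scope classical_set_scope.
Local Open Scope ring_scope.

(** Let [zs] be the true memberships, [w(t, z)] the complete likelihood of the
    observed data at parameter [t] and assignment [z], and
    [th = (alpha_hat zs, pi_hat zs)] the maximizer of [t |-> w(t, zs)].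
    The likelihood is [sum_z w(t, z)], and a relabelling [s] of the classes turns
    [w(t, s o z)] into [w(t^s, z)].  The theorem holds because, up to relabelling,
    the sum over [z] is carried by the single term [z = zs].

    Assignments far from every relabelling of [zs].  For a fixed [pi], the square
    root of the likelihood ratio of [(z, pi)] against the truth has conditional
    expectation at most [exp (- rho * H)], where [H] adds up, over the dyads, one
    minus the Bhattacharyya affinity of the two densities; this is exact
    algebra in an exponential family.  If [H] is below a small multiple of [n^2]
    then the confusion matrix of [z] and [zs] forces a permutation
    ([identifiability]; distinct mean degrees make the rows of the true matrix
    distinct).  All other [z] are handled by a union over [Q^n] assignments and a
    finite grid of matrices, since [rho * n^2] dominates [n] ([bad_far]).

    Assignments near [zs].  If [z] differs from [zs] at [k] nodes, then [H] is at
    least of order [k * n], so the sum of the square roots over all such [z] is of order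
    [n * exp (- kappa * n * rho)], which is below every power of [1/n] because
    [n * rho] dominates [log n] ([bad_local]).  Passing from the true parameter to
    a nearby one costs a factor [exp (small * k * n * rho)], by the bound on the
    total load of each node ([bad_loads], [loglik_perturb_local]).

    Hence, off an event of probability [O(1/n)] and with relative error
    [O(n^-2)], the likelihood at any [t] of the parameter space is bounded by the sum over [s] of
    [w(t^s, zs)] ([likelihood_upper]).  The function [w(., zs)] is explicit:
    [w(t, zs) <= w(th, zs) * exp (- V)] where [V] is at least a constant times
    [n |alpha - alpha_hat|^2 + rho n^2 |pi - pi_hat|^2] ([weight_le_max]).  As the
    maximum likelihood estimator does at least as well as [th], which lies in the parameter space
    on the same event, one term [s] must carry the sum and its [V] must be
    [O(n^-2)] ([dominant_term]).  This is stronger than what an [o(1)] relative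
    error would give: the latter yields only [o((rho * n^2)^(-1/2))] for [pi], which is not
    [o(1/n)] when [rho] tends to [0].

    The exceptional events about the observed dyads are controlled by Markov's
    inequality applied to a finite sum of products of functions of the single
    dyads ([conditional_markov]);
    everything else is deterministic ([good_data_mle]).  The estimator is aligned
    by the permutation that brings it close to the true parameter.  That
    permutation depends on the observation only, and it is unique because a
    parameter with distinct mean degrees has no symmetry. *)

(** * Convexity of the log-partition function *)

Lemma mvt_interval (R : realType) (J : set R) (f : R -> R) :
  is_interval J -> (forall p, J p -> derivable f p 1) ->
  forall p q, J p -> J q -> exists c,
    [/\ J c, f q - f p = derive1 f c * (q - p) & (p <= c <= q) || (q <= c <= p)].
Proof.
move=> Jint df.
have main p q : p <= q -> J p -> J q -> exists c,
    [/\ J c, f q - f p = derive1 f c * (q - p) & p <= c <= q].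
  move=> pq Jp Jq.
  have Jpq x : x \in `[p, q] -> J x.
    by rewrite in_itv /= => /Jint; exact.
  have [||c /[dup] /Jpq Jc] := @MVT_segment R f (derive1 f) p q pq.
  - move=> x xpq; rewrite derive1E; apply: derivableP; apply: df; apply: Jpq.
    exact: subset_itv_oo_cc xpq.
  - by apply: derivable_within_continuous => x /Jpq /df.
  by rewrite in_itv /= => cpq e; exists c.
move=> p q Jp Jq; case: (leP p q) => pq.
  by have [c [Jc e h]] := main _ _ pq Jp Jq; exists c; rewrite h.
have [c [Jc e cqp]] := main _ _ (ltW pq) Jq Jp.
by exists c; split; rewrite ?cqp ?orbT// -opprB e -mulrN opprB.
Qed.

Lemma itv_mem_le (R : realType) (a b x : R) : `[a, b]%classic x = (a <= x <= b).
Proof. by rewrite /= in_itv. Qed.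

(** Strong convexity and Lipschitz continuity of the log-partition function, with a
    margin [tau] around the parameter interval: exponential moments of order up to [tau]
    stay within the margin.  Every later estimate on the densities uses only
    these constants. *)
Record tame {R : realType} (psi : R -> R) (lo hi tau m L : R) : Prop := Tame {
  tame_tau : 0 < tau;
  tame_m : 0 < m;
  tame_L : 1 <= L;
  tame_convex : forall p q, lo - tau <= p <= hi + tau -> lo - tau <= q <= hi + tau ->
    psi q + derive1 psi q * (p - q) + m / 2 * (p - q) ^+ 2 <= psi p;
  tame_lip : forall p q, lo - tau <= p <= hi + tau -> lo - tau <= q <= hi + tau ->
    `|psi p - psi q| <= L * `|p - q| }.

(** The second derivative is continuous and positive, hence bounded below on a
    compact neighbourhood of the parameter interval. *)
Lemma tame_exists {R : realType} (mu : {measure set R -> \bar R}) (A : set R)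
    (b psi : R -> R) (lo hi : R) :
  expfam mu A b psi -> lo <= hi -> `[lo, hi] `<=` A° ->
  exists tau m L : R, tame psi lo hi tau m L /\
    (forall x, lo - tau <= x <= hi + tau -> A° x).
Proof.
move=> ef lohi sub.
have oA : open A° by exact: open_interior.
have [e1 e1_gt0 be1] : exists2 e : R, 0 < e & forall x, `|lo - x| < e -> A° x.
  have /nbhs_ballP[e /= e0 be] : nbhs lo A°.
    by apply: oA; apply: sub; rewrite itv_mem_le lexx.
  by exists e.
have [e2 e2_gt0 be2] : exists2 e : R, 0 < e & forall x, `|hi - x| < e -> A° x.
  have /nbhs_ballP[e /= e0 be] : nbhs hi A°.
    by apply: oA; apply: sub; rewrite itv_mem_le lexx lohi.
  by exists e.
pose tau := Num.min e1 e2 / 2.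
have tau_gt0 : 0 < tau by rewrite divr_gt0// lt_min e1_gt0.
have [tau1 tau2] : tau < e1 /\ tau < e2.
  have : Num.min e1 e2 <= e1 /\ Num.min e1 e2 <= e2.
    by split; rewrite ge_min lexx ?orbT.
  by rewrite /tau; lra.
set lo' := lo - tau; set hi' := hi + tau.
have Alo : A° lo' by apply: be1; rewrite /lo' opprB addrC subrK gtr0_norm.
have Ahi : A° hi' by apply: be2; rewrite /hi' opprD addrA subrr sub0r normrN gtr0_norm.
have lohi' : lo' <= hi' by rewrite /lo' /hi'; lra.
have J x : lo' <= x <= hi' -> A° x by exact: (expfam_interval ef) Alo Ahi _.
have d0 p : A° p -> derivable psi p 1 by move=> /(@expfam_smooth _ _ _ _ _ ef 0%N).
have d1 p : A° p -> derivable (derive1 psi) p 1.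
  by move=> /(@expfam_smooth _ _ _ _ _ ef 1%N); rewrite derive1n1.
have d2 p : A° p -> derivable (derive1 (derive1 psi)) p 1.
  by move=> /(@expfam_smooth _ _ _ _ _ ef 2%N); rewrite derive1nS derive1n1.
have [c cin cmin] : exists2 c, lo' <= c <= hi' & forall x, lo' <= x <= hi' ->
    derive1 (derive1 psi) c <= derive1 (derive1 psi) x.
  have [|c cin cmin] := @EVT_min R (derive1 (derive1 psi)) _ _ lohi'.
    by apply: derivable_within_continuous => x; rewrite in_itv/= => /J /d2.
  exists c; first by rewrite in_itv/= in cin.
  by move=> x xin; apply: cmin; rewrite in_itv.
set m := derive1 (derive1 psi) c in cmin.
have m_gt0 : 0 < m.
  by have := expfam_variance_gt0 ef (J _ cin); rewrite derive1nS derive1n1.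
have Jint : is_interval (fun x : R => lo' <= x <= hi').
  move=> x y /= /andP[x1 x2] /andP[y1 y2] z /andP[xz zy].
  by rewrite (le_trans x1 xz) (le_trans zy y2).
have mono p q : lo' <= p <= hi' -> lo' <= q <= hi' -> p <= q ->
    m * (q - p) <= derive1 psi q - derive1 psi p.
  move=> pin qin pq.
  have [z [zin -> _]] := mvt_interval Jint (fun p hp => d1 p (J p hp)) pin qin.
  by apply: ler_wpM2r (cmin _ zin); rewrite subr_ge0.
(* [psi'] is increasing, so its modulus is bounded by the values at both ends. *)
pose L := 1 + `|derive1 psi lo'| + `|derive1 psi hi'|.
exists tau, m, L; split=> //; split=> //.
- by rewrite /L; have := normr_ge0 (derive1 psi lo'); have := normr_ge0 (derive1 psi hi'); lra.
- move=> p q pin qin.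
  (* [g] decreases before [q] and increases after it. *)
  pose g x := psi x - derive1 psi q * x - m / 2 * (x - q) ^+ 2.
  have dg x : lo' <= x <= hi' ->
      is_derive x 1 g (derive1 psi x - derive1 psi q - m * (x - q)).
    move=> /J /d0 /derivableP; rewrite -derive1E => ?.
    rewrite /g; apply: is_derive_eq.
    rewrite /GRing.scale/=; lra.
  have dg1 x : lo' <= x <= hi' -> derivable g x 1 by move=> /dg[].
  have [z [zin ge z12]] := mvt_interval Jint dg1 qin pin.
  have dgz : derive1 g z = derive1 psi z - derive1 psi q - m * (z - q).
    by rewrite derive1E; have [_ ->] := dg _ zin.
  rewrite dgz in ge.
  suff : 0 <= g p - g q by rewrite /g subrr expr0n/= mulr0 subr0; lra.
  rewrite ge; case/orP: z12 => /andP[z1 z2].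
    by rewrite mulr_ge0//; have := mono _ _ qin zin z1; lra.
  by rewrite -mulrNN mulr_ge0//; have := mono _ _ zin qin z2; lra.
- move=> p q pin qin.
  have [z [zin -> _]] := mvt_interval Jint (fun p hp => d0 p (J p hp)) qin pin.
  rewrite normrM ler_wpM2r//.
  have /andP[z1 z2] := zin.
  have h1 := mono _ _ (introT andP (conj (lexx _) lohi')) zin z1.
  have h2 := mono _ _ zin (introT andP (conj lohi' (lexx _))) z2.
  have h3 : 0 <= m * (z - lo') by rewrite mulr_ge0 ?subr_ge0// ltW.
  have h4 : 0 <= m * (hi' - z) by rewrite mulr_ge0 ?subr_ge0// ltW.
  rewrite /L ler_norml.
  have := ler_norm (derive1 psi hi'); have := lerNnormlW (lexx `|derive1 psi lo'|).
  have := normr_ge0 (derive1 psi lo'); have := normr_ge0 (derive1 psi hi').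
  by move=> *; apply/andP; split; lra.
Qed.

Section mean_parameter.
Context {R : realType} (mu : {measure set R -> \bar R}) (A : set R) (b psi : R -> R).
Hypothesis ef : expfam mu A b psi.

Lemma mean_derivable p : A° p -> derivable (derive1 psi) p 1.
Proof. by move=> /(@expfam_smooth _ _ _ _ _ ef 1%N); rewrite derive1n1. Qed.

Lemma mean_injective p q : A° p -> A° q -> derive1 psi p = derive1 psi q -> p = q.
Proof.
move=> Ap Aq e.
have [c [Ac ce _]] := mvt_interval (expfam_interval ef) mean_derivable Ap Aq.
have : derive1n 2 psi c != 0 by rewrite gt_eqF//; exact: expfam_variance_gt0 ef _ Ac.
move: ce; rewrite e subrr derive1nS derive1n1 => /esym/eqP.
by rewrite mulf_eq0 => /orP[-> //|]; rewrite subr_eq0 => /eqP.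
Qed.

Lemma mean_surjective p q v : p <= q -> (forall x, p <= x <= q -> A° x) ->
  derive1 psi p < v < derive1 psi q ->
  exists2 x, p <= x <= q & derive1 psi x = v.
Proof.
move=> pq sub /andP[pv vq].
have [||c cin ce] := @IVT R (derive1 psi) p q v pq.
- by apply: derivable_within_continuous => x; rewrite in_itv/= => /sub /mean_derivable.
- by rewrite ge_min le_max (ltW pv) (ltW vq) orbT.
by exists c => //; rewrite in_itv/= in cin.
Qed.

(** Since [psi'] is increasing, [pi_hat] is located by comparing [y_hat] with the
    values of [psi'] at two points: the Chernoff bounds on [y_hat] are stated that way. *)
Lemma pi_hat_bracket {Q n : nat} (dflt : R) (y : 'I_n -> 'I_n -> R)
    (r : 'I_n -> 'I_n -> bool) (z : 'I_n -> 'I_Q) (q l : 'I_Q) (p1 p2 : R) :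
  p1 <= p2 -> (forall x, p1 <= x <= p2 -> A° x) ->
  dyad_count r z q l != 0 :> R ->
  derive1 psi p1 < y_hat y r z q l < derive1 psi p2 ->
  p1 <= pi_hat A psi dflt y r z q l <= p2 /\
  derive1 psi (pi_hat A psi dflt y r z q l) = y_hat y r z q l.
Proof.
move=> p12 sub N0 yb; have [x xin xe] := mean_surjective p12 sub yb.
rewrite mxE; case: xgetP => [p _ [Ap _ pe]|/(_ x)].
  by rewrite (mean_injective Ap (sub _ xin)) ?xe.
by case; split => //; exact: sub.
Qed.

End mean_parameter.

(** * Expectation of a product of independent functions *)

Import HBNNSimple.
Section change_of_variables.
Local Open Scope ereal_scope.
Context {R : realType}.

Let h (g : R -> R) (mg : measurable_fun [set: R] (EFin \o g)) :=
  nnsfun_approx (@measurableT _ R) mg.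

(** The right-hand side depends on [f], [u] and [nu] only through the set function
    [B |-> \int[nu]_(x in f @^-1` B) u x]; this is how two integrals over different spaces
    are compared. *)
Lemma integral_weighted_lim d (X : measurableType d)
    (nu : {measure set X -> \bar R}) (f : X -> R) (u : X -> R) (g : R -> R)
    (mg : measurable_fun [set: R] (EFin \o g)) :
  measurable_fun setT f -> measurable_fun setT u -> (forall x, (0 <= u x)%R) ->
  (forall x, (0 <= g x)%R) ->
  \int[nu]_x ((g (f x))%:E * (u x)%:E) =
  limn (fun n => \sum_(v \in range (h mg n))
    (v%:E * \int[nu]_(x in f @^-1` (h mg n @^-1` [set v])) (u x)%:E)).
Proof.
move=> mf /measurable_EFinP mu u0 g0.
have ue0 x : 0 <= (u x)%:E by rewrite lee_fin.
have mhf n : measurable_fun setT (EFin \o h mg n \o f).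
  apply/measurable_EFinP; apply: measurableT_comp mf.
  exact/measurable_funP.
transitivity (limn (fun n => \int[nu]_x ((h mg n (f x))%:E * (u x)%:E))).
  rewrite -monotone_convergence//.
  - apply: eq_integral => x _; apply/esym/cvg_lim => //.
    have hx : (EFin \o (h mg)^~ (f x)) n @[n --> \oo] --> (g (f x))%:E.
      apply: (@cvg_nnsfun_approx _ _ _ _ (@measurableT _ R) (EFin \o g)) => //.
      by move=> z _; rewrite lee_fin.
    by apply: cvgeZr.
  - by move=> n; apply: emeasurable_funM => //; exact: mhf.
  - by move=> n x _; rewrite mule_ge0// lee_fin.
  - move=> x _ a b ab; rewrite lee_wpmul2r// lee_fin.
    by have /lefP := nd_nnsfun_approx (@measurableT _ R) mg ab; exact.
congr (limn _); apply/funext => n.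
transitivity (\int[nu]_x (\sum_(v \in range (h mg n))
    ((v * \1_(h mg n @^-1` [set v]) (f x))%:E * (u x)%:E))).
  apply: eq_integral => x _; rewrite [in LHS](fimfunE (h mg n)) -fsumEFin//.
  by rewrite ge0_mule_fsuml// => v; exact: nnfun_muleindic_ge0.
have mv v : measurable (f @^-1` (h mg n @^-1` [set v])).
  by rewrite -[_ @^-1` _]setTI; apply: mf.
have mind v : measurable_fun setT (fun x => (\1_(f @^-1` (h mg n @^-1` [set v])) x)%:E : \bar R).
  by apply/measurable_EFinP; exact: measurable_indic.
have E v x : (v * \1_(h mg n @^-1` [set v]) (f x))%:E * (u x)%:E =
    v%:E * ((\1_(f @^-1` (h mg n @^-1` [set v])) x)%:E * (u x)%:E).
  by rewrite muleA.
rewrite ge0_integral_fsum//.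
- apply: eq_fsbigr => v /[!inE] -[t _ tv].
  under eq_integral do rewrite E.
  rewrite ge0_integralZl//=.
  + congr (_ * _).
    under eq_integral do rewrite muleC.
    rewrite [RHS]integral_mkcond; apply: eq_integral => x _.
    by rewrite epatch_indic.
  + by apply: emeasurable_funM.
  + by move=> x _; rewrite mule_ge0// lee_fin.
  + by rewrite lee_fin -tv.
- move=> v; under eq_fun do rewrite E.
  by apply: emeasurable_funM => //; apply: emeasurable_funM.
- by move=> v x _; rewrite mule_ge0//; exact: nnfun_muleindic_ge0.
Qed.

Lemma integral_weighted_eq d1 d2 (X1 : measurableType d1) (X2 : measurableType d2)
    (nu1 : {measure set X1 -> \bar R}) (nu2 : {measure set X2 -> \bar R})
    (f1 : X1 -> R) (f2 : X2 -> R) (u1 : X1 -> R) (u2 : X2 -> R) (g : R -> R) :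
  measurable_fun setT f1 -> measurable_fun setT u1 -> (forall x, (0 <= u1 x)%R) ->
  measurable_fun setT f2 -> measurable_fun setT u2 -> (forall x, (0 <= u2 x)%R) ->
  (forall B, measurable B -> \int[nu1]_(x in f1 @^-1` B) (u1 x)%:E =
                            \int[nu2]_(x in f2 @^-1` B) (u2 x)%:E) ->
  measurable_fun setT g -> (forall x, (0 <= g x)%R) ->
  \int[nu1]_x ((g (f1 x))%:E * (u1 x)%:E) = \int[nu2]_x ((g (f2 x))%:E * (u2 x)%:E).
Proof.
move=> mf1 mu1 u10 mf2 mu2 u20 eqB /measurable_EFinP mg g0.
rewrite (integral_weighted_lim _ mg)// (integral_weighted_lim _ mg)//.
congr (limn _); apply/funext => n; apply: eq_fsbigr => v _.
by rewrite eqB.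
Qed.

End change_of_variables.

Section product_expectation.
Local Open Scope ereal_scope.
Context {R : realType} d (T : measurableType d) (P : {measure set T -> \bar R})
  (mu : {measure set R -> \bar R}) {K : eqType} (f : K -> T -> R)
  (h g : K -> R -> R) (G : K -> R).
Hypotheses (h_ge0 : forall k x, (0 <= h k x)%R)
  (mh : forall k, measurable_fun setT (h k))
  (g_ge0 : forall k x, (0 <= g k x)%R)
  (mg : forall k, measurable_fun setT (g k))
  (h_fin : forall k, \int[mu]_x (h k x)%:E < +oo)
  (gG : forall k, \int[mu]_x (g k x * h k x)%:E = (G k)%:E).

Let G_ge0 k : (0 <= G k)%R.
Proof.
by rewrite -lee_fin -gG integral_ge0// => x _; rewrite lee_fin mulr_ge0.
Qed.

Let h_fin_num k B : measurable B -> \int[mu]_(x in B) (h k x)%:E \is a fin_num.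
Proof.
move=> mB; rewrite ge0_fin_numE; last first.
  by apply: integral_ge0 => x _; rewrite lee_fin.
apply: le_lt_trans (h_fin k); apply: ge0_subset_integral => //.
  exact/measurable_EFinP.
by move=> x _; rewrite lee_fin.
Qed.

Let measurable_prod_seq (s : seq K) : (forall k, k \in s -> measurable_fun setT (f k)) ->
  measurable_fun setT (fun w => \prod_(k <- s) g k (f k w))%R.
Proof.
elim: s => [|k s IH] mf.
  by under eq_fun do rewrite big_nil; exact: measurable_cst.
under eq_fun do rewrite big_cons.
apply: measurable_funM.
  by apply: measurableT_comp => //; apply: mf; rewrite mem_head.
by apply: IH => j js; apply: mf; rewrite in_cons js orbT.
Qed.

(** Independence is given on rectangles only.  One coordinate at a time is
    promoted from an indicator to an arbitrary nonnegative function. *)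
Lemma product_expectation (s : seq K) (E : set T) (C : R) : uniq s ->
  (forall k, k \in s -> measurable_fun setT (f k)) -> measurable E -> (0 <= C)%R ->
  (forall B : K -> set R, (forall k, measurable (B k)) ->
    P (E `&` [set w | forall k, k \in s -> B k (f k w)]) =
    C%:E * \prod_(k <- s) \int[mu]_(x in B k) (h k x)%:E) ->
  \int[P]_w (\1_E w * \prod_(k <- s) g k (f k w))%:E = (C * \prod_(k <- s) G k)%:E.
Proof.
elim: s E C => [|k s IH] E C /=.
  move=> _ _ mE C0 /(_ (fun=> setT) (fun=> measurableT)); rewrite big_nil mule1 => PE.
  under eq_integral do rewrite big_nil mulr1.
  rewrite big_nil mulr1 integral_indic// setIT -PE; congr (P _).
  by apply/seteqP; split => // x [].
move=> /andP[ks us] mf mE C0 PE.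
have mfs k' : k' \in s -> measurable_fun setT (f k').
  by move=> k's; apply: mf; rewrite in_cons k's orbT.
have mfk : measurable_fun setT (f k) by apply: mf; rewrite mem_head.
have mEB B : measurable B -> measurable (E `&` f k @^-1` B).
  by move=> mB; apply: measurableI => //; rewrite -[_ @^-1` _]setTI; apply: mfk.
have nu0 B : (0 <= fine (\int[mu]_(x in B) (h k x)%:E))%R.
  by apply: fine_ge0; apply: integral_ge0 => x _; rewrite lee_fin.
have mprod : measurable_fun setT (fun w => \1_E w * \prod_(j <- s) g j (f j w))%R.
  apply: measurable_funM; first exact: measurable_indic.
  exact: measurable_prod_seq.
have prod_ge0 w : (0 <= \1_E w * \prod_(j <- s) g j (f j w))%R.
  by rewrite mulr_ge0// prodr_ge0.
have G0 : (0 <= C * \prod_(j <- s) G j)%R by rewrite mulr_ge0// prodr_ge0.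
transitivity (\int[P]_w ((g k (f k w))%:E *
    (\1_E w * \prod_(j <- s) g j (f j w))%:E)).
  by apply: eq_integral => w _; rewrite big_cons -EFinM mulrCA.
(* Given the other coordinates, the weighted image of [P] under [f k] has density
   [h k] up to a constant; the induction hypothesis says so on every [B]. *)
rewrite (@integral_weighted_eq _ _ _ _ _ P mu (f k) id _
   (fun x => (C * \prod_(j <- s) G j) * h k x)%R)//.
- transitivity (\int[mu]_x ((C * \prod_(j <- s) G j)%:E * (g k x * h k x)%:E)).
    by apply: eq_integral => x _; rewrite -!EFinM mulrCA.
  rewrite ge0_integralZl_EFin//.
  + by rewrite gG big_cons -EFinM mulrAC -mulrA.
  + by move=> x _; rewrite lee_fin mulr_ge0.
  + by apply/measurable_EFinP; apply: measurable_funM.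
- by apply: measurable_funM.
- by move=> x; rewrite mulr_ge0.
- move=> B mB.
  transitivity (\int[P]_w (\1_(E `&` f k @^-1` B) w * \prod_(j <- s) g j (f j w))%:E).
    rewrite integral_mkcond; apply: eq_integral => w _.
    by rewrite epatch_indic indicI EFinM -!EFinM mulrAC.
  rewrite (IH _ (C * fine (\int[mu]_(x in B) (h k x)%:E))%R)//.
  + under [RHS]eq_integral do rewrite EFinM.
    rewrite ge0_integralZl_EFin//.
    * rewrite mulrAC EFinM fineK//; exact: h_fin_num.
    * by move=> x _; rewrite lee_fin.
    * by apply/measurable_EFinP; exact: measurable_funTS.
  + exact: mEB.
  + by rewrite mulr_ge0.
  + move=> B' mB'.
    pose B2 j := if j == k then B else B' j.
    have mB2 j : measurable (B2 j) by rewrite /B2; case: ifP.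
    have B2k : B2 k = B by rewrite /B2 eqxx.
    have := PE _ mB2; rewrite big_cons B2k muleA -(fineK (h_fin_num _ mB)) -EFinM.
    have -> : \prod_(j <- s) \int[mu]_(x in B2 j) (h j x)%:E =
              \prod_(j <- s) \int[mu]_(x in B' j) (h j x)%:E.
      apply: eq_big_seq => j js; rewrite /B2; case: eqP js => // ->.
      by rewrite (negbTE ks).
    move=> <-; congr (P _); apply/seteqP; split => w /=.
      move=> [[Ew Bw] Bs]; split=> // j; rewrite in_cons /B2; case: eqP => [->//|_ /=].
      exact: Bs.
    move=> [Ew Bs]; split; first split => //.
      by have := Bs k; rewrite mem_head /B2 eqxx; exact.
    move=> j js; have := Bs j; rewrite in_cons js orbT /B2 => /(_ isT).
    by case: eqP js => // ->; rewrite (negbTE ks).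
Qed.

End product_expectation.

(** * Exponential moments in the block model *)

Section outer_measure_finite.
Context {R : realType} {T : Type} (m : {outer_measure set T -> \bar R}).

Lemma outer_measure_bigcup_fin (I : finType) (F : I -> set T) :
  (m (\bigcup_i F i) <= \sum_i m (F i))%E.
Proof.
have gen (s : seq I) : (m [set w | exists2 i, i \in s & F i w] <= \sum_(i <- s) m (F i))%E.
  elim: s => [|i s IH].
    rewrite big_nil (_ : [set _ | _] = set0) ?outer_measure0//.
    by apply/seteqP; split => w // -[].
  rewrite big_cons; apply: le_trans (leeD2l _ IH).
  apply: le_trans (outer_measureU2 _ _ _); apply: le_outer_measure => w /=.
  move=> [j]; rewrite in_cons => /orP[/eqP-> Fw|js Fw]; [by left|by right; exists j].
apply: le_trans (gen (index_enum I)); apply: le_outer_measure => w [i _ Fw].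
by exists i => //; rewrite mem_index_enum.
Qed.

End outer_measure_finite.

Section measurable_bigops.
Context {R : realType} {d : measure_display} {T : measurableType d} {I : Type} (h : I -> T -> R).

Lemma measurable_prod_cond (s : seq I) (C : pred I) :
  (forall i, C i -> measurable_fun setT (h i)) ->
  measurable_fun setT (fun w => \prod_(i <- s | C i) h i w).
Proof.
move=> mh; elim: s => [|i s IH].
  by under eq_fun do rewrite big_nil; exact: measurable_cst.
under eq_fun do rewrite big_cons; case: (boolP (C i)) => // Ci.
by apply: measurable_funM => //; exact: mh.
Qed.

Lemma measurable_sum_cond (s : seq I) (C : pred I) :
  (forall i, C i -> measurable_fun setT (h i)) ->
  measurable_fun setT (fun w => \sum_(i <- s | C i) h i w).
Proof.
move=> mh; elim: s => [|i s IH].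
  by under eq_fun do rewrite big_nil; exact: measurable_cst.
under eq_fun do rewrite big_cons; case: (boolP (C i)) => // Ci.
by apply: measurable_funD => //; exact: mh.
Qed.

End measurable_bigops.

Section sbm_expectation.
Context {R : realType} {Q n : nat} {d} {T : measurableType d} {P : probability T R}
  {mu : {measure set R -> \bar R}} {A : set R} {b psi : R -> R} {t : param R Q} {rho : R}
  {z : T -> 'I_n -> 'I_Q} {y : T -> 'I_n -> 'I_n -> R} {r : T -> 'I_n -> 'I_n -> bool}.
Hypotheses (ef : expfam mu A b psi) (tA : forall q l, A (t.2 q l))
  (t_prob : prob_vector t.1) (rho01 : 0 <= rho <= 1)
  (sample : sbm_dyad_sample P mu b psi t rho z y r).

Let dyad : pred ('I_n * 'I_n) := fun p => p.1 != p.2.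

Lemma dyad_prodE (S : Type) (idx : S) (op : Monoid.com_law idx) (F : 'I_n -> 'I_n -> S) :
  \big[op/idx]_i \big[op/idx]_(j | i != j) F i j = \big[op/idx]_(p | dyad p) F p.1 p.2.
Proof. by rewrite pair_big_dep. Qed.

Lemma dyad_seqE (S : Type) (idx : S) (op : Monoid.com_law idx) (F : 'I_n -> 'I_n -> S) :
  \big[op/idx]_i \big[op/idx]_(j | i != j) F i j = \big[op/idx]_(p <- enum dyad) F p.1 p.2.
Proof. by rewrite dyad_prodE big_enum. Qed.

Lemma phi_ge0 x p : 0 <= phi b psi x p.
Proof. by rewrite mulr_ge0 ?expR_ge0//; exact: (expfam_ge0 ef). Qed.

Lemma phi_measurable p : measurable_fun setT (fun x => phi b psi x p).
Proof.
apply: measurable_funM; first exact: (expfam_measurable ef).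
apply: measurableT_comp; first exact: measurable_expR.
by apply: measurable_funB => //; apply: measurable_funM.
Qed.

Definition atom (zz : 'I_n -> 'I_Q) (rr : 'I_n -> 'I_n -> bool) : set T :=
  [set w | forall i, z w i = zz i] `&`
  [set w | forall i j, i != j -> r w i j = rr i j].

Lemma measurable_memberships zz : measurable [set w | forall i, z w i = zz i].
Proof.
have -> : [set w | forall i, z w i = zz i] = \bigcap_(i in setT) [set w | z w i = zz i].
  by apply/seteqP; split => w h i; [move=> _; exact: h|exact: (h i I)].
by apply: fin_bigcap_measurable => // i _; exact: (sbm_measurable_z sample).
Qed.

Lemma measurable_atom zz rr : measurable (atom zz rr).
Proof.
apply: measurableI; first exact: measurable_memberships.
have -> : [set w | forall i j, i != j -> r w i j = rr i j] =
    \bigcap_(p in [set p : 'I_n * 'I_n | dyad p]) [set w | r w p.1 p.2 = rr p.1 p.2].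
  apply/seteqP; split => w h; first by move=> p; exact: h.
  by move=> i j ij; exact: (h (i, j)).
apply: fin_bigcap_measurable => // p dp.
rewrite (_ : [set _ | _] = setT `&` (fun w => r w p.1 p.2) @^-1` [set rr p.1 p.2]).
  exact: (sbm_measurable_r sample).
by rewrite setTI.
Qed.

Lemma atom_expectation zz rr (g : 'I_n -> 'I_n -> R -> R) (G : 'I_n -> 'I_n -> R) :
  (forall i j x, 0 <= g i j x) -> (forall i j, measurable_fun setT (g i j)) ->
  (forall i j, (\int[mu]_x (g i j x * phi b psi x (t.2 (zz i) (zz j)))%:E = (G i j)%:E)%E) ->
  (\int[P]_w (\1_(atom zz rr) w * \prod_i \prod_(j | i != j) g i j (y w i j))%:E =
   ((\prod_i t.1 0 (zz i)) * \prod_i \prod_(j | i != j)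
      ((if rr i j then rho else 1 - rho) * G i j))%:E)%E.
Proof.
move=> g0 mg gG.
pose s := enum dyad.
pose Wr := \prod_i \prod_(j | i != j) (if rr i j then rho else 1 - rho).
have Wr0 : 0 <= Wr.
  rewrite /Wr; apply: prodr_ge0 => i _; apply: prodr_ge0 => j _.
  by move: rho01; case: ifP => _; lra.
have Wz0 : 0 <= \prod_i t.1 0 (zz i) by apply: prodr_ge0 => i _; exact: (t_prob.1).
transitivity (\int[P]_w (\1_(atom zz rr) w *
    \prod_(p <- s) g p.1 p.2 (y w p.1 p.2))%:E)%E.
  by apply: eq_integral => w _; rewrite dyad_seqE.
rewrite (@product_expectation R _ _ P mu _ (fun p w => y w p.1 p.2)
   (fun p x => phi b psi x (t.2 (zz p.1) (zz p.2))) (fun p => g p.1 p.2)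
   (fun p => G p.1 p.2) (fun p x => phi_ge0 _ _) (fun p => phi_measurable _)
   (fun p => g0 _ _) (fun p => mg _ _) _ (fun p => gG _ _) s (atom zz rr)
   (\prod_i t.1 0 (zz i) * Wr) (enum_uniq _))//.
- congr EFin; rewrite -mulrA; congr (_ * _).
  under [RHS]eq_bigr do rewrite big_split.
  by rewrite big_split/= -(dyad_seqE _ G).
- by move=> p; rewrite (expfam_density ef)// ltry.
- by move=> p; rewrite mem_enum => dp; exact: (sbm_measurable_y sample).
- exact: measurable_atom.
- by rewrite mulr_ge0.
- move=> B mB.
  pose B2 i j := B (i, j).
  have mB2 i j : measurable (B2 i j) by exact: mB.
  have := sbm_indep sample zz rr mB2.
  rewrite (sbm_law_y sample _ mB2) (sbm_law_r sample) (sbm_law_z sample).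
  rewrite (dyad_seqE _ (fun i j => \int[mu]_(x in B2 i j)
    (phi b psi x (t.2 (zz i) (zz j)))%:E)%E) -/s -/Wr EFinM muleAC.
  rewrite (eq_bigr (fun p => \int[mu]_(x in B p)
      (phi b psi x (t.2 (zz p.1) (zz p.2)))%:E)%E) => [|[]//].
  move=> <-.
  congr (P _); apply/seteqP; split => w /=.
    move=> [[zw rw] Bw]; split=> //; split=> // i j ij.
    by apply: (Bw (i, j)); rewrite mem_enum.
  move=> [[zw Bw] rw]; split; first by split.
  by move=> [i j]; rewrite mem_enum; exact: Bw.
Qed.

Definition pattern : pred {ffun 'I_n * 'I_n -> bool} := pffun_on false dyad predT.

Lemma patternP (rr : {ffun 'I_n * 'I_n -> bool}) :
  reflect (forall i, rr (i, i) = false) (pattern rr).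
Proof.
apply: (iffP pffun_onP) => [[/supportP h _] i|h]; first by apply: h; rewrite unfold_in /dyad eqxx.
split=> // ; apply/supportP => -[i j]; rewrite unfold_in /dyad /= negbK => /eqP->.
exact: h.
Qed.

Lemma moment zz (g : 'I_n -> 'I_n -> R -> R) (G : 'I_n -> 'I_n -> R) :
  (forall i j x, 0 <= g i j x) -> (forall i j, measurable_fun setT (g i j)) ->
  (forall i j, (\int[mu]_x (g i j x * phi b psi x (t.2 (zz i) (zz j)))%:E = (G i j)%:E)%E) ->
  (\int[P]_w (\1_[set w | forall i, z w i = zz i] w *
     \prod_i \prod_(j | i != j) (if r w i j then g i j (y w i j) else 1))%:E =
   ((\prod_i t.1 0 (zz i)) * \prod_i \prod_(j | i != j) (1 - rho + rho * G i j))%:E)%E.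
Proof.
move=> g0 mg gG.
pose g' (rr : {ffun 'I_n * 'I_n -> bool}) i j x := if rr (i, j) then g i j x else 1.
pose G' (rr : {ffun 'I_n * 'I_n -> bool}) i j := if rr (i, j) then G i j else 1.
pose F (rr : {ffun 'I_n * 'I_n -> bool}) w := \1_(atom zz (fun i j => rr (i, j))) w *
  \prod_i \prod_(j | i != j) g' rr i j (y w i j).
have g'0 rr i j x : 0 <= g' rr i j x by rewrite /g'; case: ifP.
have mg' rr i j : measurable_fun setT (g' rr i j).
  by rewrite /g'; case: (rr (i, j)).
have F0 rr w : 0 <= F rr w.
  by rewrite mulr_ge0// prodr_ge0// => i _; rewrite prodr_ge0.
have mF rr : measurable_fun setT (F rr).
  apply: measurable_funM; first by apply: measurable_indic; exact: measurable_atom.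
  apply: measurable_prod_cond => i _; apply: measurable_prod_cond => j ij.
  by apply: measurableT_comp => //; exact: (sbm_measurable_y sample).
transitivity (\int[P]_w (\sum_(rr <- [seq rr <- index_enum _ | pattern rr]) (F rr w)%:E)%E)%E.
  apply: eq_integral => w _; rewrite big_filter sumEFin; congr EFin.
  (* The only observation pattern whose atom contains [w]. *)
  pose rr0 := [ffun p : 'I_n * 'I_n => (p.1 != p.2) && r w p.1 p.2].
  have rr0P : pattern rr0 by apply/patternP => i; rewrite ffunE/= eqxx.
  rewrite (bigD1 rr0)//= [X in _ + X]big1 ?addr0; last first.
    move=> rr /andP[/patternP rrP rrn]; rewrite /F indicE memNset ?mul0r//.
    move=> [_ rw]; move/eqP: rrn; apply; apply/ffunP => -[i j]; rewrite ffunE/=.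
    by case: eqVneq => [->|ij]/=; [exact: rrP|rewrite rw].
  rewrite /F; have -> : \1_(atom zz (fun i j => rr0 (i, j))) w =
      \1_[set w | forall i, z w i = zz i] w :> R.
    rewrite !indicE; congr (_%:R : R); congr nat_of_bool.
    apply/idP/idP; rewrite !inE; first by case.
    by move=> zw; split => // i j ij; rewrite ffunE/= ij.
  congr (_ * _); apply: eq_bigr => i _; apply: eq_bigr => j ij.
  by rewrite /g' ffunE/= ij.
rewrite ge0_integral_sum//; last 2 first.
- by move=> rr; exact/measurable_EFinP.
- by move=> rr w _; rewrite lee_fin.
rewrite big_filter (eq_bigr (fun rr : {ffun 'I_n * 'I_n -> bool} => ((\prod_i t.1 0 (zz i)) *
    \prod_i \prod_(j | i != j) (if rr (i, j) then rho * G i j else 1 - rho))%:E)); last first.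
  move=> rr _; rewrite (@atom_expectation _ _ _ (G' rr))//.
    congr (EFin (_ * _)); apply: eq_bigr => i _; apply: eq_bigr => j _; rewrite /G'.
    by case: ifP => _; rewrite ?mulr1.
  move=> i j; rewrite /g' /G'; case: ifP => _; first exact: gG.
  by under eq_integral do rewrite mul1r; exact: (expfam_density ef).
rewrite sumEFin -mulr_sumr; congr (EFin (_ * _)).
rewrite dyad_prodE.
transitivity (\prod_(p | dyad p) \sum_(e : bool) (if e then rho * G p.1 p.2 else 1 - rho)).
  rewrite (big_distr_big false); apply: eq_bigr => rr _; rewrite dyad_prodE.
  by apply: eq_bigr => -[].
by apply: eq_bigr => p _; rewrite big_bool/= addrC.
Qed.

Lemma sum_memberships_prob : \sum_(zz : {ffun 'I_n -> 'I_Q}) \prod_i t.1 0 (zz i) = 1.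
Proof.
rewrite -(bigA_distr_bigA (fun _ q => t.1 0 q)) big1// => i _.
exact: t_prob.2.
Qed.

Let zf w := [ffun i => z w i].

(** Markov's inequality conditionally on the memberships, so that the bounding
    random variable may depend on them; [good] restricts attention to memberships
    for which the conditional expectation is controlled.  The outer measure spares any
    measurability question about the event. *)
Lemma conditional_markov (I : finType) (good : pred {ffun 'I_n -> 'I_Q})
    (c : I -> {ffun 'I_n -> 'I_Q} -> R)
    (g : I -> {ffun 'I_n -> 'I_Q} -> 'I_n -> 'I_n -> R -> R)
    (G : I -> {ffun 'I_n -> 'I_Q} -> 'I_n -> 'I_n -> R) (B : R) :
  0 <= B -> (forall k zz, 0 <= c k zz) ->
  (forall k zz i j x, 0 <= g k zz i j x) ->
  (forall k zz i j, measurable_fun setT (g k zz i j)) ->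
  (forall k zz i j, (\int[mu]_x (g k zz i j x * phi b psi x (t.2 (zz i) (zz j)))%:E =
     (G k zz i j)%:E)%E) ->
  (forall zz, good zz -> \sum_k c k zz *
     \prod_i \prod_(j | i != j) (1 - rho + rho * G k zz i j) <= B) ->
  (mu_ext P [set w | good (zf w) /\ (1 <= \sum_k c k (zf w) *
      \prod_i \prod_(j | i != j) (if r w i j then g k (zf w) i j (y w i j) else 1))%R] <= B%:E)%E.
Proof.
move=> B0 c0 g0 mg gG bound.
pose Y k (zz : {ffun 'I_n -> 'I_Q}) w := \1_[set w | forall i, z w i = zz i] w *
     \prod_i \prod_(j | i != j) (if r w i j then g k zz i j (y w i j) else 1).
pose X w := \sum_(zz | good zz) \sum_k c k zz * Y k zz w.
have XE w : good (zf w) -> X w = \sum_k c k (zf w) *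
    \prod_i \prod_(j | i != j) (if r w i j then g k (zf w) i j (y w i j) else 1).
  move=> gw; rewrite /X (bigD1 (zf w))//= [X in _ + X]big1 ?addr0.
    apply: eq_bigr => k _; rewrite /Y indicE mem_set ?mul1r// => i.
    by rewrite ffunE.
  move=> zz /andP[_ zzn]; apply: big1 => k _.
  rewrite /Y indicE memNset ?mul0r ?mulr0// => h; move/eqP: zzn; apply.
  by apply/ffunP => i; rewrite ffunE h.
have Y0 k zz w : 0 <= Y k zz w.
  by rewrite mulr_ge0// prodr_ge0// => i _; rewrite prodr_ge0// => j _; case: ifP.
have mY k zz : measurable_fun setT (Y k zz).
  apply: measurable_funM; first by apply: measurable_indic; exact: measurable_memberships.
  apply: measurable_prod_cond => i _; apply: measurable_prod_cond => j ij.
  apply: measurable_fun_ifT; first exact: (sbm_measurable_r sample).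
    by apply: measurableT_comp => //; exact: (sbm_measurable_y sample).
  exact: measurable_cst.
have X0 w : 0 <= X w.
  by rewrite sumr_ge0// => zz _; rewrite sumr_ge0// => k _; rewrite mulr_ge0.
have mX : measurable_fun setT X.
  apply: measurable_sum_cond => zz _; apply: measurable_sum_cond => k _.
  by apply: measurable_funM.
have EX : (\int[P]_w (X w)%:E <= B%:E)%E.
  under eq_integral do rewrite -sumEFin -big_filter.
  rewrite ge0_integral_sum//; last 2 first.
  - move=> zz; apply/measurable_EFinP; apply: measurable_sum_cond => k _.
    exact: measurable_funM.
  - by move=> zz w _; rewrite lee_fin sumr_ge0// => k _; rewrite mulr_ge0.
  rewrite big_filter; have -> : (\sum_(zz | good zz) \int[P]_w (\sum_k c k zz * Y k zz w)%:E =
     \sum_(zz | good zz) ((\prod_i t.1 0 (zz i)) * \sum_k c k zz *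
     \prod_i \prod_(j | i != j) (1 - rho + rho * G k zz i j))%:E)%E.
    apply: eq_bigr => zz _.
    under eq_integral do rewrite -sumEFin.
    rewrite ge0_integral_sum//; last 2 first.
    - by move=> k; apply/measurable_EFinP; exact: measurable_funM.
    - by move=> k w _; rewrite lee_fin mulr_ge0.
    rewrite mulr_sumr -sumEFin; apply: eq_bigr => k _.
    under eq_integral do rewrite EFinM.
    rewrite ge0_integralZl_EFin//; last 2 first.
    - by move=> w _; rewrite lee_fin.
    - exact/measurable_EFinP.
    by rewrite (moment (g0 k zz) (mg k zz) (gG k zz)) -EFinM mulrCA.
  rewrite sumEFin lee_fin.
  apply: (@le_trans _ _ (\sum_(zz | good zz) (\prod_i t.1 0 (zz i)) * B)).
    apply: ler_sum => zz gz; apply: ler_wpM2l; last exact: bound.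
    by apply: prodr_ge0 => i _; exact: (t_prob.1).
  rewrite -mulr_suml ler_piMl//.
  have := sum_memberships_prob; rewrite (bigID good)/= => /(canRL (addrK _)) ->.
  rewrite gerBl.
  by apply: sumr_ge0 => zz _; apply: prodr_ge0 => i _; exact: (t_prob.1).
have mS : measurable [set w | 1 <= X w].
  by rewrite -[[set _ | _]]setTI; apply: measurable_fun_le.
apply: (@le_trans _ _ (mu_ext P [set w | 1 <= X w])).
  by apply: le_mu_ext => w [gw]; rewrite -XE.
rewrite measurable_mu_extE//; apply: le_trans EX.
apply: (@le_trans _ _ (\int[P]_w (\1_[set w | (1 <= X w)%R] w)%:E)%E).
  by rewrite integral_indic// setIT.
apply: ge0_le_integral => //.
- by apply/measurable_EFinP; exact: measurable_indic.
- exact/measurable_EFinP.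
- move=> w _; rewrite lee_fin indicE; case: (boolP (w \in _)) => //.
  by rewrite inE.
Qed.

(** Tilting an exponential family shifts its parameter. *)
Lemma exponential_moment p s u : A (p + s) ->
  (\int[mu]_x (expR (s * x + u) * phi b psi x p)%:E =
   (expR (psi (p + s) - psi p + u))%:E)%E.
Proof.
move=> Aps.
transitivity (\int[mu]_x ((expR (psi (p + s) - psi p + u))%:E *
    (phi b psi x (p + s))%:E)%E)%E.
  apply: eq_integral => x _; rewrite -EFinM /phi mulrCA [in RHS]mulrCA -!expRD.
  by congr (EFin (_ * expR _)); ring.
rewrite ge0_integralZl_EFin ?expR_ge0//.
- by rewrite (expfam_density ef)// mule1.
- by move=> x _; rewrite lee_fin phi_ge0.
- by apply/measurable_EFinP; exact: phi_measurable.
Qed.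

(** If the carrier [b] vanishes at an observed value, then every likelihood is [0] and any
    parameter maximizes it; this happens with probability zero. *)
Lemma observed_density_positive :
  mu_ext P [set w | exists i j, i != j /\ b (y w i j) = 0] = 0%E.
Proof.
pose B (p : 'I_n * 'I_n) i j := if p == (i, j) then b @^-1` [set 0] else setT.
pose N (zp : {ffun 'I_n -> 'I_Q} * ('I_n * 'I_n)) := if dyad zp.2 then
   [set w | (forall i, z w i = zp.1 i) /\
            (forall i j, i != j -> B zp.2 i j (y w i j))] else set0.
have mB p i j : measurable (B p i j).
  rewrite /B; case: ifP => // _; rewrite -[_ @^-1` _]setTI.
  exact: (expfam_measurable ef).
apply/eqP; rewrite eq_le; apply/andP; split; last exact: outer_measure_ge0.
have sub : [set w | exists i j, i != j /\ b (y w i j) = 0] `<=` \bigcup_zp N zp.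
  move=> w /= [i [j [ij bw]]]; exists (zf w, (i, j)) => //.
  rewrite /N /dyad ij; split=> [i'|i' j' ij']; first by rewrite ffunE.
  by rewrite /B; case: eqP => [[<- <-]|].
apply: (le_trans (le_mu_ext _ sub)); apply: (le_trans (outer_measure_bigcup_fin _ _)).
rewrite big1// => -[zz [i j]] _; rewrite /N /dyad /=; case: ifPn => ij; last exact: outer_measure0.
have PN := sbm_law_y sample zz (mB (i, j)).
have mN : measurable [set w | (forall i', z w i' = zz i') /\
    (forall i' j', i' != j' -> B (i, j) i' j' (y w i' j'))].
  rewrite [X in measurable X](_ : _ = [set w | forall i', z w i' = zz i'] `&`
    \bigcap_(p in [set p : 'I_n * 'I_n | dyad p]) [set w | B (i, j) p.1 p.2 (y w p.1 p.2)]).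
    apply: measurableI; first exact: measurable_memberships.
  apply: fin_bigcap_measurable => // p dp.
  rewrite (_ : [set _ | _] = setT `&` (fun w => y w p.1 p.2) @^-1` B (i, j) p.1 p.2).
    exact: (sbm_measurable_y sample).
  by rewrite setTI.
  apply/seteqP; split => w [zw h]; split => //; first by move=> p; exact: h.
  by move=> i' j' ij'; exact: (h (i', j')).
rewrite measurable_mu_extE//; transitivity (P [set w | (forall i', z w i' = zz i') /\
    (forall i' j', i' != j' -> B (i, j) i' j' (y w i' j'))]) => //.
rewrite PN dyad_prodE (bigD1 (i, j))//=.
rewrite [X in (_ * (X * _))%E](_ : _ = 0%E) ?mul0e ?mule0//.
rewrite /B eqxx; apply: integral0_eq => x /= bx.
by rewrite /phi bx mul0r.
Qed.

End sbm_expectation.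

(** * Affinities and confusion of assignments *)

Local Close Scope classical_set_scope.

Section affinity.
Context {R : realType}.

(** Bhattacharyya affinity, the integral of the geometric mean of the densities
    with parameters [p] and [q]. *)
Definition affinity (psi : R -> R) (p q : R) : R :=
  expR (psi ((p + q) / 2) - (psi p + psi q) / 2).

Context (psi : R -> R) (lo hi tau m L : R) (tm : tame psi lo hi tau m L).

(** A lower bound for one minus the affinity of two parameters at distance at least
    [delta] ([affinity_le]). *)
Definition gap (delta : R) : R := 1 - expR (- (m / 8 * delta ^+ 2)).

Lemma gap_gt0 delta : 0 < delta -> 0 < gap delta.
Proof.
move=> d0; rewrite /gap subr_gt0 -[ltRHS]expR0 ltr_expR oppr_lt0.
by rewrite mulr_gt0 ?divr_gt0 ?exprn_gt0// (tame_m tm).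
Qed.

Lemma affinity_le p q delta : lo <= p <= hi -> lo <= q <= hi ->
  0 <= delta -> delta <= `|p - q| -> affinity psi p q <= 1 - gap delta.
Proof.
move=> pin qin d0 dpq; rewrite /gap subKr ler_expR.
have t0 := tame_tau tm.
have pin' : lo - tau <= p <= hi + tau by move: pin => /andP[]; lra.
have qin' : lo - tau <= q <= hi + tau by move: qin => /andP[]; lra.
have cin' : lo - tau <= (p + q) / 2 <= hi + tau.
  by move: pin qin => /andP[? ?] /andP[? ?]; lra.
have h1 := tame_convex tm pin' cin'.
have h2 := tame_convex tm qin' cin'.
have dsq : delta ^+ 2 <= (p - q) ^+ 2.
  by rewrite -[leRHS]real_normK ?num_real// lerXn2r// nnegrE.
have : m / 8 * delta ^+ 2 <= m / 8 * (p - q) ^+ 2.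
  by rewrite ler_wpM2l// divr_ge0// ltW// (tame_m tm).
have e1 : p - (p + q) / 2 = (p - q) / 2 by lra.
have e2 : q - (p + q) / 2 = - ((p - q) / 2) by lra.
rewrite e1 in h1; rewrite e2 in h2.
have e3 : m / 2 * ((p - q) / 2) ^+ 2 = m / 8 * (p - q) ^+ 2 by field.
rewrite sqrrN e3 mulrN in h2; rewrite e3 in h1.
lra.
Qed.

Lemma affinity_le1 p q : lo <= p <= hi -> lo <= q <= hi -> affinity psi p q <= 1.
Proof.
move=> pin qin; apply: le_trans (affinity_le pin qin (lexx 0) _) _ => //.
by rewrite /gap expr0n/= mulr0 oppr0 expR0 subrr subr0.
Qed.

End affinity.

Section assignments.
Context {R : realType} {Q n : nat} (psi : R -> R) (lo hi tau m L : R)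
  (tm : tame psi lo hi tau m L).
Implicit Types (x z : 'I_n -> 'I_Q) (pi : 'M[R]_Q).

Definition mismatch z x : nat := #|[set i | z i != x i]|.

(** Sum over the dyads of one minus the affinity: [rho] times it is the exponent in
    the expected square root of the likelihood ratio. *)
Definition separation pi0 x pi z : R := \sum_i \sum_(j | i != j)
  (1 - affinity psi (pi (z i) (z j)) (pi0 (x i) (x j))).

Definition entries_in (pi : 'M[R]_Q) := forall q l, lo <= pi q l <= hi.

(** Only the dyads in [I] times [J] are kept; the term [- 1] accounts for the
    diagonal. *)
Lemma separation_ge pi0 x pi z (I J : {set 'I_n}) (g : R) :
  entries_in pi0 -> entries_in pi -> 0 <= g ->
  (forall i j, i \in I -> j \in J ->
     affinity psi (pi (z i) (z j)) (pi0 (x i) (x j)) <= 1 - g) ->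
  #|I|%:R * (#|J|%:R - 1) * g <= separation pi0 x pi z.
Proof.
move=> pi0in piin g0 h.
have term0 i j : 0 <= 1 - affinity psi (pi (z i) (z j)) (pi0 (x i) (x j)).
  by rewrite subr_ge0 (affinity_le1 tm).
rewrite /separation (bigID (mem I))/=; apply: ler_wpDr.
  by apply: sumr_ge0 => i _; apply: sumr_ge0.
rewrite -mulrA mulr_natl -sumr_const; apply: ler_sum => i iI.
rewrite (bigID (mem J))/=; apply: ler_wpDr; first exact: sumr_ge0.
apply: (@le_trans _ _ (\sum_(j in J :\ i) g)); last first.
  rewrite [leRHS](eq_bigl (fun j => j \in J :\ i)); last first.
    by move=> j; rewrite !inE eq_sym.
  by apply: ler_sum => j /setD1P[_ jJ]; have := h _ _ iI jJ; lra.
rewrite sumr_const -[leRHS]mulr_natl ler_wpM2r// lerBlDr natr1 ler_nat.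
by rewrite [leqLHS](cardsD1 i) -[leqRHS]add1n leq_add2r leq_b1.
Qed.

(** A misclassified node [i] has two distinct rows of [pi0] to tell apart, hence a column
    [l] where they differ; each correctly classified node of class [l] then
    contributes a gap, and most nodes of that class are correctly classified. *)
Lemma separation_local pi0 x z (c Delta : R) :
  entries_in pi0 -> 0 < Delta ->
  (forall q q', q != q' -> exists l, Delta <= `|pi0 q l - pi0 q' l|) ->
  (forall q, c * n%:R <= #|[set i | x i == q]|%:R) ->
  (mismatch z x)%:R <= c / 2 * n%:R ->
  (mismatch z x)%:R * (c / 2 * n%:R) * gap m Delta <= separation pi0 x pi0 z.
Proof.
move=> pi0in D0 rows size dle.
have term0 i j : 0 <= 1 - affinity psi (pi0 (z i) (z j)) (pi0 (x i) (x j)).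
  by rewrite subr_ge0 (affinity_le1 tm).
have g0 := gap_gt0 tm D0.
rewrite /separation (bigID (mem [set i | z i != x i]))/=; apply: ler_wpDr.
  by apply: sumr_ge0 => i _; apply: sumr_ge0.
rewrite -mulrA mulr_natl -sumr_const; apply: ler_sum => i; rewrite inE => zxi.
have [l hl] := rows _ _ zxi.
pose J := [set j | x j == l] :\: [set j | z j != x j].
rewrite (bigID (mem J))/=; apply: ler_wpDr; first exact: sumr_ge0.
apply: (@le_trans _ _ (\sum_(j in J) gap m Delta)); last first.
  rewrite [leRHS](eq_bigl (fun j => j \in J)); last first.
    move=> j; apply: andb_idl; rewrite !inE negbK => /andP[/eqP zj _].
    by apply: contraNneq zxi => ->; rewrite zj.
  apply: ler_sum => j; rewrite !inE negbK => /andP[/eqP zj /eqP xj].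
  rewrite zj xj; have := affinity_le tm (pi0in (z i) l) (pi0in (x i) l) (ltW D0) hl.
  lra.
rewrite sumr_const -[leRHS]mulr_natl ler_wpM2r ?(ltW g0)//.
have : (#|[set j | x j == l]| <= #|J| + mismatch z x)%N.
  rewrite /J /mismatch -(cardsID [set j | z j != x j] [set j | x j == l]) addnC leq_add2l.
  by apply: subset_leq_card; apply: subsetIr.
rewrite -(ler_nat R) natrD; have := size l; lra.
Qed.

(** Call a cell of the confusion matrix of [x] and [z] heavy if it has at least
    [beta * n] nodes.  Each class has a heavy cell by the pigeonhole principle; a small
    separation makes [pi] agree with [pi0] on heavy cells; distinct rows then
    leave exactly one heavy cell in each row and column. *)
Lemma identifiability pi0 pi x z (c Delta delta eps beta : R) : (0 < n)%N -> (0 < Q)%N ->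
  entries_in pi0 -> entries_in pi -> 0 < delta -> delta *+ 2 < Delta ->
  (forall q q', q != q' -> exists l, Delta <= `|pi0 q l - pi0 q' l|) ->
  (forall q, c * n%:R <= #|[set i | x i == q]|%:R) ->
  Q%:R * beta <= c -> Q%:R ^+ 2 * beta <= eps -> 2 <= beta * n%:R ->
  separation pi0 x pi z < gap m delta * beta ^+ 2 / 2 * n%:R ^+ 2 ->
  exists s : 'S_Q, (forall q l, `|pi (s q) (s l) - pi0 q l| <= delta) /\
    (mismatch z (fun i => s (x i)))%:R <= eps * n%:R.
Proof.
move=> n0 Q0 pi0in piin d0 dD rows size Qc Qeps bn sep.
have g0 := gap_gt0 tm d0.
have nR0 : 0 < n%:R :> R by rewrite ltr0n.
pose conf q q' := [set i | (x i == q) && (z i == q')].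
pose heavy q q' := beta * n%:R <= #|conf q q'|%:R :> R.
(* A pair of heavy cells contributes quadratically many dyads with the same two
   parameters, so an affinity bounded away from 1 there would exceed the bound. *)
have close q q' l l' : heavy q q' -> heavy l l' -> `|pi q' l' - pi0 q l| <= delta.
  move=> hq hl; rewrite leNgt; apply/negP => far.
  have := @separation_ge pi0 x pi z (conf q q') (conf l l') (gap m delta)
     pi0in piin (ltW g0) _.
  have -> : (forall i j, i \in conf q q' -> j \in conf l l' ->
     affinity psi (pi (z i) (z j)) (pi0 (x i) (x j)) <= 1 - gap m delta) <-> True.
    split=> // _ i j; rewrite !inE => /andP[/eqP-> /eqP->] /andP[/eqP-> /eqP->].
    by apply: (affinity_le tm) => //; exact: ltW.
  move=> /(_ I); move: hq hl; rewrite /heavy => hq hl.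
  have h1 : beta * n%:R * (beta * n%:R / 2) <= #|conf q q'|%:R * (#|conf l l'|%:R - 1).
    by apply: ler_pM => //; lra.
  have := ler_wpM2r (ltW g0) h1.
  have -> : beta * n%:R * (beta * n%:R / 2) * gap m delta =
      gap m delta * beta ^+ 2 / 2 * n%:R ^+ 2 by field.
  by move=> h2 h3; have := le_lt_trans (le_trans h2 h3) sep; rewrite ltxx.
have ex_heavy q : exists q', heavy q q'.
  apply: contrapT => /forallNP noh.
  have : #|[set i | x i == q]|%:R = \sum_q' #|conf q q'|%:R :> R.
    rewrite -natr_sum -sum1_card; congr (_%:R); rewrite (partition_big z predT)//=.
    by apply: eq_bigr => q' _; rewrite -sum1_card; apply: eq_bigl => i; rewrite !inE.
  have : \sum_q' #|conf q q'|%:R < \sum_(q' : 'I_Q) beta * n%:R.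
    apply: ltr_sum; first by apply/hasP; exists q; rewrite ?mem_index_enum.
    by move=> q' _; rewrite ltNge; apply/negP/noh.
  rewrite sumr_const card_ord -mulr_natl mulrA.
  have := ler_wpM2r (ltW nR0) Qc; have := size q => h1 h2 h3 h4.
  suff : (0 : R) < 0 by rewrite ltxx.
  lra.
have [s hs] := choice ex_heavy.
have sep_rows q q' (u : 'I_Q -> 'I_Q) (v : 'I_Q) :
    (forall l, `|pi v (u l) - pi0 q l| <= delta) ->
    (forall l, `|pi v (u l) - pi0 q' l| <= delta) -> q = q'.
  move=> h1 h2; apply: contrapT => /eqP /rows[l].
  have := ler_distD (pi v (u l)) (pi0 q l) (pi0 q' l).
  rewrite (distrC (pi0 q l) (pi _ _)); have := h1 l; have := h2 l => a1 a2 a3 a4.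
  suff : (0 : R) < 0 by rewrite ltxx.
  lra.
have s_inj : injective s.
  move=> q q' e; apply: (@sep_rows _ _ s (s q)) => l.
    exact: close.
  by rewrite e; apply: close.
exists (perm s_inj); split=> [q l|]; first by rewrite !permE; exact: close.
(* Every other column index is some [s q''], so a second heavy cell in the row
   [q] would make the rows [q] and [q''] of [pi0] indistinguishable. *)
have light q q' : q' != s q -> #|conf q q'|%:R <= beta * n%:R :> R.
  move=> q's; rewrite leNgt; apply/negP => /ltW hv; move/negP: q's; apply.
  have [q'' e] : exists q'', q' = s q''.
    by exists (invF s_inj q'); rewrite f_invF.
  rewrite e; apply/eqP; congr s; apply: (@sep_rows _ _ s q') => l.
    by rewrite e; exact: close.
  exact: close.
apply: (@le_trans _ _ (\sum_(p : 'I_Q * 'I_Q) beta * n%:R)); last first.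
  rewrite sumr_const card_prod card_ord -[leLHS]mulr_natl natrM mulrA.
  by rewrite ler_wpM2r// ltW.
apply: (@le_trans _ _ (\sum_(p : 'I_Q * 'I_Q | p.2 != s p.1) #|conf p.1 p.2|%:R)).
  rewrite /mismatch -natr_sum ler_nat -sum1_card.
  rewrite (partition_big (fun i => (x i, z i)) (fun p => p.2 != s p.1))/=.
    apply: leq_sum => -[q q'] /= qs; rewrite -sum1_card.
    rewrite [leqRHS](bigID (fun i => z i != perm s_inj (x i)))/=.
    apply: leq_trans (leq_addr _ _); apply: eq_leq; apply: eq_bigl => i.
    by rewrite !inE xpair_eqE andbC.
  by move=> i; rewrite inE permE.
rewrite [leRHS](bigID (fun p : 'I_Q * 'I_Q => p.2 != s p.1))/=.
apply: ler_wpDr; first by apply: sumr_ge0 => _ _; lra.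
by apply: ler_sum => p; exact: light.
Qed.

Definition loglik (y : 'I_n -> 'I_n -> R) (r : 'I_n -> 'I_n -> bool) z pi : R :=
  \sum_i \sum_(j | i != j) (r i j)%:R * (pi (z i) (z j) * y i j - psi (pi (z i) (z j))).

(** Bounds, up to a constant, the change in the contribution of a dyad to the
    log-likelihood per unit of change of the parameter ([score_lip]). *)
Definition load (y : 'I_n -> 'I_n -> R) (r : 'I_n -> 'I_n -> bool) i j : R :=
  (r i j)%:R * (1 + `|y i j|).

Lemma score_lip (p p' v delta : R) : lo <= p <= hi -> lo <= p' <= hi ->
  `|p - p'| <= delta ->
  `|(p * v - psi p) - (p' * v - psi p')| <= delta * L * (1 + `|v|).
Proof.
move=> pin pin' pp'.
have t0 := tame_tau tm; have L1 := tame_L tm.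
have d0 : 0 <= delta by exact: le_trans pp'.
have -> : (p * v - psi p) - (p' * v - psi p') = (p - p') * v - (psi p - psi p') by ring.
apply: le_trans (ler_normB _ _) _; rewrite normrM.
have h1 : `|psi p - psi p'| <= L * `|p - p'|.
  by apply: (tame_lip tm); move: pin pin' => /andP[? ?] /andP[? ?]; lra.
have h2 : `|p - p'| * `|v| <= delta * L * `|v|.
  by rewrite ler_wpM2r// (le_trans pp')// ler_peMr.
have h3 : L * `|p - p'| <= L * delta by rewrite ler_wpM2l//; lra.
lra.
Qed.

Lemma loglik_perturb y r z pi pi' delta : entries_in pi -> entries_in pi' ->
  (forall q l, `|pi q l - pi' q l| <= delta) ->
  loglik y r z pi <= loglik y r z pi' + delta * L * \sum_i \sum_(j | i != j) load y r i j.
Proof.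
move=> piin piin' dpi; rewrite mulr_sumr -big_split/=; apply: ler_sum => i _.
rewrite mulr_sumr -big_split/=; apply: ler_sum => j _; rewrite /load mulrCA -mulrDr.
rewrite ler_wpM2l//.
have := score_lip (y i j) (piin _ _) (piin' _ _) (dpi (z i) (z j)).
by move/ler_normlP => [_]; lra.
Qed.

(** The dyads between two correctly classified nodes cancel, so the cost is
    proportional to the number of misclassified nodes. *)
Lemma loglik_perturb_local y r x z pi pi' delta B : entries_in pi -> entries_in pi' ->
  (forall q l, `|pi q l - pi' q l| <= delta) -> 0 <= delta ->
  (forall i, \sum_(j | i != j) load y r i j <= B) ->
  (forall j, \sum_(i | i != j) load y r i j <= B) ->
  loglik y r z pi - loglik y r x pi <= loglik y r z pi' - loglik y r x pi' +
    4 * delta * L * B * (mismatch z x)%:R.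
Proof.
move=> piin piin' dpi d0 rowB colB.
have L1 := tame_L tm.
have dL0 : 0 <= 2 * delta * L by rewrite !mulr_ge0//; lra.
rewrite -lerBlDl.
apply: (@le_trans _ _ (\sum_i \sum_(j | i != j)
   2 * delta * L * (((z i != x i)%:R + (z j != x j)%:R) * load y r i j))).
  rewrite /loglik -!sumrB; apply: ler_sum => i _; rewrite -!sumrB; apply: ler_sum => j _.
  set a1 := pi (z i) (z j); set a2 := pi (x i) (x j).
  set b1 := pi' (z i) (z j); set b2 := pi' (x i) (x j).
  have -> : (r i j)%:R * (a1 * y i j - psi a1) - (r i j)%:R * (a2 * y i j - psi a2) -
    ((r i j)%:R * (b1 * y i j - psi b1) - (r i j)%:R * (b2 * y i j - psi b2)) =
    (r i j)%:R * (((a1 * y i j - psi a1) - (b1 * y i j - psi b1)) -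
                  ((a2 * y i j - psi a2) - (b2 * y i j - psi b2))) by ring.
  rewrite /load [leRHS](_ : _ = (r i j)%:R * (((z i != x i)%:R + (z j != x j)%:R) *
     (2 * (delta * L * (1 + `|y i j|))))); last by ring.
  rewrite ler_wpM2l//.
  have /ler_normlP[h1' h1] : `|(a1 * y i j - psi a1) - (b1 * y i j - psi b1)| <=
      delta * L * (1 + `|y i j|).
    by apply: score_lip; [exact: piin|exact: piin'|exact: dpi].
  have /ler_normlP[h2 h2'] : `|(a2 * y i j - psi a2) - (b2 * y i j - psi b2)| <=
      delta * L * (1 + `|y i j|).
    by apply: score_lip; [exact: piin|exact: piin'|exact: dpi].
  have y0 : 0 <= delta * L * (1 + `|y i j|).
    by rewrite !mulr_ge0 ?addr_ge0//; lra.
  apply: (@le_trans _ _ (((z i != x i) || (z j != x j))%:R *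
      (2 * (delta * L * (1 + `|y i j|))))); last first.
    apply: ler_wpM2r; first by rewrite mulr_ge0.
    by rewrite -natrD ler_nat; case: (z i != x i); case: (z j != x j).
  case: (eqVneq (z i) (x i)) => [zi|zi] /=; last by rewrite mul1r; lra.
  case: (eqVneq (z j) (x j)) => [zj|zj] /=; last by rewrite mul1r; lra.
  by rewrite mul0r /a1 /b1 zi zj -/a2 -/b2 subrr.
have cardE : (mismatch z x)%:R = \sum_i (z i != x i)%:R :> R.
  rewrite /mismatch -sum1_card natr_sum big_mkcond/=.
  by apply: eq_bigr => i _; rewrite inE; case: (z i != x i).
under eq_bigr do rewrite -mulr_sumr.
rewrite -mulr_sumr [leRHS](_ : _ = 2 * delta * L * ((mismatch z x)%:R * B + (mismatch z x)%:R * B)); last by ring.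
rewrite ler_wpM2l//.
under eq_bigr do (under eq_bigr do rewrite mulrDl; rewrite big_split/=).
rewrite big_split/= cardE !mulr_suml; apply: lerD.
  by apply: ler_sum => i _; rewrite -mulr_sumr ler_wpM2l.
rewrite (exchange_big_dep predT)//=; apply: ler_sum => j _.
by rewrite -mulr_sumr ler_wpM2l.
Qed.

End assignments.

(** * The complete likelihood and its maximizer *)

Section weights.
Context {R : realType} {Q n : nat} (psi : R -> R) (y : 'I_n -> 'I_n -> R)
  (r : 'I_n -> 'I_n -> bool).
Implicit Types (x z : 'I_n -> 'I_Q) (pi : 'M[R]_Q) (alpha : 'rV[R]_Q) (t : param R Q).

Definition prior alpha z : R := \prod_i alpha 0 (z i).

(** Complete likelihood without the carrier factors, which do not depend on the
    parameter ([complete_likelihoodE]). *)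
Definition weight t z : R := prior t.1 z * expR (loglik psi y r z t.2).

Definition relabel (s : 'S_Q) t : param R Q := (perm_alpha s t.1, perm_pi s t.2).

Lemma weight_relabel (s : 'S_Q) t z : weight t (fun i => s (z i)) = weight (relabel s t) z.
Proof.
rewrite /weight /prior /loglik /relabel/=; congr (_ * expR _).
  by apply: eq_bigr => i _; rewrite mxE.
by apply: eq_bigr => i _; apply: eq_bigr => j _; rewrite mxE.
Qed.

Lemma weight_ext t z z' : z =1 z' -> weight t z = weight t z'.
Proof. by move=> /funext ->. Qed.

Lemma expR_sumE (I : finType) (C : pred I) (F : I -> R) :
  expR (\sum_(i | C i) F i) = \prod_(i | C i) expR (F i).
Proof. exact: (big_morph _ (@expRD R) (@expR0 R)). Qed.

Lemma complete_likelihoodE (b : R -> R) t z :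
  complete_likelihood b psi (observe y r) z t =
  (\prod_i \prod_(j | i != j) (if r i j then b (y i j) else 1)) * weight t z.
Proof.
rewrite /complete_likelihood /weight mulrCA; congr (_ * _).
rewrite /loglik expR_sumE -big_split/=; apply: eq_bigr => i _.
rewrite expR_sumE -big_split/=; apply: eq_bigr => j ij.
rewrite /observe ij/=; case: (r i j); rewrite ?mul1r// ?mul0r ?expR0//.
Qed.

Lemma mle_weight (b : R -> R) Theta t :
  (forall v, 0 <= b v) -> (forall i j, i != j -> b (y i j) != 0) ->
  is_mle b psi Theta (observe y r) t ->
  Theta t /\ forall u, Theta u ->
    \sum_(z : {ffun 'I_n -> 'I_Q}) weight u z <= \sum_(z : {ffun 'I_n -> 'I_Q}) weight t z.
Proof.
move=> b0 bn [Tt mt]; split=> // u /mt.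
have E v : likelihood b psi (observe y r) v =
    (\prod_i \prod_(j | i != j) (if r i j then b (y i j) else 1)) *
    \sum_(z : {ffun 'I_n -> 'I_Q}) weight v z.
  by rewrite mulr_sumr; apply: eq_bigr => z _; exact: complete_likelihoodE.
rewrite !E ler_pM2l// prodr_gt0// => i _; rewrite prodr_gt0// => j ij.
by case: ifP => // _; rewrite lt0r bn/=.
Qed.

Lemma weight_gt0 t z : (forall q, 0 < t.1 0 q) -> 0 < weight t z.
Proof. by move=> t0; rewrite mulr_gt0 ?expR_gt0// prodr_gt0. Qed.

Lemma sum_labels x (F : 'I_Q -> R) : \sum_i F (x i) = \sum_q #|[set i | x i == q]|%:R * F q.
Proof.
rewrite (partition_big x predT)//=; apply: eq_bigr => q _.
rewrite (eq_bigr (fun=> F q)) => [|i /eqP->//].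
by rewrite sumr_const mulr_natl; congr (_ *+ _); apply: eq_card => i; rewrite inE.
Qed.

Lemma alpha_hatE x q : (0 < n)%N ->
  #|[set i | x i == q]|%:R = n%:R * alpha_hat x 0 q :> R.
Proof.
move=> n0; rewrite mxE mulrA mulfV ?mul1r ?pnatr_eq0 -?lt0n//.
rewrite -sum1_card natr_sum big_mkcond/=; apply: eq_bigr => i _.
by rewrite inE; case: (x i == q).
Qed.

Lemma alpha_hat_prob x : (0 < n)%N -> prob_vector (alpha_hat x : 'rV[R]_Q).
Proof.
move=> n0; split=> [q|].
  by rewrite mxE mulr_ge0 ?invr_ge0// sumr_ge0.
have n0R : n%:R != 0 :> R by rewrite pnatr_eq0 -lt0n.
apply: (mulfI n0R); rewrite mulr1 mulr_sumr.
rewrite (eq_bigr (fun q => #|[set i | x i == q]|%:R * 1)) => [|q _]; last first.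
  by rewrite -alpha_hatE// mulr1.
by rewrite -(sum_labels x (fun=> 1)) sumr_const card_ord.
Qed.

(** The exponent is [n] times the Kullback-Leibler divergence, which dominates the
    squared Hellinger distance; the latter dominates a quarter of the squared
    difference of any coordinate, since [sqrt a + sqrt b <= 2]. *)
Lemma prior_le_max alpha x q : (0 < n)%N -> prob_vector alpha ->
  prior alpha x <= prior (alpha_hat x) x *
    expR (- (n%:R / 4 * (alpha 0 q - alpha_hat x 0 q) ^+ 2)).
Proof.
move=> n0 [alpha0 alpha1]; have [hat0 hat1] := alpha_hat_prob x n0.
set h := alpha_hat x in hat0 hat1 *.
have n0R : n%:R != 0 :> R by rewrite pnatr_eq0 -lt0n.
have hx i : 0 < h 0 (x i).
  rewrite lt_neqAle hat0 andbT eq_sym; apply/negP => /eqP e.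
  have := alpha_hatE x (x i) n0; rewrite -/h e mulr0 => /eqP.
  rewrite pnatr_eq0 cards_eq0 => /eqP/setP/(_ i).
  by rewrite !inE eqxx.
pose s q := Num.sqrt (alpha 0 q); pose g q := Num.sqrt (h 0 q).
have ss q' : s q' ^+ 2 = alpha 0 q' by rewrite sqr_sqrtr.
have gg q' : g q' ^+ 2 = h 0 q' by rewrite sqr_sqrtr.
(* [u <= exp (u - 1)] at the square root of the ratio, then squared. *)
have key i : alpha 0 (x i) <= h 0 (x i) * expR (2 * (s (x i) / g (x i) - 1)).
  have gx : 0 < g (x i) by rewrite sqrtr_gt0.
  have : (s (x i) / g (x i)) ^+ 2 <= expR (s (x i) / g (x i) - 1) ^+ 2.
    rewrite lerXn2r ?nnegrE ?expR_ge0//; first by rewrite divr_ge0// sqrtr_ge0.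
    by have := expR_ge1Dx (s (x i) / g (x i) - 1); lra.
  have g2 : g (x i) ^+ 2 != 0 by rewrite expf_neq0// gt_eqF.
  rewrite -expRM_natl exprMn exprVn ss gg ler_pdivrMr// => e.
  by rewrite mulrC.
rewrite /prior; apply: (@le_trans _ _ (\prod_i (h 0 (x i) * expR (2 * (s (x i) / g (x i) - 1))))).
  by apply: ler_prod => i _; rewrite alpha0 key.
rewrite big_split/= ler_wpM2l ?prodr_ge0// -expR_sumE ler_expR.
rewrite (sum_labels x (fun q => 2 * (s q / g q - 1))).
have g0 q' : 0 <= g q' by rewrite sqrtr_ge0.
have s0 q' : 0 <= s q' by rewrite sqrtr_ge0.
have -> : \sum_q' #|[set i | x i == q']|%:R * (2 * (s q' / g q' - 1)) =
    \sum_q' n%:R * (2 * (s q' * g q' - g q' ^+ 2)).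
  apply: eq_bigr => q' _; rewrite alpha_hatE// -/h -gg.
  have [->|gn] := eqVneq (g q') 0; first by rewrite expr0n/= !(mulr0,mul0r,subr0).
  by field.
have le1 q' : g q' <= 1.
  rewrite -[leRHS]sqrtr1 ler_wsqrtr// -hat1 (bigD1 q')//= lerDl.
  by apply: sumr_ge0 => ? _; exact: hat0.
have les1 q' : s q' <= 1.
  rewrite -[leRHS]sqrtr1 ler_wsqrtr// -alpha1 (bigD1 q')//= lerDl.
  by apply: sumr_ge0 => ? _; exact: alpha0.
have -> : \sum_q' n%:R * (2 * (s q' * g q' - g q' ^+ 2)) =
    - (n%:R * \sum_q' (s q' - g q') ^+ 2).
  have e : \sum_q' (s q' - g q') ^+ 2 = \sum_q' 2 * (g q' ^+ 2 - s q' * g q').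
    apply/eqP; rewrite -subr_eq0 -sumrB.
    under eq_bigr => q' _.
      rewrite (_ : _ - _ = alpha 0 q' - h 0 q'); last by rewrite -ss -gg; ring.
      over.
    by rewrite sumrB alpha1 hat1 subrr.
  rewrite e mulr_sumr -sumrN; apply: eq_bigr => q' _; ring.
rewrite lerN2 -mulrA ler_wpM2l//.
rewrite (bigD1 q)//=; apply: ler_wpDr; first by apply: sumr_ge0 => *; exact: sqr_ge0.
rewrite -ss -gg.
have -> : s q ^+ 2 - g q ^+ 2 = (s q - g q) * (s q + g q) by ring.
rewrite exprMn mulrCA -[leRHS]mulr1 ler_wpM2l ?sqr_ge0//.
rewrite ler_pdivrMl// mulr1; have := g0 q; have := s0 q; have := le1 q; have := les1 q.
move=> a1 a2 a3 a4.
have : (s q + g q) ^+ 2 <= 2 ^+ 2 by rewrite lerXn2r// ?nnegrE; lra.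
lra.
Qed.

Definition dyad_total x q l : R :=
  \sum_i \sum_(j | i != j) y i j * (r i j)%:R * (x i == q)%:R * (x j == l)%:R.

Lemma loglik_blocks x pi : loglik psi y r x pi =
  \sum_q \sum_l (dyad_total x q l * pi q l - dyad_count r x q l * psi (pi q l)).
Proof.
rewrite /loglik /dyad_total /dyad_count.
under [RHS]eq_bigr => q _.
  under eq_bigr => l _.
    rewrite !mulr_suml -sumrB.
    under eq_bigr do rewrite !mulr_suml -sumrB.
    over.
  rewrite exchange_big/=.
  under eq_bigr do rewrite exchange_big/=.
  over.
rewrite exchange_big/=; apply: eq_bigr => i _; rewrite exchange_big/=; apply: eq_bigr => j _.
rewrite (bigD1 (x i))//= (bigD1 (x j))//= !eqxx.
rewrite [X in _ = _ + X + _]big1 => [|l /negbTE]; last by rewrite eq_sym => -> /=; ring.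
rewrite [X in _ = _ + X]big1 => [|q /negbTE]; first by rewrite /=; ring.
by rewrite eq_sym => ->; apply: big1 => l _ /=; ring.
Qed.

(** The log-likelihood is concave in each entry of [pi], with curvature proportional to the
    number of observed dyads of the block. *)
Lemma loglik_le_max lo hi tau m L x pi (pih : 'M[R]_Q) q l : tame psi lo hi tau m L ->
  (forall q l, lo - tau <= pi q l <= hi + tau) ->
  (forall q l, lo - tau <= pih q l <= hi + tau) ->
  (forall q l, 0 < dyad_count r x q l :> R) ->
  (forall q l, derive1 psi (pih q l) = y_hat y r x q l) ->
  loglik psi y r x pi <= loglik psi y r x pih -
    dyad_count r x q l * (m / 2 * (pi q l - pih q l) ^+ 2).
Proof.
move=> tm piin pihin N0 pihE.
have m0 : 0 < m := tame_m tm.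
have term q' l' : dyad_total x q' l' * pi q' l' - dyad_count r x q' l' * psi (pi q' l') +
    dyad_count r x q' l' * (m / 2 * (pi q' l' - pih q' l') ^+ 2) <=
    dyad_total x q' l' * pih q' l' - dyad_count r x q' l' * psi (pih q' l').
  have h := tame_convex tm (piin q' l') (pihin q' l').
  have N0' := N0 q' l'.
  have := ler_wpM2l (ltW N0') h.
  have -> : dyad_total x q' l' = dyad_count r x q' l' * derive1 psi (pih q' l').
    by rewrite pihE /y_hat mulrC divfK// gt_eqF.
  lra.
rewrite -lerBDr opprK !loglik_blocks.
have pen q' l' : 0 <= dyad_count r x q' l' * (m / 2 * (pi q' l' - pih q' l') ^+ 2) :> R.
  by rewrite mulr_ge0 ?(ltW (N0 _ _))// mulr_ge0 ?sqr_ge0//; lra.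
apply: (@le_trans _ _ (\sum_q' \sum_l' (dyad_total x q' l' * pi q' l' -
    dyad_count r x q' l' * psi (pi q' l') +
    dyad_count r x q' l' * (m / 2 * (pi q' l' - pih q' l') ^+ 2)))); last first.
  by apply: ler_sum => q' _; apply: ler_sum => l' _; exact: term.
under [leRHS]eq_bigr do rewrite big_split/=.
rewrite [leRHS]big_split/= lerD2l (bigD1 q)//= (bigD1 l)//= -addrA lerDl.
by rewrite addr_ge0// sumr_ge0// => q' _; rewrite sumr_ge0.
Qed.

(** Quantitative optimality of the estimators with known memberships.  A single
    coordinate of each kind is kept; the discarded ones only help. *)
Lemma weight_le_max lo hi tau m L t x (th : param R Q) q q' l' : (0 < n)%N ->
  tame psi lo hi tau m L -> prob_vector t.1 ->
  (forall q l, lo - tau <= t.2 q l <= hi + tau) ->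
  (forall q l, lo - tau <= th.2 q l <= hi + tau) ->
  (forall q l, 0 < dyad_count r x q l :> R) ->
  (forall q l, derive1 psi (th.2 q l) = y_hat y r x q l) ->
  th.1 = alpha_hat x ->
  weight t x <= weight th x * expR (- (n%:R / 4 * (t.1 0 q - th.1 0 q) ^+ 2 +
    dyad_count r x q' l' * (m / 2 * (t.2 q' l' - th.2 q' l') ^+ 2))).
Proof.
move=> n0 tm tprob tin thin N0 thE th1.
have h1 := prior_le_max x q n0 tprob.
have h2 := loglik_le_max q' l' tm tin thin N0 thE.
have [hat0 hat1] := alpha_hat_prob x n0.
rewrite /weight th1 opprD expRD mulrACA; apply: ler_pM => //.
- by apply: prodr_ge0 => i _; exact: tprob.1.
- by rewrite -expRD ler_expR.
Qed.

End weights.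

(** * Reduction of the likelihood to the true memberships *)

Section likelihood_upper.
Context {R : realType} {Q n : nat} (psi : R -> R) (lo hi tau m L : R)
  (tm : tame psi lo hi tau m L)
  (y : 'I_n -> 'I_n -> R) (r : 'I_n -> 'I_n -> bool)
  (x : {ffun 'I_n -> 'I_Q}) (pi0 : 'M[R]_Q).
Implicit Types (t : param R Q) (z : {ffun 'I_n -> 'I_Q}).

Local Notation weight := (weight psi y r).
Local Notation loglik := (loglik psi y r).

(** Turns a bound on the sum of square roots of likelihood ratios into the square of it for
    the sum of the ratios. *)
Lemma sum_sqr_le (I : finType) (C : pred I) (F : I -> R) (w : R) :
  (forall i, 0 <= F i) -> \sum_(i | C i) F i <= w -> \sum_(i | C i) F i ^+ 2 <= w ^+ 2.
Proof.
move=> F0 Fw; have S0 : 0 <= \sum_(i | C i) F i by exact: sumr_ge0.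
apply: (@le_trans _ _ ((\sum_(i | C i) F i) ^+ 2)); last by rewrite lerXn2r// nnegrE (le_trans S0).
rewrite expr2 mulr_suml; apply: ler_sum => i Ci; rewrite expr2 ler_wpM2l//.
by rewrite (bigD1 i)//= lerDl sumr_ge0.
Qed.

Lemma mismatchE z z' : (mismatch z z') = (\sum_i (z i != z' i))%N.
Proof.
rewrite /mismatch -sum1_card big_mkcond/=.
by apply: eq_bigr => i _; rewrite inE; case: (z i != z' i).
Qed.

Lemma prior_mismatch (alpha : 'rV[R]_Q) (c0 K : R) z :
  (forall q, c0 <= alpha 0 q <= 1) -> 0 < c0 -> c0^-1 <= expR K ->
  prior alpha z <= prior alpha x * expR (K * (mismatch z x)%:R).
Proof.
move=> ain c00 cK.
rewrite mismatchE natr_sum mulr_sumr expR_sumE -big_split/=; apply: ler_prod => i _.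
have /andP[a1 a2] := ain (z i); have /andP[b1 b2] := ain (x i).
apply/andP; split; first lra.
case: eqVneq => [->|_] /=; first by rewrite mulr0 expR0 mulr1.
rewrite mulr1; apply: (le_trans a2); apply: (@le_trans _ _ (c0 * c0^-1)).
  by rewrite mulfV// gt_eqF.
by apply: ler_pM => //; [lra|rewrite invr_ge0; lra].
Qed.

(** The factor [expR (K * mismatch z x)] in the hypothesis pays, after squaring, for the change of
    the prior and for moving [t] to the true parameter. *)
Lemma neighbours_sum (c0 delta Bd K e w : R) t :
  entries_in lo hi pi0 -> entries_in lo hi t.2 ->
  (forall q, c0 <= t.1 0 q <= 1) -> 0 < c0 -> c0^-1 <= expR K ->
  (forall q l, `|t.2 q l - pi0 q l| <= delta) -> 0 <= delta ->
  (forall i, \sum_(j | i != j) load y r i j <= Bd) ->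
  (forall j, \sum_(i | i != j) load y r i j <= Bd) ->
  4 * delta * L * Bd <= K -> 0 <= e ->
  \sum_(z : {ffun 'I_n -> 'I_Q} | (z != x) && ((mismatch z x)%:R <= e))
     expR ((loglik z pi0 - loglik x pi0) / 2 + K * (mismatch z x)%:R) <= w ->
  \sum_(z : {ffun 'I_n -> 'I_Q} | (mismatch z x)%:R <= e) weight t z <= (1 + w ^+ 2) * weight t x.
Proof.
move=> pi0in tin ain c00 cK near d0 rowB colB dK e0 hw.
have xx : mismatch x x = 0%N by rewrite mismatchE big1// => i _; rewrite eqxx.
have wx0 : 0 <= weight t x.
  rewrite mulr_ge0 ?expR_ge0// prodr_ge0// => i _.
  by have /andP[? _] := ain (x i); lra.
rewrite (bigD1 x)/=; last by rewrite xx.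
rewrite mulrDl mul1r lerD2l mulrC.
have hw2 := sum_sqr_le (fun z : {ffun 'I_n -> 'I_Q} => expR_ge0 _) hw.
apply: le_trans (ler_wpM2l wx0 hw2); rewrite mulr_sumr.
rewrite [leLHS](eq_bigl (fun z : {ffun 'I_n -> 'I_Q} =>
  (z != x) && ((mismatch z x)%:R <= e))); last by move=> z; rewrite andbC.
apply: ler_sum => z _.
have hp := prior_mismatch z ain c00 cK.
have hl := loglik_perturb_local tm x z tin pi0in near d0 rowB colB.
rewrite -expRM_natl mulr_natl -mulr_natl.
apply: (@le_trans _ _ ((prior t.1 x * expR (K * (mismatch z x)%:R)) *
    expR (loglik x t.2 + (loglik z pi0 - loglik x pi0) + K * (mismatch z x)%:R))).
  apply: ler_pM => //; first by apply: prodr_ge0 => i _; have /andP[? _] := ain (z i); lra.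
  have := ler_wpM2r (ler0n R (mismatch z x)) dK.
  by rewrite ler_expR; lra.
rewrite /weight -!mulrA -!expRD ler_wpM2l//; last by rewrite ler_expR; lra.
by apply: prodr_ge0 => i _; have /andP[? _] := ain (x i); lra.
Qed.

Definition near_pi (delta : R) (s : 'S_Q) t : bool :=
  [forall q, forall l, `|t.2 (s q) (s l) - pi0 q l| <= delta].

(** An assignment is either close to [s o x] for some [s], and then counted
    as a neighbour of [x] for the relabelled parameter, or it loses a factor
    [expR (- F)] against the truth. *)
Lemma likelihood_upper (c0 delta Bd K e w F e1 : R) (t0 th t : param R Q) :
  t0.2 = pi0 ->
  entries_in lo hi pi0 -> entries_in lo hi t.2 ->
  (forall q, c0 <= t.1 0 q <= 1) -> (forall q, c0 <= t0.1 0 q) ->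
  0 < c0 -> c0^-1 <= expR K -> 0 <= delta ->
  (forall i, \sum_(j | i != j) load y r i j <= Bd) ->
  (forall j, \sum_(i | i != j) load y r i j <= Bd) ->
  4 * delta * L * Bd <= K -> 0 <= e ->
  \sum_(z : {ffun 'I_n -> 'I_Q} | (z != x) && ((mismatch z x)%:R <= e))
     expR ((loglik z pi0 - loglik x pi0) / 2 + K * (mismatch z x)%:R) <= w ->
  (forall z, (exists2 s : 'S_Q, near_pi delta s t & (mismatch z (fun i => s (x i)))%:R <= e) \/
     loglik z t.2 <= loglik x pi0 - F) ->
  (Q%:R / c0) ^+ n * expR (- F) <= e1 ->
  weight t0 x <= weight th x ->
  \sum_(z : {ffun 'I_n -> 'I_Q}) weight t z <=
    (1 + w ^+ 2) * (\sum_(s : 'S_Q) weight (relabel s t) x) + e1 * weight th x.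
Proof.
move=> t0E pi0in tin ain a0in c00 cK d0 rowB colB dK e0 hw dich he1 hth.
have wt0 (s : 'S_Q) z : 0 <= weight (relabel s t) z.
  rewrite mulr_ge0 ?expR_ge0// prodr_ge0// => i _; rewrite mxE.
  by have /andP[? _] := ain (s (z i)); lra.
have wt z : 0 <= weight t z.
  rewrite mulr_ge0 ?expR_ge0// prodr_ge0// => i _.
  by have /andP[? _] := ain (z i); lra.
(* Assignments close to [s o x]; an assignment may be counted for several [s]. *)
pose Z (s : 'S_Q) z := near_pi delta s t && ((mismatch z (fun i => s (x i)))%:R <= e).
have split_z z : weight t z <= (\sum_s (Z s z)%:R * weight t z) + expR (loglik x pi0 - F).
  have [[s ns ms]|far] := dich z.
    rewrite (bigD1 s)//= {1}/Z ns ms mul1r -addrA lerDl addr_ge0 ?expR_ge0//.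
    by apply: sumr_ge0 => s' _; rewrite mulr_ge0.
  apply: ler_wpDl; first by apply: sumr_ge0 => s' _; rewrite mulr_ge0.
  rewrite /weight -[leRHS]mul1r; apply: ler_pM; rewrite ?expR_ge0 ?ler_expR//.
    by apply: prodr_ge0 => i _; have /andP[? _] := ain (z i); lra.
  rewrite -[leRHS](@big1_eq _ 1 *%R _ (index_enum 'I_n) predT); apply: ler_prod => i _.
  by have /andP[? ?] := ain (z i); apply/andP; split; lra.
apply: (@le_trans _ _ (\sum_(z : {ffun 'I_n -> 'I_Q}) (\sum_s (Z s z)%:R * weight t z + expR (loglik x pi0 - F)))).
  exact: ler_sum.
rewrite big_split/= exchange_big/=; apply: lerD.
  rewrite mulr_sumr; apply: ler_sum => s _.
  case: (boolP (near_pi delta s t)) => ns; last first.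
    rewrite big1 => [|z _]; first by rewrite mulr_ge0// addr_ge0 ?sqr_ge0.
    by rewrite /Z (negbTE ns) mul0r.
  have rin : entries_in lo hi (relabel s t).2 by move=> q l; rewrite mxE; exact: tin.
  have rain q : c0 <= (relabel s t).1 0 q <= 1 by rewrite mxE; exact: ain.
  have rnear q l : `|(relabel s t).2 q l - pi0 q l| <= delta.
    by rewrite mxE; move/forallP: ns => /(_ q)/forallP/(_ l).
  apply: le_trans (neighbours_sum pi0in rin rain c00 cK rnear d0 rowB colB dK e0 hw).
  pose h (v : {ffun 'I_n -> 'I_Q}) := [ffun i => s (v i)].
  pose h' (v : {ffun 'I_n -> 'I_Q}) := [ffun i => (s^-1)%g (v i)].
  rewrite (reindex h)/=; last first.
    exists h' => v _; apply/ffunP => i; rewrite !ffunE ?permK ?permKV//.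
  rewrite [leRHS]big_mkcond/=; apply: ler_sum => v _.
  have mE : mismatch (h v) (fun i => s (x i)) = mismatch v x.
    rewrite /mismatch; apply: eq_card => i; rewrite !inE ffunE.
    by rewrite (inj_eq perm_inj).
  rewrite /Z ns mE/=; case: ifP => _; rewrite ?mul0r// mul1r.
  by rewrite -weight_relabel (@weight_ext _ _ _ _ _ _ _ (h v) (fun i => s (v i)))// => i; rewrite ffunE.
rewrite sumr_const card_ffun !card_ord -mulr_natl natrX.
apply: le_trans (ler_wpM2r _ he1); last first.
  by apply: le_trans hth; rewrite mulr_ge0 ?expR_ge0// prodr_ge0// => i _; have := a0in (x i); lra.
have hth2 : c0 ^+ n * expR (loglik x pi0) <= weight th x.
  apply: le_trans hth; rewrite /weight t0E ler_wpM2r ?expR_ge0//.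
  rewrite -[in leLHS](card_ord n) -prodr_const; apply: ler_prod => i _.
  by rewrite a0in andbT; lra.
apply: le_trans (ler_wpM2l _ hth2); last by rewrite mulr_ge0 ?expR_ge0// exprn_ge0// divr_ge0//; lra.
rewrite expRD expr_div_n.
have cn : c0 ^+ n != 0 by rewrite expf_neq0// gt_eqF.
by rewrite [leRHS](_ : _ = Q%:R ^+ n * (expR (loglik x pi0) * expR (- F)))//; field.
Qed.

End likelihood_upper.

(** Here [f s] is the ratio of the weights of the relabelled estimator and of
    the maximizer.  All the ratios but one are at most [e2], which is exponentially small, so the
    remaining one is at least [1 - 3 * u]. *)
Lemma dominant_term (R : realType) (I : finType) (close : pred I) (f : I -> R) (w2 e1 e2 u : R) :
  (forall s, 0 <= f s) ->
  1 <= (1 + w2) * (\sum_s f s) + e1 ->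
  (forall s, ~~ close s -> f s <= e2) ->
  (forall s s', close s -> close s' -> s = s') ->
  0 <= w2 <= u -> 0 <= e2 -> #|I|%:R * e2 <= u / 2 -> e1 <= u -> u <= 6^-1 ->
  exists2 s, close s & forall V, 0 <= V -> f s <= expR (- V) -> V <= 6 * u.
Proof.
move=> f0 main far uniq /andP[w20 w2u] e20 Ie2 e1u u6.
have u0 : 0 <= u by exact: le_trans w2u.
have rest (C : pred I) : (forall s, C s -> ~~ close s) -> \sum_(s | C s) f s <= u / 2.
  move=> hC; apply: le_trans Ie2.
  apply: (@le_trans _ _ (\sum_(s : I) e2)); last by rewrite sumr_const mulr_natl.
  rewrite big_mkcond/=; apply: ler_sum => s _; case: ifP => // Cs.
  by apply: far; exact: hC.
have [[s cs]|noclose] := pselect (exists s, close s); last first.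
  have hs : \sum_s f s <= u / 2.
    by apply: rest => s _; apply/negP => cs; apply: noclose; exists s.
  have : (1 + w2) * (\sum_s f s) <= (1 + u) * (u / 2).
    by apply: ler_pM => //; [lra|exact: sumr_ge0|lra].
  have : u * u <= u * 6^-1 by rewrite ler_wpM2l.
  move=> h1 h2; have : (0 : R) < 0 by lra.
  by rewrite ltxx.
exists s => // V V0 fV.
have hs : \sum_(s' | s' != s) f s' <= u / 2.
  apply: rest => s' s's; apply/negP => cs'; move/eqP: s's; apply; exact: uniq.
move: main; rewrite (bigD1 s)//= => main.
have V1 : 0 < 1 + V by lra.
(* [exp (- V) <= 1 / (1 + V)]. *)
have fV1 : f s * (1 + V) <= 1.
  rewrite -ler_pdivlMr// (le_trans fV)// expRN mul1r.
  by rewrite lef_pV2 ?posrE ?expR_gt0//; exact: expR_ge1Dx.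
have h1 : (1 + w2) * (f s + \sum_(s' | s' != s) f s') <= (1 + u) * (f s + u / 2).
  apply: ler_pM => //; [lra| |lra|lra].
  by rewrite addr_ge0// sumr_ge0.
have h2 : u * u <= u * 6^-1 by rewrite ler_wpM2l.
have h3 : u * f s <= u * 1.
  by rewrite ler_wpM2l// (le_trans fV)// -[leRHS]expR0 ler_expR; lra.
have h4 : 1 - 3 * u <= f s by lra.
have h5 : (1 - 3 * u) * (1 + V) <= f s * (1 + V) by rewrite ler_wpM2r// ltW.
have h6 : 3 * u * V <= 2^-1 * V by rewrite ler_wpM2r//; lra.
lra.
Qed.

(** * Probabilities of the exceptional events *)

Local Open Scope classical_set_scope.
Local Open Scope ring_scope.

Section dyad_products.
Context {R : realType} {n : nat}.

Lemma observed_prodE (r : 'I_n -> 'I_n -> bool) (a : 'I_n -> 'I_n -> R) :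
  \prod_i \prod_(j | i != j) (if r i j then expR (a i j) else 1) =
  expR (\sum_i \sum_(j | i != j) (r i j)%:R * a i j).
Proof.
rewrite expR_sumE; apply: eq_bigr => i _; rewrite expR_sumE; apply: eq_bigr => j _.
by case: (r i j); rewrite ?mul1r// mul0r expR0.
Qed.

Lemma moment_prod_le (rho : R) (G : 'I_n -> 'I_n -> R) :
  0 <= rho <= 1 -> (forall i j, 0 <= G i j) ->
  \prod_i \prod_(j | i != j) (1 - rho + rho * G i j) <=
  expR (- (rho * \sum_i \sum_(j | i != j) (1 - G i j))).
Proof.
move=> rho01 G0.
have t0 i j : 0 <= 1 - rho + rho * G i j.
  by rewrite addr_ge0 ?mulr_ge0//; lra.
rewrite mulr_sumr -sumrN expR_sumE; apply: ler_prod => i _; rewrite prodr_ge0//=.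
rewrite mulr_sumr -sumrN expR_sumE; apply: ler_prod => j _; rewrite t0/=.
by have := expR_ge1Dx (- (rho * (1 - G i j))); lra.
Qed.

End dyad_products.

Section bad_events.
Context {R : realType} {Q n : nat} {d} {T : measurableType d} {P : probability T R}
  {mu : {measure set R -> \bar R}} {A : set R} {b psi : R -> R} {t : param R Q} {rho : R}
  {z : T -> 'I_n -> 'I_Q} {y : T -> 'I_n -> 'I_n -> R} {r : T -> 'I_n -> 'I_n -> bool}
  {lo hi tau m L : R}.
Hypotheses (ef : expfam mu A b psi) (tm : tame psi lo hi tau m L)
  (subA : forall x, lo - tau <= x <= hi + tau -> A x)
  (tin : entries_in lo hi t.2)
  (t_prob : prob_vector t.1) (rho01 : 0 <= rho <= 1)
  (sample : sbm_dyad_sample P mu b psi t rho z y r).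

Let zf w : {ffun 'I_n -> 'I_Q} := [ffun i => z w i].

Let tA q l : A (t.2 q l).
Proof. by apply: subA; have := tin q l; have := tame_tau tm; move=> ? /andP[]; lra. Qed.

Let term (I : Type) (c : I -> {ffun 'I_n -> 'I_Q} -> R)
    (g : I -> {ffun 'I_n -> 'I_Q} -> 'I_n -> 'I_n -> R -> R) w k : R :=
  c k (zf w) * \prod_i \prod_(j | i != j) (if r w i j then g k (zf w) i j (y w i j) else 1).

(** The event [E] holds as soon as every exponential functional is below [1]; this
    turns a list of tail bounds into a single use of Markov's inequality. *)
Lemma chernoff (I : finType) (good : pred {ffun 'I_n -> 'I_Q})
    (c : I -> {ffun 'I_n -> 'I_Q} -> R)
    (g : I -> {ffun 'I_n -> 'I_Q} -> 'I_n -> 'I_n -> R -> R)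
    (G : I -> {ffun 'I_n -> 'I_Q} -> 'I_n -> 'I_n -> R) (B : R) (E : T -> Prop) :
  0 <= B -> (forall k zz, 0 <= c k zz) ->
  (forall k zz i j x, 0 <= g k zz i j x) ->
  (forall k zz i j, measurable_fun setT (g k zz i j)) ->
  (forall k zz i j, (\int[mu]_x (g k zz i j x * phi b psi x (t.2 (zz i) (zz j)))%:E =
     (G k zz i j)%:E)%E) ->
  (forall zz, good zz -> \sum_k c k zz *
     \prod_i \prod_(j | i != j) (1 - rho + rho * G k zz i j) <= B) ->
  (forall w, good (zf w) -> \sum_k term c g w k < 1 -> (forall k, term c g w k < 1) -> E w) ->
  (mu_ext P [set w | good (zf w) /\ ~ E w] <= B%:E)%E.
Proof.
move=> B0 c0 g0 mg gG bound hE.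
apply: le_trans (conditional_markov ef tA t_prob rho01 sample B0 c0 g0 mg gG bound).
apply: le_mu_ext => w /= [gw nE]; split=> //; rewrite leNgt; apply/negP => small.
apply: nE; apply: hE => // k; apply: le_lt_trans small.
rewrite (bigD1 k)//= lerDl sumr_ge0// => k' _; rewrite mulr_ge0//.
by apply: prodr_ge0 => i _; apply: prodr_ge0 => j _; case: ifP.
Qed.

Lemma expR_measurable (s u : R) : measurable_fun setT (fun x : R => expR (s * x + u)).
Proof.
apply: measurableT_comp; first exact: measurable_expR.
by apply: measurable_funD => //; apply: measurable_funM.
Qed.

(** A bound for the moment of order [tau] of [exp (1 + |y|)], uniform in the true
    parameter. *)
Definition load_moment : R := 2 * expR (tau + L * tau).

Lemma bad_loads (Bd : R) :
  (mu_ext P [set w | ~ ((forall i, (\sum_(j | i != j) load (y w) (r w) i j <= Bd)%R) /\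
                       (forall j, (\sum_(i | i != j) load (y w) (r w) i j <= Bd)%R))] <=
   (2 * n%:R * expR (rho * (n%:R * load_moment) - tau * Bd))%:E)%E.
Proof.
have tau0 : 0 < tau := tame_tau tm.
(* [g0 v] bounds [exp (tau * (1 + |v|))]. *)
pose g0 (v : R) := expR (tau * v + tau) + expR (- tau * v + tau).
pose on (k : bool * 'I_n) (i j : 'I_n) := (if k.1 then i else j) == k.2.
pose g (k : bool * 'I_n) (zz : {ffun 'I_n -> 'I_Q}) i j v := if on k i j then g0 v else 1.
pose p (zz : {ffun 'I_n -> 'I_Q}) i j := t.2 (zz i) (zz j).
pose G (k : bool * 'I_n) (zz : {ffun 'I_n -> 'I_Q}) i j := if on k i j then
  expR (psi (p zz i j + tau) - psi (p zz i j) + tau) +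
  expR (psi (p zz i j + - tau) - psi (p zz i j) + tau) else 1.
have g00 v : 0 <= g0 v by rewrite addr_ge0 ?expR_ge0.
have mg0 : measurable_fun setT g0 by apply: measurable_funD; exact: expR_measurable.
have Aplus q l : A (t.2 q l + tau) /\ A (t.2 q l + - tau).
  by split; apply: subA; have := tin q l; move=> /andP[? ?]; lra.
have gG k zz i j : (\int[mu]_x (g k zz i j x * phi b psi x (t.2 (zz i) (zz j)))%:E =
     (G k zz i j)%:E)%E.
  rewrite /g /G; case: (on k i j); last first.
    by under eq_integral do rewrite mul1r; exact: (expfam_density ef).
  rewrite /g0; under eq_integral do rewrite mulrDl EFinD.
  rewrite ge0_integralD//.
  - rewrite (exponential_moment ef _ (Aplus _ _).1).
    by rewrite (exponential_moment ef _ (Aplus _ _).2) EFinD.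
  - by move=> x _; rewrite lee_fin mulr_ge0 ?expR_ge0// (phi_ge0 ef).
  - apply/measurable_EFinP; apply: measurable_funM; first exact: expR_measurable.
    exact: phi_measurable ef _.
  - by move=> x _; rewrite lee_fin mulr_ge0 ?expR_ge0// (phi_ge0 ef).
  - apply/measurable_EFinP; apply: measurable_funM; first exact: expR_measurable.
    exact: phi_measurable ef _.
have GM k zz i j : 0 <= G k zz i j <= 1 + (on k i j)%:R * load_moment.
  rewrite /G; case: (on k i j) => /=; last by lra.
  have h (s : R) : `|s| = tau -> psi (p zz i j + s) - psi (p zz i j) <= L * tau.
    move=> sE; have := tin (zz i) (zz j) => /andP[h1 h2].
    have [s1 s2] : - tau <= s /\ s <= tau by move: (ler_norm s) (ler_norm (- s)); rewrite normrN sE; lra.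
    have : `|psi (p zz i j + s) - psi (p zz i j)| <= L * `|p zz i j + s - p zz i j|.
      by apply: (tame_lip tm); rewrite /p; lra.
    by rewrite addrAC subrr add0r sE; apply: le_trans; exact: ler_norm.
  have h1 : expR (psi (p zz i j + tau) - psi (p zz i j) + tau) <= expR (tau + L * tau).
    by rewrite ler_expR; have := h _ (gtr0_norm tau0); lra.
  have h2 : expR (psi (p zz i j + - tau) - psi (p zz i j) + tau) <= expR (tau + L * tau).
    by rewrite ler_expR; have := h (- tau); rewrite normrN gtr0_norm// => /(_ erefl); lra.
  rewrite addr_ge0 ?expR_ge0//= mul1r /load_moment; lra.
have B0 : 0 <= 2 * n%:R * expR (rho * (n%:R * load_moment) - tau * Bd).
  by rewrite !mulr_ge0 ?expR_ge0.
have lm0 : 0 <= load_moment by rewrite mulr_ge0 ?expR_ge0.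
rewrite [X in mu_ext P X](_ : _ = [set w | predT (zf w) /\
   ~ ((forall i, (\sum_(j | i != j) load (y w) (r w) i j <= Bd)%R) /\
      (forall j, (\sum_(i | i != j) load (y w) (r w) i j <= Bd)%R))]); last first.
  by apply/seteqP; split => w //= -[].
apply: (@chernoff _ predT (fun _ _ => expR (- (tau * Bd))) g G) => //.
- by move=> k zz i j v; rewrite /g; case: ifP.
- by move=> k zz i j; rewrite /g; case: (on k i j).
- move=> zz _.
  apply: (@le_trans _ _ (\sum_(k : bool * 'I_n) expR (rho * (n%:R * load_moment) - tau * Bd))); last first.
    by rewrite sumr_const card_prod card_bool card_ord -[leLHS]mulr_natl natrM.
  apply: ler_sum => k _; rewrite [leRHS]expRD [leRHS]mulrC ler_wpM2l ?expR_ge0//.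
  apply: le_trans (moment_prod_le rho01 (fun i j => (andP (GM k zz i j)).1)) _.
  rewrite ler_expR -mulrN ler_wpM2l//; first by case/andP: rho01.
  rewrite -sumrN; apply: (@le_trans _ _ (\sum_i \sum_j (on k i j)%:R * load_moment)).
    apply: ler_sum => i _; rewrite -sumrN big_mkcond/=; apply: ler_sum => j _.
    case: ifP => _; last by rewrite mulr_ge0.
    by have /andP[_] := GM k zz i j; lra.
  under eq_bigr do rewrite -mulr_suml.
  rewrite -mulr_suml ler_wpM2r//; case: k => [[] k] /=; rewrite /on/=.
    rewrite (bigD1 k)//= [X in _ + X]big1 => [|i /negbTE ->]; last by rewrite big1.
    by rewrite addr0 eqxx sumr_const card_ord.
  apply: (@le_trans _ _ (\sum_(i < n) 1)); last by rewrite sumr_const card_ord.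
  apply: ler_sum => i _; rewrite (bigD1 k)//= big1 => [|j /negbTE -> //].
  by rewrite eqxx addr0.
move=> w _ _ each.
have base k : \prod_i \prod_(j | i != j) (if r w i j then g k (zf w) i j (y w i j) else 1) < expR (tau * Bd).
  have := each k; rewrite /term expRN mulrC ltr_pdivrMr ?expR_gt0// mul1r//.
have low k : expR (tau * \sum_i \sum_(j | i != j) (on k i j)%:R * load (y w) (r w) i j) <=
    \prod_i \prod_(j | i != j) (if r w i j then g k (zf w) i j (y w i j) else 1).
  rewrite mulr_sumr expR_sumE; apply: ler_prod => i _; rewrite expR_ge0/=.
  rewrite mulr_sumr expR_sumE; apply: ler_prod => j _; rewrite expR_ge0/= /g /load.
  case: (r w i j); last by rewrite mul0r !mulr0 expR0.
  case: (on k i j); last by rewrite mul0r mulr0 expR0.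
  rewrite !mul1r /g0; have := expR_ge0 (tau * y w i j + tau).
  have := expR_ge0 (- tau * y w i j + tau).
  case: (leP 0 (y w i j)) => yij.
    by rewrite (ger0_norm yij) (_ : tau * (1 + _) = tau * y w i j + tau); [lra|ring].
  by rewrite (ltr0_norm yij) (_ : tau * (1 + _) = - tau * y w i j + tau); [lra|ring].
have fin k : \sum_i \sum_(j | i != j) (on k i j)%:R * load (y w) (r w) i j <= Bd.
  by rewrite -(ler_pM2l tau0) -ler_expR ltW// (le_lt_trans (low k)).
split=> [i|j].
  have := fin (true, i); rewrite (bigD1 i)//= [X in _ + X]big1 ?addr0; last first.
    by move=> i' /negbTE i'i; apply: big1 => j _; rewrite /on/= i'i mul0r.
  by rewrite (eq_bigr (fun j => load (y w) (r w) i j)) => [//|j _]; rewrite /on/= eqxx mul1r.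
have := fin (false, j); rewrite (exchange_big_dep predT)//= (bigD1 j)//= [X in _ + X]big1 ?addr0; last first.
  by move=> j' /negbTE j'j; apply: big1 => i _; rewrite /on/= j'j mul0r.
by rewrite (eq_bigr (fun i => load (y w) (r w) i j)) => [//|i _]; rewrite /on/= eqxx mul1r.
Qed.

(** Square root of the likelihood ratio of [(z', pi)] against the truth, for an
    observed dyad. *)
Let ratio (pi : 'M[R]_Q) (z' zz : {ffun 'I_n -> 'I_Q}) i j (v : R) : R :=
  expR ((pi (z' i) (z' j) - t.2 (zz i) (zz j)) / 2 * v +
    (psi (t.2 (zz i) (zz j)) - psi (pi (z' i) (z' j))) / 2).

Let ratio_moment pi (z' zz : {ffun 'I_n -> 'I_Q}) i j : entries_in lo hi pi ->
  (\int[mu]_x (ratio pi z' zz i j x * phi b psi x (t.2 (zz i) (zz j)))%:E =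
   (affinity psi (pi (z' i) (z' j)) (t.2 (zz i) (zz j)))%:E)%E.
Proof.
move=> piin.
have tau0 : 0 < tau := tame_tau tm.
have e : t.2 (zz i) (zz j) + (pi (z' i) (z' j) - t.2 (zz i) (zz j)) / 2 =
  (pi (z' i) (z' j) + t.2 (zz i) (zz j)) / 2 by lra.
rewrite (exponential_moment ef); last first.
  apply: subA; rewrite e.
  by have /andP[? ?] := tin (zz i) (zz j); have /andP[? ?] := piin (z' i) (z' j); lra.
by rewrite e /affinity; congr (expR _)%:E; lra.
Qed.

Let ratio_prod pi z' w :
  \prod_i \prod_(j | i != j) (if r w i j then ratio pi z' (zf w) i j (y w i j) else 1) =
  expR ((loglik psi (y w) (r w) z' pi - loglik psi (y w) (r w) (zf w) t.2) / 2).
Proof.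
rewrite observed_prodE; congr expR.
rewrite /loglik -sumrB mulr_suml; apply: eq_bigr => i _.
rewrite -sumrB mulr_suml; apply: eq_bigr => j _.
by set p1 := pi _ _; set p2 := t.2 _ _; lra.
Qed.

Let ratio_mean pi (z' zz : {ffun 'I_n -> 'I_Q}) : entries_in lo hi pi ->
  \prod_i \prod_(j | i != j) (1 - rho + rho * affinity psi (pi (z' i) (z' j)) (t.2 (zz i) (zz j)))
  <= expR (- (rho * separation psi t.2 zz pi z')).
Proof. by move=> piin; apply: moment_prod_le => // i j; exact: expR_ge0. Qed.

(** A union bound over all [Q^n] assignments and the matrices of the grid. *)
Lemma bad_far (I : finType) (pi_ : I -> 'M[R]_Q) (eta : R) : 0 <= eta ->
  (forall a, entries_in lo hi (pi_ a)) ->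
  (mu_ext P [set w | ~ (forall a (z' : {ffun 'I_n -> 'I_Q}),
     (eta * n%:R ^+ 2 <= separation psi t.2 (zf w) (pi_ a) z')%R ->
     (loglik psi (y w) (r w) z' (pi_ a) <=
      loglik psi (y w) (r w) (zf w) t.2 - eta * rho * n%:R ^+ 2)%R)] <=
   (#|I|%:R * Q%:R ^+ n * expR (- (eta * rho * n%:R ^+ 2 / 2)))%:E)%E.
Proof.
move=> eta0 piin.
pose far (k : I * {ffun 'I_n -> 'I_Q}) (zz : {ffun 'I_n -> 'I_Q}) :=
  eta * n%:R ^+ 2 <= separation psi t.2 zz (pi_ k.1) k.2.
pose c k zz := if far k zz then expR (eta * rho * n%:R ^+ 2 / 2) else 0.
rewrite [X in mu_ext P X](_ : _ = [set w | predT (zf w) /\ ~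
   (forall a (z' : {ffun 'I_n -> 'I_Q}),
     (eta * n%:R ^+ 2 <= separation psi t.2 (zf w) (pi_ a) z')%R ->
     (loglik psi (y w) (r w) z' (pi_ a) <=
      loglik psi (y w) (r w) (zf w) t.2 - eta * rho * n%:R ^+ 2)%R)]); last first.
  by apply/seteqP; split => w //= -[].
apply: (@chernoff _ predT c (fun k (zz : {ffun 'I_n -> 'I_Q}) => ratio (pi_ k.1) k.2 zz)
   (fun k (zz : {ffun 'I_n -> 'I_Q}) i j => affinity psi (pi_ k.1 (k.2 i) (k.2 j)) (t.2 (zz i) (zz j)))) => //.
- by move=> k zz; rewrite /c; case: ifP => // _; exact: expR_ge0.
- by move=> *; exact: expR_ge0.
- by move=> *; exact: expR_measurable.
- by move=> *; exact: ratio_moment.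
- move=> zz _.
  apply: (@le_trans _ _ (\sum_(k : I * {ffun 'I_n -> 'I_Q}) expR (- (eta * rho * n%:R ^+ 2 / 2)))); last first.
    by rewrite sumr_const card_prod card_ffun !card_ord -[leLHS]mulr_natl natrM natrX.
  apply: ler_sum => k _; rewrite /c; case: ifP => [fk|_]; last by rewrite mul0r expR_ge0.
  apply: le_trans (ler_wpM2l (expR_ge0 _) (ratio_mean _ _ (piin _))) _.
  rewrite -expRD ler_expR.
  have rho0 : 0 <= rho by case/andP: rho01.
  by have := ler_wpM2l rho0 fk; lra.
move=> w _ _ each a z' fz; have := each (a, z').
rewrite /term ratio_prod /c /far fz -expRD -[ltRHS]expR0 ltr_expR/=.
lra.
Qed.

Lemma sum_mismatch (zz : {ffun 'I_n -> 'I_Q}) (v : R) : 0 <= v ->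
  \sum_(z' : {ffun 'I_n -> 'I_Q}) v ^+ mismatch z' zz <= (1 + Q%:R * v) ^+ n.
Proof.
move=> v0.
have -> : \sum_(z' : {ffun 'I_n -> 'I_Q}) v ^+ mismatch z' zz =
  \sum_(z' : {ffun 'I_n -> 'I_Q}) \prod_i v ^+ (z' i != zz i).
  by apply: eq_bigr => z' _; rewrite mismatchE expr_sum.
rewrite -(bigA_distr_bigA (fun i q => v ^+ (q != zz i))).
rewrite -[in leRHS](card_ord n) -prodr_const; apply: ler_prod => i _.
rewrite sumr_ge0 => [|q _]; last exact: exprn_ge0.
rewrite (bigD1 (zz i))//= eqxx expr0 lerD2l.
rewrite (eq_bigr (fun=> v)) => [|q ->]; last by rewrite expr1.
apply: (@le_trans _ _ (\sum_(q : 'I_Q) v)); last by rewrite sumr_const card_ord mulr_natl.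
by rewrite big_mkcond/=; apply: ler_sum => q _; case: ifP.
Qed.

Definition balanced_classes (c : R) : pred {ffun 'I_n -> 'I_Q} :=
  fun zz => [forall q, c * n%:R <= #|[set i | zz i == q]%SET|%:R].

(** Half of the exponent per misclassified node in [separation_local]. *)
Definition local_rate (c Delta : R) : R := rho * (c / 2 * n%:R) * gap m Delta / 2.

(** Half of the exponent given by [separation_local] is spent on the factor
    [expR (local_rate * mismatch)]; the other half bounds the sum over assignments by a binomial
    expansion ([sum_mismatch]). *)
Lemma bad_local (c Delta e N : R) : 0 < Delta -> 0 < N -> 0 <= c -> e <= c / 2 * n%:R ->
  (forall q q', q != q' -> exists l, Delta <= `|t.2 q l - t.2 q' l|) ->
  (mu_ext P [set w | balanced_classes c (zf w) /\ ~
    (\sum_(z' : {ffun 'I_n -> 'I_Q} | (z' != zf w) && ((mismatch z' (zf w))%:R <= e))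
       expR ((loglik psi (y w) (r w) z' t.2 - loglik psi (y w) (r w) (zf w) t.2) / 2 +
          local_rate c Delta * (mismatch z' (zf w))%:R) <= N^-1)%R] <=
   (N * ((1 + Q%:R * expR (- local_rate c Delta)) ^+ n - 1))%:E)%E.
Proof.
move=> D0 N0 c0 ec rows; set K := local_rate c Delta.
have rho0 : 0 <= rho by case/andP: rho01.
pose near (z' zz : {ffun 'I_n -> 'I_Q}) := (z' != zz) && ((mismatch z' zz)%:R <= e).
pose c_ (z' zz : {ffun 'I_n -> 'I_Q}) := if near z' zz then N * expR (K * (mismatch z' zz)%:R) else 0.
have xx (x : {ffun 'I_n -> 'I_Q}) : mismatch x x = 0%N.
  by rewrite mismatchE big1// => i _; rewrite eqxx.
have bound (zz : {ffun 'I_n -> 'I_Q}) : \sum_(z' : {ffun 'I_n -> 'I_Q} | z' != zz)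
    expR (- K * (mismatch z' zz)%:R) <= (1 + Q%:R * expR (- K)) ^+ n - 1.
  have := sum_mismatch zz (expR_ge0 (- K)); rewrite (bigD1 zz)//= xx expr0.
  rewrite (eq_bigr (fun z' : {ffun 'I_n -> 'I_Q} => expR (- K * (mismatch z' zz)%:R))); first by lra.
  by move=> z' _; rewrite mulrC expRM_natl.
apply: (@chernoff _ _ c_ (fun z' zz => ratio t.2 z' zz)
   (fun (z' zz : {ffun 'I_n -> 'I_Q}) i j => affinity psi (t.2 (z' i) (z' j)) (t.2 (zz i) (zz j)))) => //.
- rewrite mulr_ge0 ?(ltW N0)// subr_ge0 exprn_ege1// lerDl mulr_ge0 ?expR_ge0//.
- move=> k zz; rewrite /c_; case: ifP => // _; rewrite mulr_ge0 ?expR_ge0//; exact: ltW.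
- by move=> *; exact: expR_ge0.
- by move=> *; exact: expR_measurable.
- by move=> *; exact: ratio_moment.
- move=> zz /forallP bal.
  apply: le_trans (ler_wpM2l (ltW N0) (bound zz)).
  rewrite mulr_sumr [leRHS]big_mkcond/=; apply: ler_sum => z' _; rewrite /c_ /near.
  case: (eqVneq z' zz) => [_|zn] /=; first by rewrite mul0r.
  case: ifP => [me|_]; last by rewrite mul0r mulr_ge0 ?expR_ge0// ltW.
  rewrite -mulrA ler_wpM2l ?(ltW N0)//.
  apply: le_trans (ler_wpM2l (expR_ge0 _) (ratio_mean _ _ tin)) _.
  rewrite -expRD ler_expR.
  have := separation_local tm tin D0 rows bal (le_trans me ec).
  by move/(ler_wpM2l rho0); rewrite /K /local_rate; lra.
move=> w _ small _; rewrite -(ler_pM2l N0) mulfV ?gt_eqF//.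
apply: le_trans (ltW small); rewrite mulr_sumr big_mkcond/=; apply: ler_sum => z' _.
rewrite /term ratio_prod /c_ /near; case: ifP => _; last by rewrite mul0r.
by rewrite addrC expRD mulrA.
Qed.

Lemma block_size (c : R) (zz : {ffun 'I_n -> 'I_Q}) q l : 2 <= c * n%:R ->
  balanced_classes c zz ->
  c ^+ 2 * n%:R ^+ 2 / 2 <= \sum_i \sum_(j | i != j) ((zz i == q) && (zz j == l))%:R :> R.
Proof.
move=> cn /forallP bal; have hq := bal q; have hl := bal l.
set I := [set i | zz i == q]%SET in hq; set J := [set i | zz i == l]%SET in hl.
apply: (@le_trans _ _ (#|I|%:R * (#|J|%:R - 1))).
  have -> : c ^+ 2 * n%:R ^+ 2 / 2 = (c * n%:R) * (c * n%:R / 2) by field.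
  by apply: ler_pM => //; lra.
rewrite (bigID (mem I))/=; apply: ler_wpDr.
  by apply: sumr_ge0 => i _; apply: sumr_ge0.
rewrite mulr_natl -sumr_const; apply: ler_sum => i iI.
have zi : zz i == q by move: iI; rewrite inE.
apply: (@le_trans _ _ (\sum_(j in (J :\ i)%SET) 1)).
  rewrite sumr_const lerBlDr natr1 ler_nat.
  by rewrite [leqLHS](cardsD1 i) -[leqRHS]add1n leq_add2r leq_b1.
rewrite big_mkcond [leRHS]big_mkcond/=; apply: ler_sum => j _.
by rewrite !inE zi /= (eq_sym j); case: (i != j); case: (zz j == l).
Qed.

(** An exponent common to the three kinds of tail bounds in [bad_blocks]. *)
Definition block_rate (delta : R) : R :=
  Num.min ((1 - expR (- (m / 2 * delta ^+ 2))) / 2) 8^-1.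

(** Chernoff bounds for the number and the mean of the observed dyads in a block.
    Tilting by [delta] against the mean at the parameter shifted by [delta]
    leaves a Bregman divergence of [psi], at least [m / 2 * delta ^+ 2]. *)
Lemma bad_blocks (c delta : R) : 0 < c -> 0 < delta <= tau -> 2 <= c * n%:R ->
  (mu_ext P [set w | balanced_classes c (zf w) /\ ~ (forall q l,
     [/\ (rho * (c ^+ 2 * n%:R ^+ 2 / 8) <= dyad_count (r w) (zf w) q l)%R,
         (0 < dyad_count (r w) (zf w) q l :> R)%R &
         (derive1 psi (t.2 q l - delta) < y_hat (y w) (r w) (zf w) q l <
          derive1 psi (t.2 q l + delta))%R])] <=
   (Q%:R ^+ 2 * 3 * expR (- (rho * (c ^+ 2 * n%:R ^+ 2 * block_rate delta))))%:E)%E.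
Proof.
move=> c0 /andP[d0 dtau] cn; set g := block_rate delta.
have rho0 : 0 <= rho by case/andP: rho01.
have tau0 : 0 < tau := tame_tau tm.
have m0 : 0 < m := tame_m tm.
pose on (k : ('I_Q * 'I_Q) * option bool) (zz : {ffun 'I_n -> 'I_Q}) i j :=
  (zz i == k.1.1) && (zz j == k.1.2).
pose p (k : ('I_Q * 'I_Q) * option bool) := t.2 k.1.1 k.1.2.
pose sl (k : ('I_Q * 'I_Q) * option bool) : R := match k.2 with
  | None => 0 | Some true => delta | Some false => - delta end.
pose ic k : R := if k.2 is None then -1 else - sl k * derive1 psi (p k + sl k).
(* [None] bounds the number of observed dyads of the block from below, [Some true]
   and [Some false] bound their mean from above and from below. *)
pose c_ (k : ('I_Q * 'I_Q) * option bool) (zz : {ffun 'I_n -> 'I_Q}) : R :=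
  if k.2 is None then expR (rho * (c ^+ 2 * n%:R ^+ 2 / 8)) else 1.
pose gk k zz i j (v : R) := if on k zz i j then expR (sl k * v + ic k) else 1.
pose G k (zz : {ffun 'I_n -> 'I_Q}) i j := if on k zz i j then expR (psi (p k + sl k) - psi (p k) + ic k) else 1.
have slle k : `|sl k| <= tau.
  by rewrite /sl; case: k.2 => [[]|]; rewrite ?normrN ?normr0 ?gtr0_norm//; lra.
have pin k : lo - tau <= p k + sl k <= hi + tau /\ lo - tau <= p k <= hi + tau.
  have := tin k.1.1 k.1.2; rewrite -/(p k) => /andP[? ?].
  by have := ler_norm (sl k); have := ler_norm (- sl k); rewrite normrN; have := slle k; lra.
have Gle k : k.2 != None -> expR (psi (p k + sl k) - psi (p k) + ic k) <= expR (- (m / 2 * delta ^+ 2)).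
  move=> kn; rewrite ler_expR.
  have [h1 h2] := pin k; have := tame_convex tm h2 h1.
  rewrite /ic (_ : p k - (p k + sl k) = - sl k); last by ring.
  have : sl k ^+ 2 = delta ^+ 2 by rewrite /sl; case: k.2 kn => [[]|]//= _; rewrite sqrrN.
  by rewrite sqrrN => -> ; case: k.2 kn => [?|]//= _; lra.
have g8 : g <= 8^-1 by rewrite /g /block_rate ge_min lexx orbT.
have g2 : 2 * g <= 1 - expR (- (m / 2 * delta ^+ 2)).
  have : g <= (1 - expR (- (m / 2 * delta ^+ 2))) / 2 by rewrite /g /block_rate ge_min lexx.
  lra.
have e1 : expR (-1 : R) <= 2^-1.
  by rewrite expRN lef_pV2 ?posrE ?expR_gt0//; have := expR_ge1Dx (1 : R); lra.
have on_sum (k : ('I_Q * 'I_Q) * option bool) (zz : {ffun 'I_n -> 'I_Q}) (a : 'I_n -> 'I_n -> R) w :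
    \prod_i \prod_(j | i != j) (if r w i j then (if on k zz i j then expR (a i j) else 1) else 1) =
    expR (\sum_i \sum_(j | i != j) (r w i j)%:R * ((on k zz i j)%:R * a i j)).
  rewrite -observed_prodE; apply: eq_bigr => i _; apply: eq_bigr => j _.
  by case: (r w i j) => //; case: (on k zz i j); rewrite ?mul1r// mul0r expR0.
apply: (@chernoff _ _ c_ gk G) => //.
- by move=> k zz; rewrite /c_; case: k.2 => // *; exact: expR_ge0.
- by move=> k zz i j v; rewrite /gk; case: ifP => // _; exact: expR_ge0.
- by move=> k zz i j; rewrite /gk; case: (on k zz i j) => //; exact: expR_measurable.
- move=> k zz i j; rewrite /gk /G; case: ifP => [/andP[/eqP zi /eqP zj]|_]; last first.
    by under eq_integral do rewrite mul1r; exact: (expfam_density ef).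
  rewrite zi zj -/(p k) (exponential_moment ef)//; apply: subA.
  exact: (pin k).1.
- move=> zz bal.
  apply: (@le_trans _ _ (\sum_(k : ('I_Q * 'I_Q) * option bool)
      expR (- (rho * (c ^+ 2 * n%:R ^+ 2 * g))))); last first.
    by rewrite sumr_const !card_prod card_option card_bool !card_ord -[leLHS]mulr_natl !natrM.
  apply: ler_sum => k _.
  have G0 i j : 0 <= G k zz i j by rewrite /G; case: ifP => // _; exact: expR_ge0.
  have c_0 : 0 <= c_ k zz by rewrite /c_; case: k.2 => // *; exact: expR_ge0.
  apply: le_trans (ler_wpM2l c_0 (moment_prod_le rho01 G0)) _.
  pose h := 1 - expR (psi (p k + sl k) - psi (p k) + ic k).
  have -> : \sum_i \sum_(j | i != j) (1 - G k zz i j) =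
      h * \sum_i \sum_(j | i != j) ((zz i == k.1.1) && (zz j == k.1.2))%:R.
    rewrite mulr_sumr; apply: eq_bigr => i _; rewrite mulr_sumr; apply: eq_bigr => j _.
    by rewrite /G /on /h; case: ifP => _; rewrite ?mulr1// mulr0 subrr.
  have bs := block_size k.1.1 k.1.2 cn bal.
  set S := \sum_i _ in bs *.
  have V0 : 0 <= c ^+ 2 * n%:R ^+ 2 :> R by rewrite mulr_ge0 ?sqr_ge0.
  rewrite /c_; case kE : k.2 => [u|].
    have h2 : 2 * g <= h by have := Gle k; rewrite kE /h => /(_ isT); lra.
    have h0 : 0 <= h.
      by rewrite /h subr_ge0 (le_trans (Gle k _)) ?kE// -[leRHS]expR0 ler_expR oppr_le0 mulr_ge0 ?sqr_ge0//; lra.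
    rewrite mul1r ler_expR lerN2 ler_wpM2l//.
    apply: le_trans (ler_wpM2l h0 bs).
    by have := ler_wpM2r V0 h2; lra.
  have h2 : 2^-1 <= h.
    have -> : h = 1 - expR (-1) by rewrite /h /ic /sl kE addr0 subrr add0r.
    by lra.
  rewrite -expRD ler_expR.
  have h3 : 2^-1 * (c ^+ 2 * n%:R ^+ 2 / 2) <= h * S by apply: ler_pM => //; lra.
  have := ler_wpM2l rho0 h3; have := ler_wpM2l rho0 (ler_wpM2l V0 g8); lra.
move=> w bal _ each q l.
set N := dyad_count _ _ _ _; set S := dyad_total (y w) (r w) (zf w) q l.
have sumE (s0 u : R) : \sum_i \sum_(j | i != j) (r w i j)%:R *
    ((on ((q, l), None : option bool) (zf w) i j)%:R * (s0 * y w i j + u)) = s0 * S + u * N.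
  rewrite /S /N /dyad_total /dyad_count !mulr_sumr -big_split/=; apply: eq_bigr => i _.
  rewrite !mulr_sumr -big_split/=; apply: eq_bigr => j _.
  by rewrite /on/= -mulnb natrM; ring.
have hN := each ((q, l), None).
have hU := each ((q, l), Some true).
have hL := each ((q, l), Some false).
rewrite /term /c_ /gk (on_sum _ _ (fun i j => _)) sumE -expRD -[ltRHS]expR0 ltr_expR /ic /sl/= in hN.
rewrite /term /c_ /gk (on_sum _ _ (fun i j => _)) sumE mul1r -[ltRHS]expR0 ltr_expR /ic /sl /p/= in hU.
rewrite /term /c_ /gk (on_sum _ _ (fun i j => _)) sumE mul1r -[ltRHS]expR0 ltr_expR /ic /sl /p/= in hL.
have N0 : 0 <= N.
  by apply: sumr_ge0 => i _; apply: sumr_ge0 => j _; rewrite !mulr_ge0.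
have hU' : S < N * derive1 psi (t.2 q l + delta).
  by rewrite -(ltr_pM2l d0); lra.
have hL' : N * derive1 psi (t.2 q l - delta) < S.
  by rewrite -(ltr_pM2l d0); lra.
have Npos : 0 < N.
  rewrite lt_neqAle N0 andbT; apply/eqP => N0'; move: hU' hL'; rewrite -N0' !mul0r.
  by move=> /lt_trans h /h; rewrite ltxx.
split=> //; first by lra.
by rewrite /y_hat -/N -/S ltr_pdivlMr// ltr_pdivrMr// mulrC hL' mulrC.
Qed.

End bad_events.

(** * Class proportions *)

Section class_proportions.
Context {R : realType} {Q n : nat} {d} {T : measurableType d} {P : probability T R}
  {mu : {measure set R -> \bar R}} {b psi : R -> R} {t : param R Q} {rho : R}
  {z : T -> 'I_n -> 'I_Q} {y : T -> 'I_n -> 'I_n -> R} {r : T -> 'I_n -> 'I_n -> bool}.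
Hypotheses (n_gt0 : (0 < n)%N) (t_prob : prob_vector t.1)
  (sample : sbm_dyad_sample P mu b psi t rho z y r).

Let zf w : {ffun 'I_n -> 'I_Q} := [ffun i => z w i].

Lemma memberships_law (C : pred {ffun 'I_n -> 'I_Q}) :
  (mu_ext P [set w | C (zf w)] <=
   (\sum_(zz : {ffun 'I_n -> 'I_Q} | C zz) \prod_i t.1 0 (zz i))%:E)%E.
Proof.
pose F (zz : {ffun 'I_n -> 'I_Q}) := if C zz then [set w | forall i, z w i = zz i] else set0.
have sub : [set w | C (zf w)] `<=` \bigcup_zz F zz.
  by move=> w /= Cw; exists (zf w) => //; rewrite /F Cw => i; rewrite ffunE.
apply: (le_trans (le_mu_ext _ sub)); apply: (le_trans (outer_measure_bigcup_fin _ _)).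
rewrite [in leRHS]big_mkcond/= -sumEFin; apply: lee_sum => zz _; rewrite /F.
case: ifP => _; last by rewrite outer_measure0.
have mz := measurable_memberships sample zz.
by rewrite (measurable_mu_extE _ mz) le_eqVlt; apply/orP; left; apply/eqP; exact: (sbm_law_z sample).
Qed.

Lemma expR_le_quadratic (u : R) : `|u| <= 2^-1 -> expR u <= 1 + u + 2 * u ^+ 2.
Proof.
move=> u2; have [u21 u22] : - 2^-1 <= u /\ u <= 2^-1.
  by have := ler_norm u; have := ler_norm (- u); rewrite normrN; lra.
have u1 : 0 < 1 - u by lra.
have eu : expR u <= (1 - u)^-1.
  by rewrite -[leLHS]invrK -expRN lef_pV2 ?posrE ?expR_gt0//; exact: expR_ge1Dx.
apply: (le_trans eu).
rewrite -[leLHS]mul1r ler_pdivrMr//.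
have : 0 <= u ^+ 2 * (1 - 2 * u) by rewrite mulr_ge0 ?sqr_ge0//; lra.
have -> : (1 + u + 2 * u ^+ 2) * (1 - u) = 1 + u ^+ 2 * (1 - 2 * u) by ring.
lra.
Qed.

Lemma alpha_hat_deviation (e : R) : 0 < e <= 1 ->
  (mu_ext P [set w | ~ (forall q, (`|alpha_hat (zf w) 0 q - t.1 0 q| <= e)%R)] <=
   (2 * Q%:R * expR (- (n%:R * e ^+ 2 / 8)))%:E)%E.
Proof.
move=> /andP[e0 e1].
have nR : 0 < n%:R :> R by rewrite ltr0n.
pose C (zz : {ffun 'I_n -> 'I_Q}) := [exists q, e < `|alpha_hat zz 0 q - t.1 0 q|].
have sub : [set w | ~ (forall q, (`|alpha_hat (zf w) 0 q - t.1 0 q| <= e)%R)] `<=`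
    [set w | C (zf w)].
  move=> w /= /existsNP[q /negP]; rewrite -ltNge => h.
  by apply/existsP; exists q.
apply: (le_trans (le_mu_ext _ sub)); apply: (le_trans (memberships_law _)).
rewrite lee_fin.
have [a0 a1] := t_prob.
pose sg (s : bool) : R := if s then 1 else -1.
(* Minimizes the exponent [2 * la ^+ 2 - la * e]. *)
pose la := e / 4.
pose tilt (k : bool * 'I_Q) (q : 'I_Q) : R :=
  expR (la * sg k.1 * ((q == k.2)%:R - t.1 0 k.2) - la * e).
have tiltE k (zz : {ffun 'I_n -> 'I_Q}) : \prod_i tilt k (zz i) =
   expR (n%:R * la * (sg k.1 * (alpha_hat zz 0 k.2 - t.1 0 k.2) - e)).
  rewrite /tilt -expR_sumE; congr expR; rewrite sumrB -mulr_sumr sumrB.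
  rewrite !sumr_const !card_ord mxE -[_ *+ n]mulr_natl -[(la * e) *+ n]mulr_natl.
  by field; rewrite gt_eqF.
apply: (@le_trans _ _ (\sum_(zz : {ffun 'I_n -> 'I_Q}) \sum_(k : bool * 'I_Q)
    \prod_i (t.1 0 (zz i) * tilt k (zz i)))).
  rewrite big_mkcond/=; apply: ler_sum => zz _.
  have pos k : 0 <= \prod_i (t.1 0 (zz i) * tilt k (zz i)).
    by apply: prodr_ge0 => i _; rewrite mulr_ge0 ?expR_ge0.
  case: ifP => [/existsP[q hq]|_]; last by apply: sumr_ge0.
  pose k := (0 <= alpha_hat zz 0 q - t.1 0 q, q).
  rewrite (bigD1 k)//=; apply: ler_wpDr; first exact: sumr_ge0.
  rewrite big_split/= ler_peMr//; first by apply: prodr_ge0.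
  rewrite tiltE -expR0 ler_expR !mulr_ge0//; first by rewrite /la; lra.
  rewrite subr_ge0 /sg /k/=; move: hq; case: (leP 0 (alpha_hat zz 0 q - _)) => h.
    by rewrite ger0_norm// mul1r => /ltW.
  by rewrite ltr0_norm// mulN1r => /ltW.
rewrite exchange_big/=.
apply: (@le_trans _ _ (\sum_(k : bool * 'I_Q) expR (- (n%:R * e ^+ 2 / 8)))); last first.
  by rewrite sumr_const card_prod card_bool card_ord -[leLHS]mulr_natl natrM.
apply: ler_sum => k _.
rewrite -(bigA_distr_bigA (fun _ q => t.1 0 q * tilt k q)).
have la2 : `|la * sg k.1| <= 2^-1.
  by rewrite normrM ger0_norm /la; [case: k.1; rewrite /sg ?normrN normr1; lra|lra].
have ak1 : t.1 0 k.2 <= 1 by rewrite -a1 (bigD1 k.2)//= lerDl sumr_ge0.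
apply: (@le_trans _ _ (\prod_(i < n) expR (- (e ^+ 2 / 8)))); last first.
  by rewrite prodr_const card_ord -expRM_natl ler_expR; lra.
apply: ler_prod => i _; rewrite sumr_ge0/= => [|q _]; last by rewrite mulr_ge0 ?expR_ge0.
have -> : \sum_q t.1 0 q * tilt k q =
    (1 + t.1 0 k.2 * (expR (la * sg k.1) - 1)) * expR (- (la * sg k.1 * t.1 0 k.2) - la * e).
  have -> : 1 + t.1 0 k.2 * (expR (la * sg k.1) - 1) = \sum_q t.1 0 q * expR (la * sg k.1 * (q == k.2)%:R).
    rewrite (bigD1 k.2)//= eqxx mulr1.
    rewrite [in RHS](eq_bigr (fun q => t.1 0 q)) => [|q /negbTE ->]; last by rewrite mulr0 expR0 mulr1.
    have := a1; rewrite (bigD1 k.2)//= => /(canRL (addKr _)) ->.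
    by rewrite /=; ring.
  rewrite mulr_suml; apply: eq_bigr => q _; rewrite -mulrA -expRD /tilt.
  by congr (_ * expR _); ring.
apply: (@le_trans _ _ (expR (t.1 0 k.2 * (expR (la * sg k.1) - 1)) * expR (- (la * sg k.1 * t.1 0 k.2) - la * e))).
  by rewrite ler_wpM2r ?expR_ge0//; exact: expR_ge1Dx.
rewrite -expRD ler_expR.
have h := expR_le_quadratic la2.
have sg2 : (la * sg k.1) ^+ 2 = la ^+ 2 by rewrite exprMn /sg; case: k.1; rewrite ?sqrrN expr1n mulr1.
rewrite sg2 in h.
have := ler_wpM2l (a0 k.2) h.
have l2 : 0 <= la ^+ 2 by exact: sqr_ge0.
have := ler_wpM2r l2 ak1.
have -> : e ^+ 2 / 8 = 2 * la ^+ 2 by rewrite /la; field.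
have -> : la * e = 4 * la ^+ 2 by rewrite /la; field.
lra.
Qed.

End class_proportions.

(** * Separation constants and growth rates *)

Section finite_choices.
Context {R : realType}.

Lemma fin_lower_bound (I : finType) (C : I -> R -> Prop) :
  (forall i e e', e' <= e -> C i e -> C i e') ->
  (forall i, exists2 e, 0 < e & C i e) -> exists2 e, 0 < e & forall i, C i e.
Proof.
move=> down hC.
have gen (s : seq I) : exists2 e, 0 < e & forall i, i \in s -> C i e.
  elim: s => [|i s [e e0 he]]; first by exists 1.
  have [e' e'0 he'] := hC i.
  exists (Num.min e e'); first by rewrite lt_min e0.
  move=> j; rewrite in_cons => /orP[/eqP->|js].
    by apply: down he'; rewrite ge_min lexx orbT.
  by apply: down (he _ js); rewrite ge_min lexx.
have [e e0 he] := gen (enum I); exists e => // i; apply: he.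
by rewrite mem_enum.
Qed.

(** Total boundedness of the set of matrices with entries in an interval. *)
Lemma matrix_grid (Q : nat) (lo hi delta : R) : lo <= hi -> 0 < delta ->
  exists (I : finType) (g : I -> 'M[R]_Q), (forall a, entries_in lo hi (g a)) /\
    forall pi, entries_in lo hi pi -> exists a, forall q l, `|pi q l - g a q l| <= delta.
Proof.
move=> lohi d0.
pose N := (Num.truncn ((hi - lo) / delta)).+1.
pose g (a : {ffun 'I_Q * 'I_Q -> 'I_N}) : 'M[R]_Q := \matrix_(q, l) (lo + (a (q, l))%:R * delta).
have hl0 : 0 <= (hi - lo) / delta by rewrite divr_ge0// ?subr_ge0// ltW.
exists {ffun 'I_Q * 'I_Q -> 'I_N}, g; split=> [a q l|pi piin].
  rewrite mxE lerDl mulr_ge0 ?(ltW d0)//=.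
  have : (a (q, l))%:R <= (hi - lo) / delta.
    have /andP[+ _] := truncn_itv hl0; apply: le_trans.
    by rewrite ler_nat -ltnS; exact: ltn_ord.
  by rewrite ler_pdivlMr//; lra.
have kP q l : (Num.truncn ((pi q l - lo) / delta) < N)%N.
  have /andP[p1 p2] := piin q l.
  have pl0 : 0 <= (pi q l - lo) / delta by rewrite divr_ge0 ?subr_ge0// ltW.
  rewrite ltnS -ltnS -(ltr_nat R); have /andP[t1 _] := truncn_itv pl0.
  have /andP[_ t2] := truncn_itv hl0; apply: le_lt_trans t1 _; apply: le_lt_trans t2.
  by rewrite ler_pM2r ?invr_gt0//; lra.
exists [ffun p => Ordinal (kP p.1 p.2)] => q l; rewrite mxE ffunE/=.
have /andP[p1 p2] := piin q l.
have pl0 : 0 <= (pi q l - lo) / delta by rewrite divr_ge0 ?subr_ge0// ltW.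
have /andP[] := truncn_itv pl0; set k := Num.truncn _.
rewrite ler_pdivlMr// ltr_pdivrMr// -natr1 => k1 k2.
by rewrite ger0_norm; lra.
Qed.

Lemma matrix_norm_gt (k l : nat) (X : 'M[R]_(k, l)) (e : R) : 0 <= e -> e < `|X| ->
  exists i j, e < `|X i j|.
Proof.
move=> e0 eX; have [X0|/mx_norm_neq0[[i j] ij]] := eqVneq (mx_norm X) 0.
  by move: eX; rewrite [ltRHS]X0 ltNge e0.
by exists i, j; move: eX; rewrite [ltRHS]ij.
Qed.

End finite_choices.

Section identifiable_parameter.
Context {R : realType} {Q : nat} (psi : R -> R) (t0 : param R Q).
Hypothesis distinct : distinct_mean_degrees psi t0.

Let degree q := \sum_l derive1 psi (t0.2 q l) * t0.1 0 l.

Let degree_inj : injective degree.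
Proof.
move=> q q' e; apply: distinct; rewrite !mxE.
have E p : \sum_j map_mx (derive1 psi) t0.2 p j * (t0.1^T) j 0 = degree p.
  by apply: eq_bigr => l _; rewrite !mxE.
by rewrite !E.
Qed.

(** Two equal rows would give two equal mean degrees. *)
Lemma rows_separated : exists2 Delta, 0 < Delta &
  forall q q', q != q' -> exists l, Delta <= `|t0.2 q l - t0.2 q' l|.
Proof.
have [Delta D0 hD] : exists2 e : R, 0 < e & forall p : 'I_Q * 'I_Q,
    p.1 != p.2 -> exists l, e <= `|t0.2 p.1 l - t0.2 p.2 l|.
  apply: fin_lower_bound => [p e e' ee' h /h[l hl]|p].
    by exists l; exact: le_trans hl.
  have [pp|pp] := eqVneq p.1 p.2; first by exists 1.
  have [l hl] : exists l, t0.2 p.1 l != t0.2 p.2 l.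
    apply: contrapT => /forallNP same; move/eqP: pp; apply; apply: degree_inj.
    by apply: eq_bigr => l _; have /negP/negPn/eqP -> := same l.
  exists `|t0.2 p.1 l - t0.2 p.2 l|; first by rewrite normr_gt0 subr_eq0.
  by move=> _; exists l.
by exists Delta => // q q'; exact: (hD (q, q')).
Qed.

(** A symmetry of the parameter preserves the mean degrees, hence is trivial. *)
Lemma symmetries_separated : exists2 Delta, 0 < Delta & forall s : 'S_Q, s != 1%g ->
  (exists q, Delta <= `|t0.1 0 (s q) - t0.1 0 q|) \/
  (exists q l, Delta <= `|t0.2 (s q) (s l) - t0.2 q l|).
Proof.
apply: fin_lower_bound => [s e e' ee' h /h[[q hq]|[q [l hl]]]|s].
- by left; exists q; exact: le_trans hq.
- by right; exists q, l; exact: le_trans hl.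
have [->|sn] := eqVneq s 1%g; first by exists 1 => //; rewrite eqxx.
have [[q hq]|noq] := pselect (exists q, t0.1 0 (s q) != t0.1 0 q).
  exists `|t0.1 0 (s q) - t0.1 0 q|; first by rewrite normr_gt0 subr_eq0.
  by move=> _; left; exists q.
have [[q [l hl]]|nol] := pselect (exists q l, t0.2 (s q) (s l) != t0.2 q l).
  exists `|t0.2 (s q) (s l) - t0.2 q l|; first by rewrite normr_gt0 subr_eq0.
  by move=> _; right; exists q, l.
case/eqP: sn; apply/permP => q; rewrite perm1; apply: degree_inj.
rewrite /degree (reindex_inj (@perm_inj _ s))/=; apply: eq_bigr => l _.
have /negP/negPn/eqP-> : ~ (t0.1 0 (s l) != t0.1 0 l) by move=> h; apply: noq; exists l.
suff -> : t0.2 (s q) (s l) = t0.2 q l by [].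
by apply: contrapT => /eqP h; apply: nol; exists q, l.
Qed.

End identifiable_parameter.

Section closeness.
Context {R : realType} {Q : nat} (t0 : param R Q).

Definition close_param (delta : R) (t : param R Q) (s : 'S_Q) : bool :=
  [forall q, `|t.1 0 (s q) - t0.1 0 q| <= delta] && near_pi t0.2 delta s t.

(** If [s] and [s'] both align [t] with [t0], their quotient is nearly a
    symmetry of [t0]. *)
Lemma close_param_unique (delta Delta : R) t s s' : delta *+ 2 < Delta ->
  (forall s : 'S_Q, s != 1%g ->
    (exists q, Delta <= `|t0.1 0 (s q) - t0.1 0 q|) \/
    (exists q l, Delta <= `|t0.2 (s q) (s l) - t0.2 q l|)) ->
  close_param delta t s -> close_param delta t s' -> s = s'.
Proof.
move=> dD sep /andP[/forallP a1 /forallP p1] /andP[/forallP a2 /forallP p2].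
apply: contrapT => /eqP ss'.
pose u := (s * s'^-1)%g.
have uE q : s' (u q) = s q by rewrite permM permKV.
have un : u != 1%g.
  apply: contra ss' => /eqP u1; apply/eqP/permP => q.
  by rewrite -uE u1 perm1.
have [[q hq]|[q [l hl]]] := sep _ un.
  have := a1 q; have := a2 (u q); rewrite uE => h2 h1.
  have := ler_distD (t.1 0 (s q)) (t0.1 0 (u q)) (t0.1 0 q).
  rewrite (distrC (t0.1 0 (u q)) (t.1 _ _)) => h3.
  have : (0 : R) < 0 by lra.
  by rewrite ltxx.
have /forallP/(_ l) h1 := p1 q; have /forallP/(_ (u l)) := p2 (u q); rewrite !uE => h2.
have := ler_distD (t.2 (s q) (s l)) (t0.2 (u q) (u l)) (t0.2 q l).
rewrite (distrC (t0.2 (u q) (u l)) (t.2 _ _)) => h3.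
have : (0 : R) < 0 by lra.
by rewrite ltxx.
Qed.

Lemma param_interior_radius (Theta : set (param R Q)) : param_interior Theta t0 ->
  exists2 e, 0 < e & forall u : param R Q, prob_vector u.1 ->
    (forall q, `|t0.1 0 q - u.1 0 q| < e) ->
    (forall q l, `|t0.2 q l - u.2 q l| < e) -> Theta u.
Proof.
move=> [_ /nbhs_ballP[e /= e0 he]]; exists e => // u up u1 u2.
apply: he => //; split; split=> // i j.
by rewrite ord1; exact: u1.
Qed.

End closeness.

Section rates.
Context {R : realType} (rho : nat -> R).
Hypothesis rho_large : n%:R * rho n / ln n%:R @[n --> \oo] --> +oo.

Lemma eventually_ge (K : R) : \forall n \near \oo, K <= n%:R.
Proof.
near=> n.
apply: (@le_trans _ _ (Num.truncn `|K|).+1%:R).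
  by apply: (le_trans (ler_norm _)); apply: ltW; have /andP[] := truncn_itv (normr_ge0 K).
by rewrite ler_nat; near: n; exact: nbhs_infty_ge.
Unshelve. all: by end_near. Qed.

Lemma rate_ln (K : R) : \forall n \near \oo, K * ln n%:R <= n%:R * rho n.
Proof.
near=> n.
have n2 : (2 <= n)%N by near: n; exact: nbhs_infty_ge.
have ln0 : 0 < ln n%:R :> R by rewrite ln_gt0// ltr1n.
rewrite -ler_pdivlMr//; near: n.
by move/cvgryPge : rho_large; exact.
Unshelve. all: by end_near. Qed.

Lemma rate_unbounded (K : R) : \forall n \near \oo, K <= n%:R * rho n.
Proof.
near=> n.
have n2 : (2 <= n)%N by near: n; exact: nbhs_infty_ge.
have nR : 2 <= n%:R :> R by rewrite (ler_nat R 2).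
have h : 2^-1 <= ln n%:R :> R.
  have e0 : 0 < n%:R :> R by lra.
  have iv : n%:R^-1 <= 2^-1 :> R by rewrite lef_pV2 ?posrE.
  have : ln (1 + (n%:R^-1 - 1)) <= n%:R^-1 - 1 :> R.
    by apply: le_ln1Dx; rewrite ltrBrDr addrC subrr invr_gt0.
  by rewrite addrC subrK lnV ?posrE//; lra.
apply: (@le_trans _ _ (2 * `|K| * ln n%:R)).
  have : 2 * `|K| * 2^-1 <= 2 * `|K| * ln n%:R by rewrite ler_wpM2l// mulr_ge0.
  by have := ler_norm K; lra.
by near: n; exact: rate_ln.
Unshelve. all: by end_near. Qed.

Lemma rate_expR (a : R) (k : nat) : 0 < a ->
  \forall n \near \oo, expR (- (a * (n%:R * rho n))) <= (n%:R ^+ k)^-1.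
Proof.
move=> a0; near=> n.
have n2 : (2 <= n)%N by near: n; exact: nbhs_infty_ge.
have nR : 0 < n%:R :> R by rewrite ltr0n (leq_trans _ n2).
rewrite expRN lef_pV2 ?posrE ?expR_gt0 ?exprn_gt0//.
rewrite -[X in X ^+ k](lnK (x := n%:R)) ?posrE// -expRM_natl ler_expR.
have : k%:R / a * ln n%:R <= n%:R * rho n by near: n; exact: rate_ln.
rewrite -(ler_pM2l a0).
by have -> : a * (k%:R / a * ln n%:R) = k%:R * ln n%:R by field; rewrite gt_eqF.
Unshelve. all: by end_near. Qed.

End rates.

(** * Location of the estimator on the good event *)

Section good_data.
Context {R : realType} {Q n : nat} {mu : {measure set R -> \bar R}} {A : set R} {b psi : R -> R}
  {lo hi tau m L : R} {Theta : set (param R Q)} {t0 : param R Q}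
  {c0 r0 delta0 Delta Delta' : R}.
Hypotheses (Q_gt0 : (0 < Q)%N) (n_gt0 : (0 < n)%N)
  (ef : expfam mu A b psi) (tm : tame psi lo hi tau m L)
  (subA : forall x, lo - tau <= x <= hi + tau -> A° x)
  (Theta_prob : forall u, Theta u -> prob_vector u.1)
  (Theta_box : Theta `<=` param_box c0 lo hi) (c0_gt0 : 0 < c0)
  (Theta_t0 : Theta t0)
  (Theta_r0 : forall u : param R Q, prob_vector u.1 ->
    (forall q, `|t0.1 0 q - u.1 0 q| < r0) ->
    (forall q l, `|t0.2 q l - u.2 q l| < r0) -> Theta u)
  (Delta_gt0 : 0 < Delta)
  (rows : forall q q', q != q' -> exists l, Delta <= `|t0.2 q l - t0.2 q' l|)
  (delta0_gt0 : 0 < delta0) (delta0_lt : delta0 *+ 2 < Delta')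
  (symm : forall s : 'S_Q, s != 1%g ->
    (exists q, Delta' <= `|t0.1 0 (s q) - t0.1 0 q|) \/
    (exists q l, Delta' <= `|t0.2 (s q) (s l) - t0.2 q l|)).

Context {ea d1 d2 d3 beta eta K Bd w u F Nmin vmin : R} {I : finType} {g : I -> 'M[R]_Q}.
Hypotheses (ea_c0 : ea <= c0 / 2) (ea_r0 : ea < r0) (ea_d0 : ea <= delta0 / 2)
  (d1_ge0 : 0 <= d1) (d1_tau : d1 <= tau) (d1_r0 : d1 < r0) (d1_d0 : d1 <= delta0 / 2)
  (d2_gt0 : 0 < d2) (d2_Delta : d2 < Delta)
  (d3_ge0 : 0 <= d3) (d3_d2 : d3 <= d2 / 2)
  (Qbeta : Q%:R * beta <= c0 / 2) (QQbeta : Q%:R ^+ 2 * beta <= c0 / 2 / 2)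
  (nbeta : 2 <= beta * n%:R) (eta_def : eta = gap m (d2 / 2) * beta ^+ 2 / 2)
  (gin : forall a, entries_in lo hi (g a))
  (gd3 : forall pi, entries_in lo hi pi -> exists a, forall q l, `|pi q l - g a q l| <= d3)
  (K_c0 : c0^-1 <= expR K) (K_Bd : 4 * d2 * L * Bd <= K)
  (Nmin_ge0 : 0 <= Nmin)
  (uF : (Q%:R / c0) ^+ n * expR (- F) <= u)
  (vmin_alpha : vmin <= n%:R / 4 * (delta0 / 2) ^+ 2)
  (vmin_pi : vmin <= Nmin * (m / 2 * (delta0 / 2) ^+ 2))
  (u_vmin : #|{perm 'I_Q}|%:R * expR (- vmin) <= u / 2)
  (w_u : w ^+ 2 <= u) (u_le : u <= 6^-1).

Context {dflt rho : R} {x : {ffun 'I_n -> 'I_Q}} {y : 'I_n -> 'I_n -> R}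
  {r : 'I_n -> 'I_n -> bool} {t : param R Q}.
(** Maximizer of the complete likelihood at the true memberships [x]. *)
Let th : param R Q := (alpha_hat x, pi_hat A psi dflt y r x).
Hypotheses
  (F_eta : d3 * L * (n%:R * Bd) + F <= eta * rho * n%:R ^+ 2)
  (good_alpha : forall q, `|alpha_hat x 0 q - t0.1 0 q| <= ea)
  (good_rows : forall i, \sum_(j | i != j) load y r i j <= Bd)
  (good_cols : forall j, \sum_(i | i != j) load y r i j <= Bd)
  (good_far : forall a (z : {ffun 'I_n -> 'I_Q}),
     eta * n%:R ^+ 2 <= separation psi t0.2 x (g a) z ->
     loglik psi y r z (g a) <= loglik psi y r x t0.2 - eta * rho * n%:R ^+ 2)
  (good_local : \sum_(z : {ffun 'I_n -> 'I_Q} |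
       (z != x) && ((mismatch z x)%:R <= c0 / 2 / 2 * n%:R))
     expR ((loglik psi y r z t0.2 - loglik psi y r x t0.2) / 2 + K * (mismatch z x)%:R) <= w)
  (good_blocks : forall q l, [/\ Nmin <= dyad_count r x q l, 0 < dyad_count r x q l :> R &
     derive1 psi (t0.2 q l - d1) < y_hat y r x q l < derive1 psi (t0.2 q l + d1)])
  (good_b : forall i j, i != j -> b (y i j) != 0)
  (mle : is_mle b psi Theta (observe y r) t).

Let in_box v : Theta v -> (forall q, c0 <= v.1 0 q <= 1) /\ entries_in lo hi v.2.
Proof.
move=> /Theta_box[h1 h2]; split=> // q; have /andP[-> h] := h1 q.
by rewrite /=; have := c0_gt0; lra.
Qed.

Let th_near q l : t0.2 q l - d1 <= th.2 q l <= t0.2 q l + d1 /\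
  derive1 psi (th.2 q l) = y_hat y r x q l.
Proof.
have [_ N0 br] := good_blocks q l.
have [_ /(_ q l)/andP[h1 h2]] := in_box Theta_t0.
apply: (pi_hat_bracket ef dflt _ _ _ br); first by have := d1_ge0; lra.
- by move=> v /andP[v1 v2]; apply: subA; have := d1_tau; lra.
- by rewrite gt_eqF.
Qed.

Let Theta_th : Theta th.
Proof.
apply: Theta_r0; first exact: alpha_hat_prob.
- by move=> q; rewrite distrC (le_lt_trans (good_alpha q)).
- move=> q l; have [/andP[h1 h2] _] := th_near q l.
  by rewrite (le_lt_trans _ d1_r0)// ler_norml; lra.
Qed.

Let sizes q : c0 / 2 * n%:R <= #|[set i | x i == q]%SET|%:R.
Proof.
rewrite alpha_hatE//; have [/(_ q)/andP[h _] _] := in_box Theta_t0.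
rewrite mulrC ler_wpM2l//; have := good_alpha q.
by rewrite ler_norml; have := ea_c0; lra.
Qed.

Let wide (pi : 'M[R]_Q) : entries_in lo hi pi -> forall q l, lo - tau <= pi q l <= hi + tau.
Proof. by move=> h q l; have := tame_tau tm; have /andP[] := h q l; lra. Qed.

Let weight_le v q q' l : prob_vector v.1 -> entries_in lo hi v.2 ->
  weight psi y r v x <= weight psi y r th x *
    expR (- (n%:R / 4 * (v.1 0 q - th.1 0 q) ^+ 2 +
             dyad_count r x q' l * (m / 2 * (v.2 q' l - th.2 q' l) ^+ 2))).
Proof.
move=> vp vin; apply: weight_le_max n_gt0 tm vp (wide vin) (wide (in_box Theta_th).2) _ _ erefl.
- by move=> q1 l1; have [] := good_blocks q1 l1.
- by move=> q1 l1; have [] := th_near q1 l1.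
Qed.

Let alpha_penalty_ge0 (a : R) : 0 <= n%:R / 4 * a ^+ 2.
Proof. by apply: mulr_ge0; rewrite ?sqr_ge0 ?divr_ge0. Qed.

Let pi_rate_ge0 (a : R) : 0 <= m / 2 * a ^+ 2.
Proof. by apply: mulr_ge0; rewrite ?sqr_ge0 ?divr_ge0 ?(ltW (tame_m tm)). Qed.

Let pi_penalty_ge0 q l (a : R) : 0 <= dyad_count r x q l * (m / 2 * a ^+ 2).
Proof. by have [_ N0 _] := good_blocks q l; rewrite mulr_ge0 ?(ltW N0). Qed.

Let penalty_ge0 (v : param R Q) q q' l : 0 <= n%:R / 4 * (v.1 0 q - th.1 0 q) ^+ 2 +
   dyad_count r x q' l * (m / 2 * (v.2 q' l - th.2 q' l) ^+ 2).
Proof. exact: addr_ge0. Qed.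

(** The bound on far assignments holds on a grid of matrices; it is transferred to the
    estimator by the bound on the loads. *)
Let dichotomy (z : {ffun 'I_n -> 'I_Q}) : entries_in lo hi t.2 ->
  (exists2 s : 'S_Q, near_pi t0.2 d2 s t &
     (mismatch z (fun i => s (x i)))%:R <= c0 / 2 / 2 * n%:R) \/
  loglik psi y r z t.2 <= loglik psi y r x t0.2 - F.
Proof.
move=> tin; have [a ha] := gd3 tin.
have [far|near] := leP (eta * n%:R ^+ 2) (separation psi t0.2 x (g a) z).
  right; have h1 := good_far far.
  have h2 := loglik_perturb tm y r z tin (gin a) ha.
  have h3 : \sum_i \sum_(j | i != j) load y r i j <= n%:R * Bd.
    rewrite -[n in n%:R](card_ord n) mulr_natl -sumr_const.
    by apply: ler_sum => i _; exact: good_rows.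
  have L1 := tame_L tm.
  have dL : 0 <= d3 * L by rewrite mulr_ge0//; lra.
  have := ler_wpM2l dL h3; have := F_eta; lra.
left; rewrite eta_def in near.
have d2h : 0 < d2 / 2 by rewrite divr_gt0.
have d2D : (d2 / 2) *+ 2 < Delta by rewrite -mulr_natr divfK.
have [s [s1 s2]] := identifiability tm n_gt0 Q_gt0 (in_box Theta_t0).2 (gin a) d2h d2D
  rows sizes Qbeta QQbeta nbeta near.
exists s => //; apply/forallP => q; apply/forallP => l.
have := ler_distD (g a (s q) (s l)) (t.2 (s q) (s l)) (t0.2 q l).
by have := ha (s q) (s l); have := s1 q l; have := d3_d2; lra.
Qed.

(** Deterministic core: [x] plays the role of the true memberships, [t] that of the
    maximum likelihood estimator, and the probabilistic content is in the hypotheses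
    on the data. *)
Lemma good_data_mle : exists2 s : 'S_Q, close_param t0 delta0 t s &
  (forall q, n%:R / 4 * (t.1 0 (s q) - alpha_hat x 0 q) ^+ 2 <= 6 * u) /\
  (forall q l, Nmin * (m / 2 * (t.2 (s q) (s l) - pi_hat A psi dflt y r x q l) ^+ 2) <= 6 * u).
Proof.
have m0 := tame_m tm.
have [Tt mt] := mle_weight (expfam_ge0 ef) good_b mle.
have [tbox tin] := in_box Tt.
have [t0box t0in] := in_box Theta_t0.
have [thbox _] := in_box Theta_th.
have q0 : 'I_Q := Ordinal Q_gt0.
have wth : 0 < weight psi y r th x.
  by apply: weight_gt0 => q; have /andP[h _] := thbox q; exact: lt_le_trans h.
have wth_ge0 z : 0 <= weight psi y r th z.
  by apply/ltW/weight_gt0 => q; have /andP[h _] := thbox q; exact: lt_le_trans h.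
have relabel_prob (s : 'S_Q) : prob_vector (relabel s t).1.
  have [p0 p1] := Theta_prob Tt; split=> [q|]; first by rewrite mxE.
  rewrite -p1 [RHS](reindex_inj (@perm_inj _ s))/=; apply: eq_bigr => q _.
  by rewrite mxE.
have relabel_in (s : 'S_Q) : entries_in lo hi (relabel s t).2.
  by move=> q l; rewrite mxE.
pose f (s : 'S_Q) := weight psi y r (relabel s t) x / weight psi y r th x.
have f0 s : 0 <= f s.
  rewrite divr_ge0 ?(ltW wth)//; apply/ltW/weight_gt0 => q; rewrite mxE.
  by have /andP[h _] := tbox (s q); exact: lt_le_trans h.
have fV s q q' l : f s <= expR (- (n%:R / 4 * ((relabel s t).1 0 q - th.1 0 q) ^+ 2 +
             dyad_count r x q' l * (m / 2 * ((relabel s t).2 q' l - th.2 q' l) ^+ 2))).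
  by rewrite ler_pdivrMr// mulrC; exact: weight_le.
have w0 : weight psi y r t0 x <= weight psi y r th x.
  apply: le_trans (weight_le q0 q0 q0 (Theta_prob Theta_t0) t0in) _.
  by rewrite ler_piMr// -[leRHS]expR0 ler_expR oppr_le0.
have cn0 : 0 <= c0 / 2 / 2 * n%:R by rewrite !mulr_ge0 ?invr_ge0// ltW.
have main : 1 <= (1 + w ^+ 2) * (\sum_s f s) + u.
  have t0c q : c0 <= t0.1 0 q by have /andP[] := t0box q.
  have := likelihood_upper tm (erefl t0.2) t0in tin tbox t0c c0_gt0 K_c0 (ltW d2_gt0)
    good_rows good_cols K_Bd cn0 good_local (fun z => dichotomy z tin) uF w0.
  move=> upper; rewrite -(ler_pM2r wth) mul1r mulrDl -mulrA mulr_suml.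
  rewrite (eq_bigr (fun s => weight psi y r (relabel s t) x)); last first.
    by move=> s _; rewrite /f divfK// gt_eqF.
  apply: le_trans upper; apply: le_trans (mt _ Theta_th).
  by rewrite (bigD1 x)//= lerDl sumr_ge0.
have far s : ~~ close_param t0 delta0 t s -> f s <= expR (- vmin).
  have sq_le (a e e' : R) : delta0 < `|a - e| -> `|e - e'| <= delta0 / 2 ->
      (delta0 / 2) ^+ 2 <= (a - e') ^+ 2.
    move=> h1 h2; rewrite -[leRHS]real_normK ?num_real// lerXn2r ?nnegrE//.
      by have := delta0_gt0; lra.
    by have := ler_distD e' a e; rewrite (distrC e' e); lra.
  rewrite /close_param negb_and => /orP[/forallPn[q]|/forallPn[q /forallPn[l]]];
    rewrite -ltNge => hq.
  - apply: le_trans (fV s q q0 q0) _; rewrite ler_expR lerN2 (le_trans vmin_alpha)//.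
    apply: ler_wpDr; first exact: pi_penalty_ge0.
    rewrite ler_wpM2l// ?divr_ge0// mxE; apply: sq_le hq _.
    by rewrite distrC (le_trans (good_alpha q)).
  - apply: le_trans (fV s q0 q l) _; rewrite ler_expR lerN2 (le_trans vmin_pi)//.
    apply: ler_wpDl; first exact: alpha_penalty_ge0.
    have [hN N0 _] := good_blocks q l.
    apply: ler_pM => //.
    rewrite ler_wpM2l ?divr_ge0 ?(ltW m0)// mxE; apply: sq_le hq _.
    by have [/andP[h1 h2] _] := th_near q l; rewrite ler_norml; have := d1_d0; lra.
have [s cs hs] := dominant_term f0 main far
  (fun s s' => @close_param_unique R Q t0 delta0 Delta' t s s' delta0_lt symm)
  (introT andP (conj (sqr_ge0 w) w_u)) (expR_ge0 _) u_vmin (lexx u) u_le.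
exists s => //; split=> [q|q l].
  have := hs _ (penalty_ge0 (relabel s t) q q0 q0) (fV s q q0 q0).
  by rewrite mxE; apply: le_trans; rewrite lerDl; exact: pi_penalty_ge0.
have := hs _ (penalty_ge0 (relabel s t) q0 q l) (fV s q0 q l).
have -> : (relabel s t).2 q l = t.2 (s q) (s l) by rewrite mxE.
apply: le_trans; apply: ler_wpDl.
  exact: alpha_penalty_ge0.
have [hN N0 _] := good_blocks q l.
by rewrite ler_wpM2r.
Qed.

End good_data.

(** * Rates of the error bounds *)

Section error_rates.
Context {R : realType} (rho : nat -> R).
Hypothesis (rho_large : n%:R * rho n / ln n%:R @[n --> \oo] --> +oo).

Lemma expRN_le_inv (a : R) : 0 < a -> expR (- a) <= a^-1.
Proof.
move=> a0; rewrite expRN lef_pV2 ?posrE ?expR_gt0//.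
by have := expR_ge1Dx a; lra.
Qed.

Lemma exprn_le_expR (a : R) n : 0 <= a -> a ^+ n <= expR (n%:R * a).
Proof.
move=> a0; rewrite expRM_natl lerXn2r ?nnegrE ?expR_ge0//.
by have := expR_ge1Dx a; lra.
Qed.

Lemma loads_rate (M tau C : R) : tau * C = M + 1 ->
  \forall n \near \oo, 2 * n%:R * expR (rho n * (n%:R * M) - tau * (C * (n%:R * rho n))) <= 2 / n%:R.
Proof.
move=> tC; near=> n.
have n0 : (0 < n)%N by near: n; exact: nbhs_infty_ge.
have nR : 0 < n%:R :> R by rewrite ltr0n.
have h : expR (- (1 * (n%:R * rho n))) <= (n%:R ^+ 2)^-1 by near: n; exact: rate_expR.
rewrite (mulrA tau C) tC (_ : rho n * _ - _ = - (1 * (n%:R * rho n))); last by ring.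
apply: le_trans (ler_wpM2l _ h) _; first by rewrite mulr_ge0.
by rewrite le_eqVlt; apply/orP; left; apply/eqP; field; rewrite gt_eqF.
Unshelve. all: by end_near. Qed.

Lemma far_rate (k Q : nat) (eta : R) : 0 < eta ->
  \forall n \near \oo, k%:R * Q%:R ^+ n * expR (- (eta * rho n * n%:R ^+ 2 / 2)) <= k%:R / n%:R.
Proof.
move=> eta0; near=> n.
have n0 : (0 < n)%N by near: n; exact: nbhs_infty_ge.
have nR : 0 < n%:R :> R by rewrite ltr0n.
have h : 2 * (Q%:R + 1) / eta <= n%:R * rho n by near: n; exact: rate_unbounded.
rewrite -mulrA ler_wpM2l//; apply: le_trans (expRN_le_inv nR).
apply: (@le_trans _ _ (expR (n%:R * Q%:R) * expR (- (eta * rho n * n%:R ^+ 2 / 2)))).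
  by rewrite ler_wpM2r ?expR_ge0//; exact: exprn_le_expR.
rewrite -expRD ler_expR.
move: h; rewrite ler_pdivrMr// => /(ler_wpM2l (ltW nR)); lra.
Unshelve. all: by end_near. Qed.

(** [(1 + v)^n - 1] is of order [n * v], and [v] is below [n^-3]. *)
Lemma local_rate_bound (Q : nat) (a : R) : 0 < a ->
  \forall n \near \oo, n%:R * ((1 + Q%:R * expR (- (a * (n%:R * rho n)))) ^+ n - 1) <=
    3 * Q%:R / n%:R.
Proof.
move=> a0; near=> n.
have n0 : (0 < n)%N by near: n; exact: nbhs_infty_ge.
have nR : 0 < n%:R :> R by rewrite ltr0n.
have h : expR (- (a * (n%:R * rho n))) <= (n%:R ^+ 3)^-1 by near: n; exact: rate_expR.
have Qn : 2 * Q%:R + 1 <= n%:R :> R by near: n; exact: eventually_ge.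
set v := Q%:R / n%:R ^+ 2 : R.
have v0 : 0 <= v by rewrite divr_ge0// exprn_ge0.
have v2 : v <= 2^-1.
  rewrite ler_pdivrMr ?exprn_gt0//.
  have : n%:R * 1 <= n%:R * n%:R :> R.
    by rewrite ler_wpM2l// -[1]/(1%:R) ler_nat.
  by rewrite expr2; lra.
have e1 : (1 + Q%:R * expR (- (a * (n%:R * rho n)))) ^+ n <= expR v.
  apply: (@le_trans _ _ (expR (v / n%:R) ^+ n)).
    have b0 : 0 <= 1 + Q%:R * expR (- (a * (n%:R * rho n))).
      by rewrite addr_ge0// mulr_ge0 ?expR_ge0.
    apply: lerXn2r; rewrite ?nnegrE ?expR_ge0//.
    apply: le_trans (expR_ge1Dx _); rewrite lerD2l.
    apply: le_trans (ler_wpM2l _ h) _ => //.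
    by rewrite le_eqVlt; apply/orP; left; apply/eqP; rewrite /v; field; rewrite gt_eqF.
  by rewrite -expRM_natl mulrC divfK// gt_eqF.
have e2 := expR_le_quadratic (u := v); rewrite ger0_norm// in e2.
have {}e2 := e2 v2.
have v3 : v * v <= v * 2^-1 by rewrite ler_wpM2l.
have e3 : (1 + Q%:R * expR (- (a * (n%:R * rho n)))) ^+ n - 1 <= 2 * v.
  by rewrite expr2 in e2; lra.
apply: le_trans (ler_wpM2l (ltW nR) e3) _.
have -> : n%:R * (2 * v) = 2 * Q%:R / n%:R by rewrite /v; field; rewrite gt_eqF.
by rewrite ler_wpM2r ?invr_ge0//; have := ler0n R Q; lra.
Unshelve. all: by end_near. Qed.

Lemma blocks_rate (k a : R) : 0 <= k -> 0 < a ->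
  \forall n \near \oo, k * expR (- (rho n * (n%:R ^+ 2 * a))) <= k / n%:R.
Proof.
move=> k0 a0; near=> n.
have n0 : (0 < n)%N by near: n; exact: nbhs_infty_ge.
have nR : 0 < n%:R :> R by rewrite ltr0n.
have h : 1 / a <= n%:R * rho n by near: n; exact: rate_unbounded.
rewrite ler_wpM2l//; apply: le_trans (expRN_le_inv nR).
rewrite ler_expR lerN2; move: h; rewrite ler_pdivrMr// => /(ler_wpM2l (ltW nR)); lra.
Unshelve. all: by end_near. Qed.

Lemma alpha_rate (k e : R) n : (0 < n)%N -> 0 <= k -> 0 < e ->
  k * expR (- (n%:R * e ^+ 2 / 8)) <= k * (8 / e ^+ 2) / n%:R.
Proof.
move=> n0 k0 e0; have nR : 0 < n%:R :> R by rewrite ltr0n.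
rewrite -[leRHS]mulrA ler_wpM2l//.
have h : 0 < n%:R * e ^+ 2 / 8 by rewrite divr_gt0// mulr_gt0// exprn_gt0.
apply: le_trans (expRN_le_inv h) _.
by rewrite le_eqVlt; apply/orP; left; apply/eqP; field; rewrite !gt_eqF.
Qed.

Lemma entropy_rate (a eta : R) : 0 <= a -> 0 < eta ->
  \forall n \near \oo, a ^+ n * expR (- (eta / 2 * rho n * n%:R ^+ 2)) <= (n%:R ^+ 2)^-1.
Proof.
move=> a0 eta0; near=> n.
have n0 : (0 < n)%N by near: n; exact: nbhs_infty_ge.
have nR : 0 < n%:R :> R by rewrite ltr0n.
have h : 2 * (a + 2) / eta <= n%:R * rho n by near: n; exact: rate_unbounded.
apply: (@le_trans _ _ (expR (- n%:R) ^+ 2)); last first.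
  by rewrite -exprVn lerXn2r ?nnegrE ?expR_ge0 ?invr_ge0//; exact: expRN_le_inv.
apply: (@le_trans _ _ (expR (n%:R * a) * expR (- (eta / 2 * rho n * n%:R ^+ 2)))).
  by rewrite ler_wpM2r ?expR_ge0//; exact: exprn_le_expR.
rewrite -expRD -expRM_natl ler_expR.
move: h; rewrite ler_pdivrMr// => /(ler_wpM2l (ltW nR)); lra.
Unshelve. all: by end_near. Qed.

Lemma asymmetry_rate (k a : R) : 0 <= k -> 0 < a ->
  \forall n \near \oo, k * expR (- (a * n%:R)) <= (n%:R ^+ 2)^-1 / 2.
Proof.
move=> k0 a0; near=> n.
have n0 : (0 < n)%N by near: n; exact: nbhs_infty_ge.
have nR : 0 < n%:R :> R by rewrite ltr0n.
have h : 2 * k * (3 / a) ^+ 3 <= n%:R by near: n; exact: eventually_ge.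
have an0 : 0 < a * n%:R / 3 by rewrite divr_gt0// mulr_gt0.
have e : expR (- (a * n%:R)) <= (3 / a) ^+ 3 / n%:R ^+ 3.
  rewrite (_ : - (a * n%:R) = 3%:R * - (a * n%:R / 3)); last by field.
  rewrite expRM_natl -expr_div_n lerXn2r ?nnegrE ?expR_ge0//.
    by rewrite !divr_ge0// ltW.
  apply: le_trans (expRN_le_inv an0) _.
  by rewrite le_eqVlt; apply/orP; left; apply/eqP; field; rewrite !gt_eqF.
apply: le_trans (ler_wpM2l k0 e) _.
have -> : (n%:R ^+ 2)^-1 / 2 = n%:R / 2 / n%:R ^+ 3 :> R by field; rewrite gt_eqF.
by rewrite mulrA ler_wpM2r ?invr_ge0 ?exprn_ge0//; lra.
Unshelve. all: by end_near. Qed.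

End error_rates.

(** * Convergence of the estimator *)

(** Conclusion of [good_data_mle] with tolerance [u = n^-2] and at least [n] observed
    dyads in every block. *)
Definition accurate {R : realType} {Q n : nat} (m : R) (t0 th t : param R Q) (delta0 : R) (s : 'S_Q) : Prop :=
  close_param t0 delta0 t s /\
  ((forall q, n%:R / 4 * (t.1 0 (s q) - th.1 0 q) ^+ 2 <= 6 * (n%:R ^+ 2)^-1) /\
   (forall q l, n%:R * (m / 2 * (t.2 (s q) (s l) - th.2 q l) ^+ 2) <= 6 * (n%:R ^+ 2)^-1)).

(** The constants are chosen from the separation properties of the true parameter; the six
    exceptional events each have probability [O(1/n)]. *)
Lemma mle_error_probability (R : realType) (Q : nat) (Q_gt0 : (0 < Q)%N)
    (mu : {measure set R -> \bar R}) (A : set R) (b psi : R -> R)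
    (ef : expfam mu A b psi)
    (Theta : set (param R Q))
    (Theta_prob : forall t, Theta t -> prob_vector t.1)
    (thetas : param R Q)
    (A1 : compact_param_space A Theta)
    (A2 : param_interior Theta thetas)
    (A4 : distinct_mean_degrees psi thetas)
    (rho : nat -> R)
    (rho01 : forall n, 0 <= rho n <= 1)
    (rho_large : n%:R * rho n / ln n%:R @[n --> \oo] --> +oo)
    (d : nat -> measure_display) (T : forall n, measurableType (d n))
    (P : forall n, probability (T n) R)
    (zs : forall n, T n -> 'I_n -> 'I_Q)
    (y : forall n, T n -> 'I_n -> 'I_n -> R)
    (r : forall n, T n -> 'I_n -> 'I_n -> bool)
    (sample : forall n,
      sbm_dyad_sample (P n) mu b psi thetas (rho n) (zs n) (y n) (r n))
    (t : forall n, T n -> param R Q)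
    (mle : forall n (w : T n), is_mle b psi Theta (observe (y n w) (r n w)) (t n w))
    (dflt : R) :
  exists delta0 m C : R, [/\ 0 < m,
    (forall t s s', close_param thetas delta0 t s -> close_param thetas delta0 t s' -> s = s') &
    \forall n \near \oo, (mu_ext (P n) [set w | ~ exists s : 'S_Q,
       @accurate R Q n m thetas (alpha_hat (zs n w), pi_hat A psi dflt (y n w) (r n w) (zs n w))
         (t n w) delta0 s] <= (C / n%:R)%:E)%E].
Proof.
have [c0 [lo [hi [c0_gt0 itvA Theta_box]]]] := A1.
have Theta_t0 : Theta thetas by case: A2.
have [t0a t0in] := Theta_box _ Theta_t0.
pose q0 : 'I_Q := Ordinal Q_gt0.
have lohi : lo <= hi by have /andP[] := t0in q0 q0; exact: le_trans.
have [tau [m [L [tm subA]]]] := tame_exists ef lohi itvA.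
have subA' v : lo - tau <= v <= hi + tau -> A v.
  by move=> /subA; exact: interior_subset.
have tau0 := tame_tau tm; have m0 := tame_m tm; have L1 := tame_L tm.
have [Delta D0 rows] := rows_separated A4.
have [Delta' D'0 symm] := symmetries_separated A4.
have [r0 r00 Theta_r0] := param_interior_radius A2.
have t0_prob := Theta_prob _ Theta_t0.
have QR : 1 <= Q%:R :> R by rewrite ler1n.
pose delta0 := Delta' / 3.
have delta0_gt0 : 0 < delta0 by rewrite divr_gt0.
have delta0_lt : delta0 *+ 2 < Delta' by rewrite /delta0 -mulr_natl; lra.
(* [ea] and [d1] keep the maximizer inside the parameter space and within half of
   [delta0] of the truth. *)
have [ea ea0 [ea1 ea_c0 ea_r0 ea_d0]] : exists2 ea : R, 0 < ea &
    [/\ ea <= 1, ea <= c0 / 2, ea < r0 & ea <= delta0 / 2].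
  exists (Num.min (Num.min 1 (c0 / 2)) (Num.min (r0 / 2) (delta0 / 2))).
    by rewrite !lt_min ltr01 !divr_gt0.
  by split; rewrite ?ge_min ?gt_min ?lexx ?orbT//; lra.
have [d1 d10 [d1_tau d1_r0 d1_d0]] : exists2 e : R, 0 < e &
    [/\ e <= tau, e < r0 & e <= delta0 / 2].
  exists (Num.min tau (Num.min (r0 / 2) (delta0 / 2))).
    by rewrite !lt_min tau0 !divr_gt0.
  by split; rewrite ?ge_min ?gt_min ?lexx ?orbT//; lra.
pose M := @load_moment R tau L.
have M0 : 0 <= M by rewrite mulr_ge0 ?expR_ge0.
pose C := (M + 1) / tau.
have C0 : 0 < C by rewrite divr_gt0//; lra.
pose c := c0 / 2.
have c_gt0 : 0 < c by rewrite divr_gt0.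
pose kappa := c / 2 * gap m Delta / 2.
have kappa0 : 0 < kappa by rewrite divr_gt0// mulr_gt0 ?divr_gt0// (gap_gt0 tm).
have LC0 : 0 < L * C by rewrite mulr_gt0//; lra.
(* The cost of moving [pi] by [d2] stays below the exponent of the local bound. *)
have [d2 d20 [d2_k d2_D]] : exists2 e : R, 0 < e & e * (4 * (L * C)) <= kappa /\ e < Delta.
  have h : 0 < 4 * (L * C) by rewrite mulr_gt0.
  exists (Num.min (kappa / (4 * (L * C))) (Delta / 2)).
    by rewrite lt_min (divr_gt0 kappa0 h) divr_gt0.
  split; last by rewrite gt_min; apply/orP; right; lra.
  by rewrite -ler_pdivlMr// ge_min lexx.
have [beta beta0 [Qb QQb]] : exists2 e : R, 0 < e & Q%:R * e <= c /\ Q%:R ^+ 2 * e <= c / 2.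
  have Q20 : 0 < Q%:R ^+ 2 :> R by rewrite exprn_gt0//; lra.
  exists (Num.min (c / Q%:R) (c / 2 / Q%:R ^+ 2)).
    by rewrite lt_min (divr_gt0 _ Q20) ?divr_gt0//; lra.
  split; first by rewrite mulrC -ler_pdivlMr ?ge_min ?lexx//; lra.
  by rewrite mulrC -ler_pdivlMr ?ge_min ?lexx ?orbT//; lra.
pose eta := gap m (d2 / 2) * beta ^+ 2 / 2.
have eta0 : 0 < eta by rewrite divr_gt0// mulr_gt0 ?exprn_gt0// (gap_gt0 tm)// divr_gt0.
(* The grid is so fine that it costs at most half of the global gain. *)
have [d3 d30 [d3_d2 d3_eta]] : exists2 e : R, 0 < e & e <= d2 / 2 /\ e * (L * C) <= eta / 2.
  exists (Num.min (d2 / 2) (eta / 2 / (L * C))); first by rewrite lt_min (divr_gt0 (divr_gt0 eta0 _) LC0) ?divr_gt0.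
  split; first by rewrite ge_min lexx.
  by rewrite -ler_pdivlMr// ge_min lexx orbT.
have [I [g [gin gd3]]] := matrix_grid Q lohi d30.
pose c2 := Num.min (4^-1 * (delta0 / 2) ^+ 2) (m / 2 * (delta0 / 2) ^+ 2).
have c20 : 0 < c2 by rewrite lt_min !mulr_gt0 ?divr_gt0 ?exprn_gt0 ?divr_gt0.
pose br := block_rate (m := m) d1.
have br0 : 0 < br.
  rewrite /br /block_rate lt_min invr_gt0 ltr0n andbT divr_gt0// subr_gt0 -[ltRHS]expR0.
  by rewrite ltr_expR oppr_lt0 mulr_gt0 ?divr_gt0 ?exprn_gt0.
exists delta0, m, (2 * Q%:R * (8 / ea ^+ 2) + 2 + #|I|%:R + 3 * Q%:R + Q%:R ^+ 2 * 3).
split=> // [u s s'|]; first exact: close_param_unique delta0_lt symm.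
near=> n.
have n0 : (0 < n)%N by near: n; exact: nbhs_infty_ge.
have nR : 0 < n%:R :> R by rewrite ltr0n.
have n3 : 3 <= n%:R :> R by near: n; exact: eventually_ge.
have rho0 : 0 <= rho n by case/andP: (rho01 n).
pose zf w : {ffun 'I_n -> 'I_Q} := [ffun i => zs n w i].
pose Bd := C * (n%:R * rho n).
pose K := local_rate (n := n) (rho := rho n) (m := m) c Delta.
have KE : K = kappa * (n%:R * rho n) by rewrite /K /local_rate /kappa; field.
have K_c0 : c0^-1 <= expR K.
  have h : c0^-1 / kappa <= n%:R * rho n by near: n; exact: rate_unbounded.
  apply: (@le_trans _ _ (1 + K)); last exact: expR_ge1Dx.
  by move: h; rewrite ler_pdivrMr// KE; lra.
have nrho0 : 0 <= n%:R * rho n by rewrite mulr_ge0.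
have K_Bd : 4 * d2 * L * Bd <= K.
  by rewrite KE /Bd; have := ler_wpM2r nrho0 d2_k; clear; lra.
have nbeta : 2 <= beta * n%:R.
  have : 2 / beta <= n%:R by near: n; exact: eventually_ge.
  by rewrite ler_pdivrMr// mulrC.
have cn2 : 2 <= c * n%:R.
  have : 2 / c <= n%:R by near: n; exact: eventually_ge.
  by rewrite ler_pdivrMr// mulrC.
pose F := eta / 2 * rho n * n%:R ^+ 2.
pose u : R := (n%:R ^+ 2)^-1.
have uF : (Q%:R / c0) ^+ n * expR (- F) <= u.
  by rewrite /F /u; near: n; apply: entropy_rate => //; rewrite divr_ge0// ltW.
pose vmin := c2 * n%:R.
have vmin_alpha : vmin <= n%:R / 4 * (delta0 / 2) ^+ 2.
  have : c2 <= 4^-1 * (delta0 / 2) ^+ 2 by rewrite /c2 ge_min lexx.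
  by move/(ler_wpM2r (ltW nR)); rewrite /vmin; clear; lra.
have vmin_pi : vmin <= n%:R * (m / 2 * (delta0 / 2) ^+ 2).
  by rewrite /vmin mulrC ler_wpM2l// /c2 ge_min lexx orbT.
have u_vmin : #|{perm 'I_Q}|%:R * expR (- vmin) <= u / 2.
  by rewrite /vmin /u; near: n; exact: asymmetry_rate.
have w_u : (n%:R^-1) ^+ 2 <= u by rewrite /u exprVn.
have u_le : u <= 6^-1.
  rewrite /u lef_pV2 ?posrE ?exprn_gt0//.
  have : 3 * 3 <= n%:R * n%:R :> R by apply: ler_pM.
  by rewrite expr2; clear; lra.
have F_eta : d3 * L * (n%:R * Bd) + F <= eta * rho n * n%:R ^+ 2.
  have h : 0 <= n%:R * (n%:R * rho n) by rewrite mulr_ge0.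
  by have := ler_wpM2r h d3_eta; rewrite /F /Bd; clear; lra.
have Nmin_le : n%:R <= rho n * (c ^+ 2 * n%:R ^+ 2 / 8).
  have c2_gt0 : 0 < c ^+ 2 by rewrite exprn_gt0.
  have h : 8 / c ^+ 2 <= n%:R * rho n by near: n; exact: rate_unbounded.
  move: h; rewrite ler_pdivrMr// => /(ler_wpM2l (ltW nR)); clear; lra.
pose B1 : set (T n) := [set w | ~ (forall q, `|alpha_hat (zf w) 0 q - thetas.1 0 q| <= ea)].
pose B2 : set (T n) := [set w | ~ ((forall i, \sum_(j | i != j) load (y n w) (r n w) i j <= Bd) /\
                       (forall j, \sum_(i | i != j) load (y n w) (r n w) i j <= Bd))].
pose B3 : set (T n) := [set w | ~ (forall a (z' : {ffun 'I_n -> 'I_Q}),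
     eta * n%:R ^+ 2 <= separation psi thetas.2 (zf w) (g a) z' ->
     loglik psi (y n w) (r n w) z' (g a) <=
      loglik psi (y n w) (r n w) (zf w) thetas.2 - eta * rho n * n%:R ^+ 2)].
pose B4 : set (T n) := [set w | balanced_classes c (zf w) /\ ~
    (\sum_(z' : {ffun 'I_n -> 'I_Q} | (z' != zf w) && ((mismatch z' (zf w))%:R <= c / 2 * n%:R))
       expR ((loglik psi (y n w) (r n w) z' thetas.2 - loglik psi (y n w) (r n w) (zf w) thetas.2) / 2 +
          local_rate (n := n) (rho := rho n) (m := m) c Delta * (mismatch z' (zf w))%:R) <= n%:R^-1)].
pose B5 : set (T n) := [set w | balanced_classes c (zf w) /\ ~ (forall q l,
     [/\ rho n * (c ^+ 2 * n%:R ^+ 2 / 8) <= dyad_count (r n w) (zf w) q l,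
         0 < dyad_count (r n w) (zf w) q l :> R &
         derive1 psi (thetas.2 q l - d1) < y_hat (y n w) (r n w) (zf w) q l <
          derive1 psi (thetas.2 q l + d1)])].
pose B6 : set (T n) := [set w | exists i j, i != j /\ b (y n w i j) = 0].
have sub : [set w | ~ exists s : 'S_Q,
       @accurate R Q n m thetas (alpha_hat (zs n w), pi_hat A psi dflt (y n w) (r n w) (zs n w))
         (t n w) delta0 s] `<=` ((((B1 `|` B2) `|` B3) `|` B4) `|` B5) `|` B6.
  move=> w nacc; apply: contrapT => nB; apply: nacc.
  have g1 q : `|alpha_hat (zf w) 0 q - thetas.1 0 q| <= ea.
    by apply: contrapT => h; apply: nB; do 5!left; move/(_ q).
  have [g2r g2c] : (forall i, \sum_(j | i != j) load (y n w) (r n w) i j <= Bd) /\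
      (forall j, \sum_(i | i != j) load (y n w) (r n w) i j <= Bd).
    by apply: contrapT => h; apply: nB; do 4!left; right.
  have g3 : forall a (z' : {ffun 'I_n -> 'I_Q}),
     eta * n%:R ^+ 2 <= separation psi thetas.2 (zf w) (g a) z' ->
     loglik psi (y n w) (r n w) z' (g a) <=
      loglik psi (y n w) (r n w) (zf w) thetas.2 - eta * rho n * n%:R ^+ 2.
    by apply: contrapT => h; apply: nB; do 3!left; right.
  have bal : balanced_classes c (zf w).
    apply/forallP => q; rewrite alpha_hatE// mulrC ler_wpM2l//.
    by have := g1 q; rewrite ler_norml; have /andP[] := t0a q; rewrite /c; move: ea_c0; clear; lra.
  have g4 : \sum_(z' : {ffun 'I_n -> 'I_Q} | (z' != zf w) && ((mismatch z' (zf w))%:R <= c / 2 * n%:R))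
       expR ((loglik psi (y n w) (r n w) z' thetas.2 - loglik psi (y n w) (r n w) (zf w) thetas.2) / 2 +
          K * (mismatch z' (zf w))%:R) <= n%:R^-1.
    by apply: contrapT => h; apply: nB; do 2!left; right; split.
  have g5 q l : [/\ n%:R <= dyad_count (r n w) (zf w) q l :> R,
         0 < dyad_count (r n w) (zf w) q l :> R &
         derive1 psi (thetas.2 q l - d1) < y_hat (y n w) (r n w) (zf w) q l <
          derive1 psi (thetas.2 q l + d1)].
    have [h1 h2 h3] : [/\ rho n * (c ^+ 2 * n%:R ^+ 2 / 8) <= dyad_count (r n w) (zf w) q l,
         0 < dyad_count (r n w) (zf w) q l :> R &
         derive1 psi (thetas.2 q l - d1) < y_hat (y n w) (r n w) (zf w) q l <
          derive1 psi (thetas.2 q l + d1)].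
      by move: q l; apply: contrapT => h; apply: nB; left; right; split.
    by split=> //; exact: le_trans Nmin_le h1.
  have g6 i j : i != j -> b (y n w i j) != 0.
    by move=> ij; apply/negP => /eqP b0; apply: nB; right; exists i, j.
  have zfE : (zf w : 'I_n -> 'I_Q) = zs n w by apply/funext => i; rewrite ffunE.
  have [s cs [hs1 hs2]] := good_data_mle Q_gt0 n0 ef tm subA Theta_prob Theta_box c0_gt0
    Theta_t0 Theta_r0 rows delta0_gt0 delta0_lt symm
    ea_c0 ea_r0 ea_d0 (ltW d10) d1_tau d1_r0 d1_d0 d20 d2_D (ltW d30) d3_d2 Qb QQb nbeta
    (erefl eta) gin gd3 K_c0 K_Bd (ltW nR) uF vmin_alpha vmin_pi u_vmin w_u u_le
    F_eta g1 g2r g2c g3 g4 g5 g6 (mle n w) (dflt := dflt).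
  exists s; split=> //; rewrite -zfE; split=> // q l; exact: hs2.
have b1 : (mu_ext (P n) B1 <= (2 * Q%:R * (8 / ea ^+ 2) / n%:R)%:E)%E.
  have e01 : 0 < ea <= 1 by rewrite ea0.
  apply: (le_trans (alpha_hat_deviation n0 t0_prob (sample n) e01)).
  by rewrite lee_fin alpha_rate// mulr_ge0.
have b2 : (mu_ext (P n) B2 <= (2 / n%:R)%:E)%E.
  apply: (le_trans (bad_loads ef tm subA' t0in t0_prob (rho01 n) (sample n) Bd)).
  by rewrite lee_fin /Bd; near: n; apply: loads_rate => //; rewrite mulrC divfK// gt_eqF.
have b3 : (mu_ext (P n) B3 <= (#|I|%:R / n%:R)%:E)%E.
  apply: (le_trans (bad_far ef tm subA' t0in t0_prob (rho01 n) (sample n) (ltW eta0) gin)).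
  by rewrite lee_fin; near: n; exact: far_rate.
have b4 : (mu_ext (P n) B4 <= (3 * Q%:R / n%:R)%:E)%E.
  apply: (le_trans (bad_local ef tm subA' t0in t0_prob (rho01 n) (sample n) D0 nR (ltW c_gt0)
    (lexx _) rows)).
  by rewrite lee_fin -/K KE; near: n; exact: local_rate_bound.
have b5 : (mu_ext (P n) B5 <= (Q%:R ^+ 2 * 3 / n%:R)%:E)%E.
  have d1t : 0 < d1 <= tau by rewrite d10.
  apply: (le_trans (bad_blocks ef tm subA' t0in t0_prob (rho01 n) (sample n) c_gt0 d1t cn2)).
  rewrite lee_fin -/br (_ : c ^+ 2 * n%:R ^+ 2 * br = n%:R ^+ 2 * (c ^+ 2 * br)); last by ring.
  near: n; apply: blocks_rate => //.
  by rewrite mulr_gt0// exprn_gt0.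
have b6 : mu_ext (P n) B6 = 0%E by exact: observed_density_positive ef (sample n).
apply: (le_trans (le_mu_ext _ sub)).
have oU (E1 E2 : set (T n)) : (mu_ext (P n) (E1 `|` E2) <= mu_ext (P n) E1 + mu_ext (P n) E2)%E.
  exact: outer_measureU2.
apply: (le_trans (oU _ _)); rewrite b6 adde0.
rewrite (_ : _ / n%:R = 2 * Q%:R * (8 / ea ^+ 2) / n%:R + 2 / n%:R + #|I|%:R / n%:R +
  3 * Q%:R / n%:R + Q%:R ^+ 2 * 3 / n%:R); last by rewrite -!mulrDl.
rewrite !EFinD.
apply: (le_trans (oU _ _)); apply: leeD; last exact: b5.
apply: (le_trans (oU _ _)); apply: leeD; last exact: b4.
apply: (le_trans (oU _ _)); apply: leeD; last exact: b3.
by apply: (le_trans (oU _ _)); apply: leeD.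
Unshelve. all: by end_near. Qed.

Lemma sqrt_rate_contradiction {R : realType} (N e D : R) : 1 <= N -> 0 < e ->
  24 / e ^+ 2 <= N -> N / 4 * D ^+ 2 <= 6 * (N ^+ 2)^-1 -> ~ (e * (Num.sqrt N)^-1 < `|D|).
Proof.
move=> N1 e0 big acc lt.
have N0 : 0 < N by lra.
have e20 : 0 < e ^+ 2 by rewrite exprn_gt0.
have N20 : 0 < N ^+ 2 by rewrite exprn_gt0.
have : (e * (Num.sqrt N)^-1) ^+ 2 < `|D| ^+ 2.
  by rewrite ltrXn2r// ?nnegrE// mulr_ge0 ?invr_ge0 ?sqrtr_ge0// ltW.
rewrite real_normK ?num_real// exprMn exprVn sqr_sqrtr ?(ltW N0)// ltr_pdivrMr// => h1.
move: acc; rewrite ler_pdivlMr// => acc.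
move: big; rewrite ler_pdivrMr// => big.
have h2 : e ^+ 2 * N ^+ 2 < D ^+ 2 * N * N ^+ 2 by rewrite ltr_pM2r.
have h3 : 1 * 24 <= N * (N * e ^+ 2) by apply: ler_pM.
have : (0 : R) < 0 by lra.
by rewrite ltxx.
Qed.

Lemma inverse_rate_contradiction {R : realType} (N e D m : R) : 1 <= N -> 0 < e -> 0 < m ->
  12 / (m * e ^+ 2) <= N -> N * (m / 2 * D ^+ 2) <= 6 * (N ^+ 2)^-1 -> ~ (e * N^-1 < `|D|).
Proof.
move=> N1 e0 m0 big acc lt.
have N0 : 0 < N by lra.
have e20 : 0 < e ^+ 2 by rewrite exprn_gt0.
have N20 : 0 < N ^+ 2 by rewrite exprn_gt0.
have : (e * N^-1) ^+ 2 < `|D| ^+ 2.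
  by rewrite ltrXn2r// ?nnegrE// mulr_ge0 ?invr_ge0// ltW.
rewrite real_normK ?num_real// exprMn exprVn ltr_pdivrMr// => h1.
move: acc; rewrite ler_pdivlMr// => acc.
move: big; rewrite ler_pdivrMr ?mulr_gt0// => big.
have h2 : (N * m) * e ^+ 2 < (N * m) * (D ^+ 2 * N ^+ 2) by rewrite ltr_pM2l// mulr_gt0.
have : (0 : R) < 0 by lra.
by rewrite ltxx.
Qed.

Theorem corollary5p1 (R : realType) (Q : nat) (Q_gt0 : (0 < Q)%N)
    (mu : {measure set R -> \bar R}) (A : set R) (b psi : R -> R)
    (expfam_phi : expfam mu A b psi)
    (Theta : set (param R Q))
    (Theta_prob : forall t, Theta t -> prob_vector t.1)
    (thetas : param R Q)
    (A1 : compact_param_space A Theta)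
    (A2 : param_interior Theta thetas)
    (A3 : set_inj A (fun p y => phi b psi y p))
    (A4 : distinct_mean_degrees psi thetas)
    (rho : nat -> R)
    (rho01 : forall n, 0 <= rho n <= 1)
    (rho_large : n%:R * rho n / ln n%:R @[n --> \oo] --> +oo)
    (d : nat -> measure_display) (T : forall n, measurableType (d n))
    (P : forall n, probability (T n) R)
    (zs : forall n, T n -> 'I_n -> 'I_Q)
    (y : forall n, T n -> 'I_n -> 'I_n -> R)
    (r : forall n, T n -> 'I_n -> 'I_n -> bool)
    (sample : forall n,
      sbm_dyad_sample (P n) mu b psi thetas (rho n) (zs n) (y n) (r n))
    (theta_mle : forall n, observation R n -> param R Q)
    (mle : forall n (w : T n),
      is_mle b psi Theta (observe (y n w) (r n w))
        (theta_mle n (observe (y n w) (r n w))))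
    (dflt : R) :
  exists s : forall n, observation R n -> 'S_Q,
    little_oP P
      (fun n w => let o := observe (y n w) (r n w) in
        alpha_hat (zs n w) - perm_alpha (s n o) (theta_mle n o).1)
      (fun n => (Num.sqrt n%:R)^-1)
    /\
    little_oP P
      (fun n w => let o := observe (y n w) (r n w) in
        pi_hat A psi dflt (y n w) (r n w) (zs n w)
          - perm_pi (s n o) (theta_mle n o).2)
      (fun n => n%:R^-1).
Proof.
have [delta0 [m [C [m0 uniq near_good]]]] := mle_error_probability Q_gt0 expfam_phi Theta_prob
  A1 A2 A4 rho01 rho_large sample mle dflt.
pose s n (o : observation R n) : 'S_Q :=
  odflt 1%g [pick s | close_param thetas delta0 (theta_mle n o) s].
pose bad n : set (T n) := [set w | ~ exists s : 'S_Q,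
  @accurate R Q n m thetas (alpha_hat (zs n w), pi_hat A psi dflt (y n w) (r n w) (zs n w))
    (theta_mle n (observe (y n w) (r n w))) delta0 s].
have good n w : ~ bad n w ->
    @accurate R Q n m thetas (alpha_hat (zs n w), pi_hat A psi dflt (y n w) (r n w) (zs n w))
      (theta_mle n (observe (y n w) (r n w))) delta0 (s n (observe (y n w) (r n w))).
  move=> /contrapT[s' acc]; rewrite /s; case: pickP => [s'' cs''|/(_ s')]; last first.
    by case: acc => ->.
  by rewrite /= (uniq _ _ _ cs'' acc.1).
have lim0 (k l : nat) (X : forall n, T n -> 'M[R]_(k, l)) (a : nat -> R) :
    (forall e, 0 < e -> \forall n \near \oo, forall w, ~ bad n w -> `|X n w| <= e * a n) ->
    little_oP P X a.
  move=> hX e e0.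
  apply: (@squeeze_cvge _ _ _ _ (cst 0%E) _ (fun n => (2 * `|C| * harmonic n)%:E)).
  - near=> n; apply/andP; split; first exact: mu_ext_ge0.
    have n0 : (0 < n)%N by near: n; exact: nbhs_infty_ge.
    have nR : 1 <= n%:R :> R by rewrite ler1n.
    have hn : forall w, ~ bad n w -> `|X n w| <= e * a n by near: n; exact: hX.
    have gn : (mu_ext (P n) (bad n) <= (C / n%:R)%:E)%E by near: n; exact: near_good.
    apply: (@le_trans _ _ (mu_ext (P n) (bad n))).
      apply: le_mu_ext => w /= eX; apply: contrapT => /hn.
      by rewrite leNgt eX.
    apply: (le_trans gn); rewrite lee_fin /harmonic/=.
    apply: (@le_trans _ _ (`|C| / n%:R)); first by rewrite ler_wpM2r ?invr_ge0// ler_norm.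
    have inv : n%:R^-1 <= 2 * n.+1%:R^-1 :> R.
      rewrite ler_pdivlMr ?ltr0n// mulrC ler_pdivrMr; last by lra.
      by rewrite -natr1; lra.
    by rewrite -mulrA mulrCA ler_wpM2l.
  - exact: cvg_cst.
  - apply: cvg_EFin; first exact: nearW.
    rewrite -(mulr0 (2 * `|C|)); apply: cvgM; first exact: cvg_cst.
    exact: cvg_harmonic.
exists s; split; apply: lim0 => e e0; near=> n => w /good[_ [acc1 acc2]];
  rewrite leNgt; apply/negP.
- have n0 : (0 < n)%N by near: n; exact: nbhs_infty_ge.
  have nR : 1 <= n%:R :> R by rewrite ler1n.
  have big : 24 / e ^+ 2 <= n%:R by near: n; exact: eventually_ge.
  have r0 : 0 <= e * (Num.sqrt n%:R)^-1 by rewrite mulr_ge0 ?invr_ge0 ?sqrtr_ge0// ltW.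
  move=> /(matrix_norm_gt r0)[i [q]]; rewrite ord1.
  have -> : (alpha_hat (zs n w) - perm_alpha (s n (observe (y n w) (r n w)))
      (theta_mle n (observe (y n w) (r n w))).1) 0 q =
      alpha_hat (zs n w) 0 q - (theta_mle n (observe (y n w) (r n w))).1 0
        (s n (observe (y n w) (r n w)) q) by rewrite !mxE.
  by rewrite distrC; exact: sqrt_rate_contradiction nR e0 big (acc1 q).
- have n0 : (0 < n)%N by near: n; exact: nbhs_infty_ge.
  have nR : 1 <= n%:R :> R by rewrite ler1n.
  have big : 12 / (m * e ^+ 2) <= n%:R by near: n; exact: eventually_ge.
  have r0 : 0 <= e * n%:R^-1 by rewrite mulr_ge0 ?invr_ge0// ltW.
  move=> /(matrix_norm_gt r0)[q [l]].
  have -> : (pi_hat A psi dflt (y n w) (r n w) (zs n w) -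
      perm_pi (s n (observe (y n w) (r n w))) (theta_mle n (observe (y n w) (r n w))).2) q l =
      pi_hat A psi dflt (y n w) (r n w) (zs n w) q l -
      (theta_mle n (observe (y n w) (r n w))).2 (s n (observe (y n w) (r n w)) q)
        (s n (observe (y n w) (r n w)) l) by rewrite !mxE.
  by rewrite distrC; exact: inverse_rate_contradiction nR e0 m0 big (acc2 q l).
Unshelve. all: by end_near. Qed.
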